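(* Let $n\ge 2$ and let $T:\mathbb{S}^2\to\mathbb{S}^n$ be a weakly circle-preserving map satisfying the following conditions. (1) The image $T(\mathbb{S}^2)$ is in circular general position in $\mathbb{S}^n$, i.e. for every circle $C\subset\mathbb{S}^n$ there are at least two points of $T(\mathbb{S}^2)$ not lying on $C$. (2) The image $T(\mathbb{S}^2)$ contains five or more distinct points. Then $T(\mathbb{S}^2)$ is a $2$-sphere in $\mathbb{S}^n$ and $T$ is a Möbius transformation (of $\mathbb{S}^2$ onto this $2$-sphere).
   Context: $\mathbb{S}^n$ is the unit sphere in $\mathbb{R}^{n+1}$. For $1\le m\le n$, an $m$-sphere in $\mathbb{S}^n$ is the intersection of $\mathbb{S}^n$ with an $(m+1)$-dimensional affine subspace of $\mathbb{R}^{n+1}$, provided the intersection contains more than one point; a circle is a $1$-sphere. A function $T:\mathbb{S}^2\to\mathbb{S}^n$ is weakly circle-preserving if for every circle $C\subset\mathbb{S}^2$ the image $T(C)$ is contained in some circle $C'\subset\mathbb{S}^n$; $T$ is not assumed injective, continuous or measurable. Identify $\mathbb{S}^m$ with $\mathbb{R}^m_\infty=\mathbb{R}^m\cup\{\infty\}$ by stereographic projection. The reflection (inversion) in the sphere $\{x\in\mathbb{R}^m:\|x-a\|=r\}$ is $\phi(x)=a+\left(\frac{r}{\|x-a\|}\right)^2(x-a)$ for $x\ne a,\infty$, with $\phi(a)=\infty$, $\phi(\infty)=a$; the reflection in a hyperplane of $\mathbb{R}^m$ is the usual Euclidean reflection, fixing $\infty$. A Möbius transformation of $\mathbb{S}^m$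 is a finite composition of such reflections (so orientation-reversing maps are included). A bijection $T$ from $\mathbb{S}^2$ onto a $2$-sphere $\Sigma\subset\mathbb{S}^n$ is called a Möbius transformation if, for a Möbius transformation $g$ of $\mathbb{S}^n$ carrying $\Sigma$ onto the standard copy $\{(x_0,x_1,x_2,0,\dots,0)\}\cap\mathbb{S}^n$ of $\mathbb{S}^2$, the map $g\circ T:\mathbb{S}^2\to\mathbb{S}^2$ is a Möbius transformation of $\mathbb{S}^2$ (this does not depend on the choice of $g$). *)

(* Defs.v *)
From HB Require Import structures.
From mathcomp Require Import all_boot all_order all_algebra.
From mathcomp Require Import boolp classical_sets functions cardinality reals.
Set Implicit Arguments.
Unset Strict Implicit.
Unset Printing Implicit Defensive.
Import Order.TTheory GRing.Theory Num.Theory.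
Local Open Scope ring_scope.
Local Open Scope classical_set_scope.

Definition dot (R : realType) (m : nat) (u v : 'rV[R]_m) : R :=
  \sum_(i < m) u 0 i * v 0 i.

(* MathComp-Analysis equips 'rV[R]_m with the sup norm, so the Euclidean norm
   is introduced separately. *)
Definition enorm (R : realType) (m : nat) (u : 'rV[R]_m) : R :=
  Num.sqrt (dot u u).

Definition sphere (R : realType) (n : nat) : Type :=
  {x : 'rV[R]_n.+1 | enorm x == 1}.

(* The affine subspace is p + V, where V is its direction. *)
Definition is_msphere (R : realType) (n m : nat) (S : set (sphere R n)) : Prop :=
  [/\ (1 <= m <= n)%N,
      exists (p : 'rV[R]_n.+1) (V : {vspace 'rV[R]_n.+1}),
        \dim V = m.+1 /\ S = [set x : sphere R n | val x - p \in V]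
    & exists x y, [/\ S x, S y & x <> y]].

Definition is_circle (R : realType) (n : nat) (C : set (sphere R n)) : Prop :=
  is_msphere 1 C.

Definition weakly_circle_preserving (R : realType) (n : nat)
    (T : sphere R 2 -> sphere R n) : Prop :=
  forall C, is_circle C -> exists C', is_circle C' /\ T @` C `<=` C'.

Definition circular_general_position (R : realType) (n : nat)
    (A : set (sphere R n)) : Prop :=
  forall C, is_circle C ->
    exists x y, [/\ A x, A y, x <> y, ~ C x & ~ C y].

(* [None] is the point at infinity. *)
Definition Rinfty (R : realType) (m : nat) : Type := option 'rV[R]_m.

Definition inversion (R : realType) (m : nat) (a : 'rV[R]_m) (r : R)
    (x : Rinfty R m) : Rinfty R m :=
  match x with
  | None => Some a
  | Some x =>
      if x == a then None
      else Some (a + (r / enorm (x - a)) ^+ 2 *: (x - a))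
  end.

(* Reflection in the hyperplane of equation dot x u = c. *)
Definition hyperplane_reflection (R : realType) (m : nat) (u : 'rV[R]_m) (c : R)
    (x : Rinfty R m) : Rinfty R m :=
  match x with
  | None => None
  | Some x => Some (x - (2 * (dot x u - c) / dot u u) *: u)
  end.

Definition is_reflection (R : realType) (m : nat)
    (phi : Rinfty R m -> Rinfty R m) : Prop :=
  (exists a r, 0 < r /\ phi = inversion a r) \/
  (exists u c, u <> 0 /\ phi = hyperplane_reflection u c).

Inductive moebius_Rinfty (R : realType) (m : nat) :
    (Rinfty R m -> Rinfty R m) -> Prop :=
  | moebius_id : moebius_Rinfty id
  | moebius_comp phi psi : is_reflection phi -> moebius_Rinfty psi ->
      moebius_Rinfty (phi \o psi).

(* Projection from the pole (0, .., 0, 1) onto the equatorial hyperplane. *)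
Definition stereographic (R : realType) (m : nat) (x : sphere R m) :
    Rinfty R m :=
  if val x 0 ord_max == 1 then None
  else Some (\row_(i < m)
               (val x 0 (widen_ord (leqnSn m) i) / (1 - val x 0 ord_max))).

Definition is_moebius (R : realType) (m : nat) (g : sphere R m -> sphere R m) :
    Prop :=
  exists phi, moebius_Rinfty phi /\
    forall x, stereographic (g x) = phi (stereographic x).

Definition standard_2sphere (R : realType) (n : nat) : set (sphere R n) :=
  [set x : sphere R n | forall i : 'I_n.+1, (3 <= i)%N -> val x 0 i = 0].

(* (x_0, x_1, x_2) |-> (x_0, x_1, x_2, 0, .., 0); only meaningful for n >= 2. *)
Definition embed3 (R : realType) (n : nat) (x : 'rV[R]_3) : 'rV[R]_n.+1 :=
  \row_(j < n.+1) (if (j < 3)%N then x 0 (inord j) else 0).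

(* h is g \o T read as a self-map of the 2-dimensional sphere. *)
Definition is_moebius_onto (R : realType) (n : nat)
    (T : sphere R 2 -> sphere R n) (Sigma : set (sphere R n)) : Prop :=
  set_bij setT Sigma T /\
  exists (g : sphere R n -> sphere R n) (h : sphere R 2 -> sphere R 2),
    [/\ is_moebius g, g @` Sigma = @standard_2sphere R n, is_moebius h
      & forall x, val (g (T x)) = embed3 n (val (h x))].

(* Main.v *)
Require Import Defs.
From HB Require Import structures.
From mathcomp Require Import all_boot all_order all_algebra.
From mathcomp Require Import boolp classical_sets functions cardinality reals.
From mathcomp Require Import ring lra.
Set Implicit Arguments.
Unset Strict Implicit.
Unset Printing Implicit Defensive.
Import Order.TTheory GRing.Theory Num.Theory.
Local Open Scope ring_scope.
Local Open Scope classical_set_scope.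

(** Stereographic projection turns [T] into a map from [Rinfty R 2] to
[Rinfty R n] that sends concyclic quadruples to concyclic quadruples.
Concyclicity is a linear condition: if x is represented by the isotropic vector
(x, |x|^2, 1) of a Lorentz space, four points are concyclic iff their vectors are
linearly dependent, the circles are the sections of the light cone by
3-dimensional subspaces, and Moebius maps act linearly.  So [T] may be composed
with Moebius maps on both sides.  Think of [T] as a colouring of the plane by the
points of its image.

The basic tool is the power of a point: on two lines through 0, the points x1, x2
of the first one and y1, y2 of the second one are concyclic when x1 x2 = y1 y2, so
that every pair of points of one line induces an involution of the other.

First, the image is infinite, and so is the set of colours of every circle with at
least three colours.  The key is [moved_pair]: if a circle has finitely many
colours, at least three, then two colours d, e off it are concyclic with some two
of its colours.  Otherwise the involutions induced by d and e preserve the colours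
of the circle, so that a group of multiplications permutes these colours; two
choices of the poles 0 and infinity give two such groups, and counting produces a
product of two permutations that fixes no colour although the real map inducing it
has a fixed point ([two_poles_absurd]).  If the image is finite, the
Sylvester-Gallai theorem provides a circle meeting it in three points exactly;
with [moved_pair], every further colour then belongs to a Pasch configuration of
six colours and four such circles, and this confines each of the six colours to a
circle of the plane ([pasch_circles]), while the plane is not a finite union of
circles ([finite_absurd]).  If the image is infinite, a circle with finitely many
colours would confine the other colours too much ([circle_infinite]).

Next, normalize [T] to fix 0, 1 and infinity on a line.  The power of a point in
both spaces shows that the induced map f from R to R and infinity satisfies
f (x y / z) = f x f y / f z as long as the values are finite and nonzero
([swap_hom]); the same holds around other origins and after inversion.  This makes
f a place of the field R with values in R, and such a place is the identity
because nonnegative reals are squares and R is archimedean ([place_id]).  Hence [T]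
is affine on lines, it is a similarity of the plane ([similarity]), and it becomes
the standard embedding of the plane after a Moebius map of the target
([standardize]).  Reading this on the spheres gives the theorem. *)

(** * Places of the field of real numbers *)

Section Place.
Variables (R : realType) (f : R -> option R).
Hypothesis f0 : f 0 = Some 0.
Hypothesis f1 : f 1 = Some 1.
Hypothesis fH : forall c x y z kc kx ky kz,
  f c = Some kc -> f x = Some kx -> f y = Some ky -> f z = Some kz ->
  kx != kc -> ky != kc -> kz != kc ->
  f (c + (x - c) * (y - c) / (z - c)) =
    Some (kc + (kx - kc) * (ky - kc) / (kz - kc)).
Hypothesis finf : forall s : seq R, exists x k, f x = Some k /\ k \notin s.

Lemma place_neq x y a b : f x = Some a -> f y = Some b -> a != b -> x - y != 0.
Proof.
by move=> fx fy ab; rewrite subr_eq0; apply: contra_neq ab => xy; move: fx; rewrite xy fy => -[].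
Qed.

Lemma place_unit x a : f x = Some a -> a != 0 -> x != 0.
Proof. by move=> fx a0; have := place_neq fx f0 a0; rewrite subr0. Qed.

(** The suffix U marks finite nonzero values, the units of the valuation ring.
    *)
Lemma placeMU x y a b : f x = Some a -> f y = Some b -> a != 0 -> b != 0 ->
  f (x * y) = Some (a * b).
Proof.
move=> fx fy a0 b0; have := fH f0 fx fy f1 a0 b0 (oner_neq0 R).
by rewrite !subr0 !add0r !divr1.
Qed.

Lemma placeVU x a : f x = Some a -> a != 0 -> f x^-1 = Some a^-1.
Proof.
move=> fx a0; have := fH f0 f1 f1 fx (oner_neq0 R) (oner_neq0 R) a0.
by rewrite !subr0 !add0r !mul1r.
Qed.

(** The law at the centre c shows that quotients of increments from c are
    preserved. That the increments themselves are multiplied by the value l of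
    lam follows by comparison with two points w1, w2 such that w2 - c = lam (w1
    - c) and whose values have increments of ratio l: the images of w and lam w
    under the law at an auxiliary centre c0. *)
Lemma place_dilation c lam t kc l kt :
  f c = Some kc -> f lam = Some l -> f t = Some kt -> l != 0 -> kt != kc ->
  f (c + lam * (t - c)) = Some (kc + l * (kt - kc)).
Proof.
move=> fc fl ft l0 ktc.
have [c0 [k0 [fc0]]] := finf [:: 0; kc].
rewrite !inE negb_or => /andP[k00 k0c].
have [w [kw [fw]]] := finf [:: 0; k0; k0 / l].
rewrite !inE !negb_or => /and3P[kw0 kwk kwl].
have flw := placeMU fl fw l0 kw0.
have k0c' : kc != k0 by rewrite eq_sym.
have k00' : 0 != k0 by rewrite eq_sym.
have lwk : l * kw != k0.
  by apply: contra_neq kwl => <-; rewrite mulrAC divff // mul1r.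
have := fH fc0 fc fw f0 k0c' kwk k00'.
have := fH fc0 fc flw f0 k0c' lwk k00'.
set w2 := c0 + (c - c0) * (lam * w - c0) / (0 - c0).
set w1 := c0 + (c - c0) * (w - c0) / (0 - c0).
set v2 := k0 + _; set v1 := k0 + _ => fw2 fw1.
have c00 : c0 != 0 by exact: place_unit fc0 k00.
have E1 : w1 - c = (c0 - c) * w / c0 by rewrite /w1; field.
have E2 : w2 - c = lam * (w1 - c) by rewrite E1 /w2; field.
have V1 : v1 - kc = (k0 - kc) * kw / k0 by rewrite /v1; field.
have V2 : v2 - kc = l * (v1 - kc) by rewrite V1 /v2; field.
have v1c : v1 != kc.
  rewrite -subr_eq0 V1 mulf_neq0 ?invr_neq0 // mulf_neq0 // subr_eq0 //.
have v2c : v2 != kc by rewrite -subr_eq0 V2 mulf_neq0 // subr_eq0.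
have := fH fc fw2 ft fw1 v2c ktc v1c.
rewrite V2 E2 (_ : lam * (w1 - c) * (t - c) / (w1 - c) = lam * (t - c)); last first.
  by field; exact: place_neq fw1 fc v1c.
rewrite (_ : l * (v1 - kc) * (kt - kc) / (v1 - kc) = l * (kt - kc)) //.
by field; rewrite subr_eq0.
Qed.

Lemma place_1B x a : f x = Some a -> a != 0 -> f (1 - x) = Some (1 - a).
Proof.
move=> fx a0; have := place_dilation f1 fx f0 a0 _.
by rewrite !sub0r !mulrN1; apply; rewrite eq_sym oner_neq0.
Qed.

(** A sum is the image of a point under a dilation, t + x = c + lam (t / lam -
    c) with c = x / (1 - lam), and lam is free enough to avoid coincidences. *)
Lemma placeDU t x a b : f t = Some a -> f x = Some b -> a != 0 -> b != 0 ->
  f (t + x) = Some (a + b).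
Proof.
move=> ft fx a0 b0.
have [lam [l [fl]]] := finf [:: 0; 1; a / (b + a)].
rewrite !inE !negb_or => /and3P[l0 l1 lab].
have l1' : 1 - l != 0 by rewrite subr_eq0 eq_sym.
have fl1 := place_1B fl l0.
have lam0 := place_unit fl l0.
have lam1 := place_unit fl1 l1'.
have ftl := placeMU ft (placeVU fl l0) a0 (invr_neq0 l0).
have fc := placeMU fx (placeVU fl1 l1') b0 (invr_neq0 l1').
have ne : a / l != b / (1 - l).
  apply/eqP => E; have {E} : a * (1 - l) = b * l.
    have := congr1 (fun u => u * (l * (1 - l))) E.
    have -> : a / l * (l * (1 - l)) = a * (1 - l) by field.
    by have -> : b / (1 - l) * (l * (1 - l)) = b * l by field.
  move=> E; have E2 : l * (b + a) = a by rewrite mulrDr (mulrC l b) -E; ring.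
  have [ba|ba] := eqVneq (b + a) 0; first by move: a0; rewrite -E2 ba mulr0 eqxx.
  by by move/eqP: lab; apply; rewrite -[X in X / _]E2 mulfK.
have := place_dilation fc fl ftl l0 ne.
have -> : x / (1 - lam) + lam * (t / lam - x / (1 - lam)) = t + x by field; rewrite ?lam0 ?lam1.
by have -> : b / (1 - l) + l * (a / l - b / (1 - l)) = a + b by field; rewrite ?l0 ?l1'.
Qed.

Lemma place2 : f 2 = Some 2.
Proof. by have := placeDU f1 f1 (oner_neq0 R) (oner_neq0 R). Qed.

Lemma placeN1 : f (-1) = Some (-1).
Proof.
have := place_1B place2 _; rewrite (_ : 1 - 2 = -1) ; last by ring.
by apply; rewrite pnatr_eq0.
Qed.

Lemma placeNU x a : f x = Some a -> a != 0 -> f (- x) = Some (- a).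
Proof.
move=> fx a0; rewrite -mulN1r -[- a]mulN1r; apply: placeMU placeN1 fx _ a0.
by rewrite oppr_eq0 oner_neq0.
Qed.

(** By z y = 1 + z (y - 1) - (1 - z), the product is a sum of numbers of nonzero
    value, unless z has value 1; such a factor is written as a product of two
    others. *)
Lemma placeMU0 x y a : f x = Some a -> a != 0 -> f y = Some 0 -> f (x * y) = Some 0.
Proof.
move=> fx a0 fy.
have key z k : f z = Some k -> k != 0 -> k != 1 -> f (z * y) = Some 0.
  move=> fz k0 k1.
  have k1' : 1 - k != 0 by rewrite subr_eq0 eq_sym.
  have := place_dilation f1 fz fy k0 _; rewrite eq_sym oner_neq0 => /(_ isT) ft.
  have ft0 : 1 + k * (0 - 1) != 0 by rewrite sub0r mulrN1.
  have fx' := placeNU (place_1B fz k0) k1'.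
  have := placeDU ft fx' ft0 _; rewrite oppr_eq0 => /(_ k1').
  rewrite (_ : 1 + z * (y - 1) + - (1 - z) = z * y); last by ring.
  by rewrite (_ : 1 + k * (0 - 1) + - (1 - k) = 0); last by ring.
have [a1|a1] := eqVneq a 1; last exact: key fx a0 a1.
have [m [k [fm]]] := finf [:: 0; 1].
rewrite !inE !negb_or => /andP[k0 k1].
have fV := placeMU fx (placeVU fm k0) a0 (invr_neq0 k0).
have aV0 : a / k != 0 by rewrite mulf_neq0 ?invr_neq0.
have aV1 : a / k != 1.
  by rewrite a1 mul1r; apply: contra_neq k1 => kv; rewrite -[k]invrK kv invr1.
have e1 := key _ _ fV aV0 aV1.
(* reuse key with x / m * y in place of y *)
have := place_dilation f1 fm e1 k0 _; rewrite eq_sym oner_neq0 => /(_ isT) ft.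
have k1' : 1 - k != 0 by rewrite subr_eq0 eq_sym.
have ft0 : 1 + k * (0 - 1) != 0 by rewrite sub0r mulrN1.
have fx' := placeNU (place_1B fm k0) k1'.
have := placeDU ft fx' ft0 _; rewrite oppr_eq0 => /(_ k1').
rewrite (_ : 1 + m * (x / m * y - 1) + - (1 - m) = x * y); last first.
  by field; exact: place_unit fm k0.
by rewrite (_ : 1 + k * (0 - 1) + - (1 - k) = 0); last by ring.
Qed.

(** Here (1 - m) (1 + y) = 1 + m ((1 - m) y / m - 1) is the image of a point of
    value 0 under a dilation of centre 1. *)
Lemma place_1D0 y : f y = Some 0 -> f (1 + y) = Some 1.
Proof.
move=> fy; have [m [k [fm]]] := finf [:: 0; 1].
rewrite !inE !negb_or => /andP[k0 k1].
have k1' : 1 - k != 0 by rewrite subr_eq0 eq_sym.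
have f1m := place_1B fm k0.
have m0 := place_unit fm k0; have m1 := place_unit f1m k1'.
have k1N : k^-1 != 0 by rewrite invr_neq0.
have fc := placeMU f1m (placeVU fm k0) k1' k1N.
have fy' := placeMU0 fc (mulf_neq0 k1' k1N) fy.
have := place_dilation f1 fm fy' k0 _; rewrite eq_sym oner_neq0 => /(_ isT) ft.
have ft0 : 1 + k * (0 - 1) != 0 by rewrite sub0r mulrN1.
have := placeMU ft (placeVU f1m k1') ft0 (invr_neq0 k1').
rewrite (_ : (1 + m * _) / _ = 1 + y); last by field; rewrite ?m0 ?m1.
by rewrite (_ : (1 + k * _) / _ = 1) //; field.
Qed.

Lemma placeM x y a b : f x = Some a -> f y = Some b -> f (x * y) = Some (a * b).
Proof.
move=> fx fy; have [a0|a0] := eqVneq a 0; have [b0|b0] := eqVneq b 0.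
- rewrite b0 mulr0; move: fx fy; rewrite a0 b0 => fx fy.
  have F := place_1D0 fx; have G := place_1D0 fy.
  (* xy = (1+x)(1+y) - 1 - x - y *)
  have H1 := placeMU0 F (oner_neq0 R) fy.
  have N := placeDU (place_1D0 H1) (placeNU G (oner_neq0 R)) (oner_neq0 R) _.
  have := N; rewrite oppr_eq0 oner_neq0 => /(_ isT).
  by rewrite subrr (_ : 1 + (1 + x) * y + - (1 + y) = x * y) //; ring.
- by move: fx; rewrite a0 mul0r mulrC => fx; exact: placeMU0 fy b0 fx.
- by move: fy; rewrite b0 mulr0 => fy; exact: placeMU0 fx a0 fy.
- exact: placeMU.
Qed.

Lemma placeN x a : f x = Some a -> f (- x) = Some (- a).
Proof. by move=> fx; rewrite -mulN1r -[- a]mulN1r; apply: placeM placeN1 fx. Qed.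

Lemma placeD x y a b : f x = Some a -> f y = Some b -> f (x + y) = Some (a + b).
Proof.
have key u v c : f u = Some c -> c != 0 -> f v = Some 0 -> f (u + v) = Some c.
  move=> fu c0 fv; have u0 := place_unit fu c0.
  have fuv := placeM (placeVU fu c0) fv; rewrite mulr0 in fuv.
  have := placeM fu (place_1D0 fuv).
  by rewrite mulr1 mulrDr mulr1 mulrA divff // mul1r.
move=> fx fy; have [a0|a0] := eqVneq a 0; have [b0|b0] := eqVneq b 0.
- move: fx fy; rewrite a0 b0 addr0 => fx fy.
  have := key _ _ _ (place_1D0 fx) (oner_neq0 R) fy => H.
  have := placeDU H placeN1 (oner_neq0 R) _; rewrite oppr_eq0 oner_neq0 => /(_ isT).
  by rewrite subrr (_ : 1 + x + y + -1 = x + y) //; ring.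
- by move: fx; rewrite a0 add0r addrC => fx; exact: key fy b0 fx.
- by move: fy; rewrite b0 addr0 => fy; exact: key fx a0 fy.
- exact: placeDU.
Qed.

Lemma place_nat n : f n%:R = Some n%:R.
Proof. by elim: n => // n IH; rewrite -!natr1; apply: placeD IH f1. Qed.

End Place.

Section PlaceReal.
Variables (R : realType) (f : R -> option R).
(** The map x |-> 1 / f (1 / x), that is, f read around infinity. *)
Definition dual_place (x : R) : option R :=
  if x == 0 then Some 0 else
  if f x^-1 is Some v then if v == 0 then None else Some v^-1 else Some 0.

(** [None] is the value infinity. For c = kc = 0 the law reads f (x y / z) = f x
    f y / f z, and the general case is its conjugate under the translations that
    move c and kc to 0. *)
Definition mult_at_poles (h : R -> option R) :=
  forall c x y z kc kx ky kz,
  h c = Some kc -> h x = Some kx -> h y = Some ky -> h z = Some kz ->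
  kx != kc -> ky != kc -> kz != kc ->
  h (c + (x - c) * (y - c) / (z - c)) =
    Some (kc + (kx - kc) * (ky - kc) / (kz - kc)).
Definition inf_range (h : R -> option R) :=
  forall s : seq R, exists x k, h x = Some k /\ k \notin s.

Hypothesis f0 : f 0 = Some 0.
Hypothesis f1 : f 1 = Some 1.
Hypothesis fH : mult_at_poles f.
Hypothesis finf : inf_range f.
Hypothesis dH : mult_at_poles dual_place.

Lemma dual_inf : inf_range dual_place.
Proof.
move=> s; have [x [k [fx]]] := finf (0 :: [seq v^-1 | v <- s]).
rewrite inE negb_or => /andP[k0 ks].
exists x^-1, k^-1; split; last first.
  by apply: contra ks => ks; apply/mapP; exists k^-1; rewrite ?invrK.
have x0 := place_unit f0 fx k0.
by rewrite /dual_place invr_eq0 (negPf x0) invrK fx (negPf k0).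
Qed.

(** If both x and 1 / x had the value infinity, both would have the value 0
    under the dual place, which is multiplicative. *)
Lemma place_none_inv x : f x = None -> f x^-1 = Some 0.
Proof.
move=> fx; have x0 : x != 0 by apply/eqP => x0; move: fx; rewrite x0 f0.
have d0 : dual_place 0 = Some 0 by rewrite /dual_place eqxx.
have d1 : dual_place 1 = Some 1.
  by rewrite /dual_place oner_eq0 invr1 f1 oner_eq0 invr1.
case E : (f x^-1) => [v|].
  have [-> //|v0] := eqVneq v 0.
  by have := placeVU f0 f1 fH E v0; rewrite invrK fx.
have dx : dual_place x = Some 0 by rewrite /dual_place (negPf x0) E.
have dx' : dual_place x^-1 = Some 0.
  by rewrite /dual_place invr_eq0 (negPf x0) invrK fx.
have := placeM d0 d1 dH dual_inf dx dx'.
by rewrite mulr0 divff // d1 => -[/eqP]; rewrite oner_eq0.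
Qed.

(** If x is a nonzero number of value 0 and n is large, n x^2 - 1 is positive,
    hence a square, but its value -1 is not a square. *)
Lemma place_ker x : f x = Some 0 -> x = 0.
Proof.
move=> fx; apply/eqP/negP => /negP x0.
have x2 : 0 < x ^+ 2 by rewrite lt_neqAle sqr_ge0 andbT eq_sym expf_neq0.
pose n := (Num.truncn (x ^+ 2)^-1).+1.
have nx : 1 < n%:R * x ^+ 2.
  have H : (x ^+ 2)^-1 < n%:R by rewrite truncnS_gt.
  by rewrite -[ltLHS](mulVf (lt0r_neq0 x2)) ltr_pM2r.
pose y := n%:R * x ^+ 2 - 1.
have y0 : 0 < y by rewrite subr_gt0.
have fy : f y = Some (- 1).
  have := placeD f0 f1 fH finf (placeM f0 f1 fH finf (place_nat f0 f1 fH finf n)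
     (placeM f0 f1 fH finf fx fx)) (placeN1 f0 f1 fH finf).
  by rewrite !mulr0 add0r -expr2.
have wy : Num.sqrt y * Num.sqrt y = y by rewrite -expr2 sqr_sqrtr // ltW.
case E : (f (Num.sqrt y)) => [v|].
  have := placeM f0 f1 fH finf E E; rewrite wy fy => -[] H.
  by have := sqr_ge0 v; rewrite expr2 -H oppr_ge0 ler10.
have {}E := place_none_inv E.
have := placeM f0 f1 fH finf E E; rewrite -invfM wy.
have N1 : -1 != 0 :> R by rewrite oppr_eq0 oner_neq0.
by rewrite (placeVU f0 f1 fH fy N1) mulr0 => -[/eqP]; rewrite invr_eq0 (negPf N1).
Qed.

Lemma place_total x : exists v, f x = Some v.
Proof.
case E : (f x) => [v|]; first by exists v.
have /place_ker/eqP := place_none_inv E; rewrite invr_eq0 => /eqP x0.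
by move: E; rewrite x0 f0.
Qed.

Lemma place_ge0 x v : f x = Some v -> 0 <= x -> 0 <= v.
Proof.
move=> fx x0; have [w fw] := place_total (Num.sqrt x).
have := placeM f0 f1 fH finf fw fw.
by rewrite -expr2 sqr_sqrtr // fx => -[->]; rewrite -expr2 sqr_ge0.
Qed.

(** A place that is finite everywhere preserves sums, the order and the natural
    numbers; as R is archimedean, it is the identity. *)
Lemma place_id x : f x = Some x.
Proof.
have key y w : f y = Some w -> 0 <= y -> y <= w.
  move=> fy y0; rewrite leNgt; apply/negP => wy.
  have d0 : 0 < y - w by rewrite subr_gt0.
  pose n := (Num.truncn (y - w)^-1).+1.
  have nd : 1 < n%:R * (y - w).
    have H : (y - w)^-1 < n%:R by rewrite truncnS_gt.
    by rewrite -[ltLHS](mulVf (lt0r_neq0 d0)) ltr_pM2r.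
  have ny0 : 0 <= n%:R * y by rewrite mulr_ge0.
  pose m := Num.truncn (n%:R * y).
  have /andP[m1 m2] : m%:R <= n%:R * y < m.+1%:R by exact: truncn_itv.
  have := place_ge0 (placeD f0 f1 fH finf
     (placeM f0 f1 fH finf (place_nat f0 f1 fH finf n) fy)
     (placeN f0 f1 fH finf (place_nat f0 f1 fH finf m))).
  rewrite !subr_ge0 => /(_ m1) mw.
  have : n%:R * y < 1 + n%:R * w.
    by apply: lt_le_trans m2 _; rewrite -natr1 addrC lerD2l.
  rewrite -ltrBlDr -mulrBr => H; by move: (lt_trans nd H); rewrite ltxx.
have key2 y w : f y = Some w -> 0 <= y -> w = y.
  move=> fy y0; apply/eqP; rewrite eq_le (key y w fy y0) andbT.
  pose n := (Num.truncn y).+1.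
  have yn : y <= n%:R by rewrite ltW // truncnS_gt.
  have := key _ _ (placeD f0 f1 fH finf (place_nat f0 f1 fH finf n)
    (placeN f0 f1 fH finf fy)).
  by rewrite subr_ge0 => /(_ yn); rewrite lerD2l lerN2.
have [v fx] := place_total x; rewrite fx; congr Some.
have [x0|x0] := leP 0 x; first exact: key2.
apply: oppr_inj; apply: key2 (placeN f0 f1 fH finf fx) _.
by rewrite oppr_ge0 ltW.
Qed.
End PlaceReal.

(** * The power of a point: algebra of two lines *)

Ltac fieldx := field; repeat (apply/andP; split); assumption.

(** F and G are the coordinates of the colours along two lines through 0, where
    the coordinate 0 stands for both of the colours 0 and infinity. The points
    x1, x2 of the first line are concyclic with y and x1 x2 / y on the second
    one: the colours of the latter coincide, or the powers of 0 agree. *)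
Definition swap_rel (R : realType) (F G : R -> R) := forall x1 x2 y,
  F x1 != 0 -> F x2 != 0 -> F x1 != F x2 -> G y != 0 ->
  G (x1 * x2 / y) != 0 /\
  (G (x1 * x2 / y) = G y \/ G y * G (x1 * x2 / y) = F x1 * F x2).

Definition inf_values (R : realType) (F : R -> R) :=
  forall s : seq R, exists2 x, F x != 0 & F x \notin s.

(** The composite of the swaps with (y', y2) and (y, y2) is the multiplication
    by y / y'. If it moved the colour of x, the new value would be G y G y2 / F
    x for all admissible y2, although G has many values. *)
Lemma same_value_trivial (R : realType) (F G : R -> R) :
  F 0 = 0 -> G 0 = 0 ->
  swap_rel G F -> inf_values G ->
  forall y y' x, G y != 0 -> G y = G y' -> F x != 0 -> F (y / y' * x) = F x.
Proof.
move=> F0 G0 RG iG y y' x Gy E Fx.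
have nz z : G z != 0 -> z != 0 by apply: contra_neq => ->.
have Gy' : G y' != 0 by rewrite -E.
have [x0 y0 y'0] : [/\ x != 0, y != 0 & y' != 0].
  by split; [apply: contra_neq Fx => -> | exact: nz | exact: nz].
have key y2 : G y2 != 0 -> G y2 != G y ->
   F (y / y' * x) = F x \/ F x * F (y / y' * x) = G y * G y2.
  move=> G2 ne; have y20 := nz _ G2.
  have ne' : G y' != G y2 by rewrite -E eq_sym.
  have [Fz Hz] := RG y' y2 x Gy' G2 ne' Fx.
  have ne'' : G y != G y2 by rewrite eq_sym.
  have [_ ] := RG y y2 _ Gy G2 ne'' Fz.
  have -> : y * y2 / (y' * y2 / x) = y / y' * x by fieldx.
  case: Hz => Hz [] Hw.
  - by left; rewrite Hw.
  - by right; rewrite -Hz.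
  - by right; rewrite Hw Hz E.
  - by left; apply: (mulfI Fz); rewrite Hw E -Hz mulrC.
have [y2 G2] := iG [:: G y]; rewrite inE => n2.
have [y3 G3] := iG [:: G y; G y2]; rewrite !inE negb_or => /andP[n3 n32].
have [//|H2] := key y2 G2 n2; have [//|H3] := key y3 G3 n3.
by move: H2; rewrite H3 => /(mulfI Gy) H; rewrite H eqxx in n32.
Qed.

Section Hom.
Variables (R : realType) (F G : R -> R).
Hypotheses (F0 : F 0 = 0) (G0 : G 0 = 0).
Hypotheses (R1 : swap_rel F G) (R2 : swap_rel G F).
Hypotheses (iF : inf_values F) (iG : inf_values G).

Let Fn z : F z != 0 -> z != 0. Proof. by apply: contra_neq => ->. Qed.
Let Gn z : G z != 0 -> z != 0. Proof. by apply: contra_neq => ->. Qed.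
Let trivF := same_value_trivial F0 G0 R2 iG.
Let trivG := same_value_trivial G0 F0 R1 iF.

(** Otherwise, for generic x3 and x4, the multiplication by x3 / x4 would
    multiply the values of G by F x3 / F x4, and its square would act trivially;
    so F x3 would be F x4 or - F x4. *)
Lemma swap_moves x1 x2 : F x1 != 0 -> F x2 != 0 -> F x1 != F x2 ->
  exists2 y, G y != 0 & G (x1 * x2 / y) != G y.
Proof.
move=> H1 H2 n12; apply: contrapT => nex.
have same y : G y != 0 -> G (x1 * x2 / y) = G y.
  by move=> Gy; apply/eqP; apply: contrapT => /negP ne; apply: nex; exists y.
have x10 := Fn H1; have x20 := Fn H2.
have inv x3 y : F x3 != 0 -> F x3 != F x1 -> F x3 != F x2 -> G y != 0 ->
    G (x3 / x2 * y) != 0 /\ G y * G (x3 / x2 * y) = F x1 * F x3.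
  move=> H3 n31 n32 Gy.
  have x30 := Fn H3; have y0 := Gn Gy.
  have Gy' := same y Gy; have Gy'0 : G (x1 * x2 / y) != 0 by rewrite Gy'.
  have n13 : F x1 != F x3 by rewrite eq_sym.
  have [] := R1 H1 H3 n13 Gy'0.
  have -> : x1 * x3 / (x1 * x2 / y) = x3 / x2 * y by fieldx.
  rewrite Gy' => N [] H; last by split.
  exfalso; have := @trivF _ _ x2 N H H2.
  have -> : x3 / x2 * y / y * x2 = x3 by fieldx.
  by move/eqP; rewrite (negPf n32).
have [x3 H3] := iF [:: F x1; F x2]; rewrite !inE negb_or => /andP[n31 n32].
have [x4 H4] := iF [:: F x1; F x2; F x3; - F x3].
rewrite !inE !negb_or => /and4P[n41 n42 n43 n4N].
have x30 := Fn H3; have x40 := Fn H4.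
have quot y : G y != 0 ->
    G (x3 / x4 * y) != 0 /\ G (x3 / x4 * y) = F x3 / F x4 * G y.
  move=> Gy; have y0 := Gn Gy.
  have Hr : G (x2 / x4 * y) != 0 /\ G y * G (x2 / x4 * y) = F x1 * F x4.
    have [|N H] := inv x4 (x1 * x2 / y) H4 n41 n42; first by rewrite same.
    have E : x1 * x2 / (x4 / x2 * (x1 * x2 / y)) = x2 / x4 * y by fieldx.
    have := same _ N; rewrite E => E'.
    by rewrite E' N -H same.
  have [N H] := Hr; have [N' H'] := inv x3 _ H3 n31 n32 N.
  have E : x3 / x2 * (x2 / x4 * y) = x3 / x4 * y by fieldx.
  rewrite E in N' H'; split => //.
  apply: (mulfI N); rewrite H'.
  have : F x1 = G y * G (x2 / x4 * y) / F x4 by rewrite H mulfK.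
  by move=> ->; field.
have [y Gy _] := iG [::].
have y0 := Gn Gy.
have [N1 E1] := quot y Gy; have [N2 E2] := quot _ N1.
have k10 : G (x1 * x2 / y) != 0 by rewrite same.
have k20 : G (x1 * x2 / (x3 / x4 * y)) != 0 by rewrite same.
(* the square of x3 / x4 acts trivially *)
have T1 := @trivF _ _ _ Gy (esym (same _ Gy)).
have T2 := @trivF _ _ _ k20 (same _ N1).
have N : F (y / (x1 * x2 / y) * x1) != 0 by rewrite T1.
have := T2 _ N; rewrite T1 //.
rewrite (_ : _ * (_ * x1) = (x4 / x3) ^+ 2 * x1); last by fieldx.
move=> E; have N4 : F ((x4 / x3) ^+ 2 * x1) != 0 by rewrite E.
have := @trivG _ _ _ H1 (esym E) Gy.
rewrite (_ : _ * y = x3 / x4 * (x3 / x4 * y)); last by fieldx.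
rewrite E2 E1 mulrA -[RHS]mul1r => /(mulIf Gy) /eqP.
rewrite -expr2 sqrf_eq1 => /orP[] /eqP /(congr1 (fun t => t * F x4)).
  by rewrite mulfVK // mul1r => E3; rewrite E3 eqxx in n43.
by rewrite mulfVK // mulN1r => E3; rewrite E3 opprK eqxx in n4N.
Qed.

(** The pair y, x1 x2 / y of the second line has the product x1 x2 and, if its
    colours are distinct, swaps the points of the first line. *)
Lemma hom_weak x1 x2 x3 : F x1 != 0 -> F x2 != 0 -> F x3 != 0 ->
  F x1 != F x2 -> F (x1 * x2 / x3) != 0 /\
  (F (x1 * x2 / x3) = F x3 \/ F x3 * F (x1 * x2 / x3) = F x1 * F x2).
Proof.
move=> H1 H2 H3 n12; have [y Gy ny] := swap_moves H1 H2 n12.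
have x10 := Fn H1; have x20 := Fn H2; have x30 := Fn H3; have y0 := Gn Gy.
have [N [E|E]] := R1 H1 H2 n12 Gy; first by rewrite E eqxx in ny.
have ny' : G y != G (x1 * x2 / y) by rewrite eq_sym.
have := R2 Gy N ny' H3.
by rewrite (_ : y * (x1 * x2 / y) = x1 * x2) ?E //; fieldx.
Qed.

(** The exceptional case F (x1 x / x3) = F x3 occurs for a single value F x,
    since the quotient of two such x acts trivially. *)
Lemma hom_generic x1 x3 : F x1 != 0 -> F x3 != 0 ->
  exists s : seq R, forall x, F x != 0 -> F x \notin s ->
  F (x1 * x / x3) = F x1 * F x / F x3.
Proof.
move=> H1 H3.
have x10 := Fn H1; have x30 := Fn H3.
pose bad x := F x != 0 /\ F (x1 * x / x3) = F x3.
have good x : F x != 0 -> F x1 != F x -> ~ bad x ->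
    F (x1 * x / x3) = F x1 * F x / F x3.
  move=> Hx nx nb; have [N [E|E]] := hom_weak H1 Hx H3 nx; first by case: nb.
  by rewrite -E (mulrC (F x3)) mulfK.
have [[b [Hb Eb]]|nob] := pselect (exists b, bad b).
  exists [:: F x1; F b] => x Hx; rewrite !inE negb_or => /andP[nx nb].
  apply: good => //; first by rewrite eq_sym.
  case=> _ Ex; move/eqP: nb; apply.
  have [y Gy _] := iG [::].
  have x0 := Fn Hx; have b0 := Fn Hb; have y0 := Gn Gy.
  have N : F (x1 * x / x3) != 0 by rewrite Ex.
  have := @trivG _ _ _ N (etrans Ex (esym Eb)) Gy => E.
  have Gy' : G (x1 * x / x3 / (x1 * b / x3) * y) != 0 by rewrite E.
  have := @trivF _ _ b Gy' E Hb.
  by rewrite (_ : _ * b = x) => [->|] //; fieldx.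
exists [:: F x1] => x Hx; rewrite inE => nx.
by apply: good => //; [rewrite eq_sym | move=> bx; apply: nob; exists x].
Qed.

(** In the exceptional case F (x1 x2 / x3) = F x3, the ratio x1 x2 / x3^2 acts
    trivially. Comparing this with the law at a generic x yields F x1 F x2 = F
    x3 ^ 2, so that the law holds in this case as well. *)
Lemma hom_distinct x1 x2 x3 : F x1 != 0 -> F x2 != 0 -> F x3 != 0 ->
  F x1 != F x2 -> F (x1 * x2 / x3) = F x1 * F x2 / F x3.
Proof.
move=> H1 H2 H3 n12.
have x10 := Fn H1; have x20 := Fn H2; have x30 := Fn H3.
have [N [E|E]] := hom_weak H1 H2 H3 n12; last first.
  by rewrite -E (mulrC (F x3)) mulfK.
have [s1 P1] := hom_generic H1 H3; have [s2 P2] := hom_generic H3 H2.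
have [x Hx] := iF (s1 ++ s2); rewrite mem_cat negb_or => /andP[n1 n2].
have {}P1 := P1 x Hx n1; have {}P2 := P2 x Hx n2; have x0 := Fn Hx.
have [y Gy _] := iG [::]; have y0 := Gn Gy.
have T := @trivG _ _ _ N E Gy.
have Gy' : G (x1 * x2 / x3 / x3 * y) != 0 by rewrite T.
have P1' : F (x1 * x / x3) != 0 by rewrite P1 mulf_neq0 ?invr_neq0 ?mulf_neq0.
have P2' : F (x3 * x / x2) != 0 by rewrite P2 mulf_neq0 ?invr_neq0 ?mulf_neq0.
have := @trivF _ _ _ Gy' T P2'.
rewrite (_ : _ * (_ / x2) = x1 * x / x3); last by fieldx.
rewrite P1 P2 E => E3.
have : F x1 * F x2 = F x3 * F x3.
  have := congr1 (fun t => t * (F x3 * F x2 / F x)) E3.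
  rewrite (_ : F x1 * F x / F x3 * _ = F x1 * F x2); last by fieldx.
  by rewrite (_ : F x3 * F x / F x2 * _ = F x3 * F x3) //; fieldx.
by move=> ->; rewrite mulfK.
Qed.

(** If F x1 = F x2, the law is applied twice, through a point w of another
    value. *)
Lemma swap_hom x1 x2 x3 : F x1 != 0 -> F x2 != 0 -> F x3 != 0 ->
  F (x1 * x2 / x3) = F x1 * F x2 / F x3.
Proof.
move=> H1 H2 H3; have [E12|] := eqVneq (F x1) (F x2); last exact: hom_distinct.
have x10 := Fn H1; have x20 := Fn H2; have x30 := Fn H3.
have [w Hw] := iF [:: F x1; F x3]; rewrite !inE negb_or => /andP[n1 n3].
have w0 := Fn Hw.
have E1 : F (x1 * w / x3) = F x1 * F w / F x3.
  by apply: hom_distinct => //; rewrite eq_sym.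
have N1 : F (x1 * w / x3) != 0 by rewrite E1 mulf_neq0 ?invr_neq0 ?mulf_neq0.
have n2 : F (x1 * w / x3) != F x2.
  apply: contra_neq n3 => E; move: E1; rewrite E -E12 => E1.
  apply: (mulfI H1); rewrite [in RHS]E1.
  by rewrite mulfVK.
have := hom_distinct N1 H2 Hw n2.
rewrite (_ : _ / w = x1 * x2 / x3); last by fieldx.
by move=> ->; rewrite E1; fieldx.
Qed.

End Hom.

(** * Concyclicity as linear dependence of isotropic vectors *)

Section Dot.
Variables (R : realType) (m : nat).
Implicit Types u v w : 'rV[R]_m.

Lemma dotC u v : dot u v = dot v u.
Proof. by apply: eq_bigr => i _; rewrite mulrC. Qed.
Lemma dotDl u v w : dot (u + v) w = dot u w + dot v w.
Proof. by rewrite /dot -big_split; apply: eq_bigr => i _; rewrite mxE mulrDl. Qed.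
Lemma dotZl a u w : dot (a *: u) w = a * dot u w.
Proof. by rewrite /dot mulr_sumr; apply: eq_bigr => i _; rewrite mxE mulrA. Qed.
Lemma dotDr u v w : dot w (u + v) = dot w u + dot w v.
Proof. by rewrite dotC dotDl !(dotC w). Qed.
Lemma dotZr a u w : dot w (a *: u) = a * dot w u.
Proof. by rewrite dotC dotZl (dotC w). Qed.
Lemma dotNl u w : dot (- u) w = - dot u w.
Proof. by rewrite -scaleN1r dotZl mulN1r. Qed.
Lemma dotNr u w : dot w (- u) = - dot w u.
Proof. by rewrite dotC dotNl dotC. Qed.
Lemma dot0l w : dot 0 w = 0.
Proof. by rewrite -(scale0r 0) dotZl mul0r. Qed.
Lemma dot0r w : dot w 0 = 0.
Proof. by rewrite dotC dot0l. Qed.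
Definition dotE := (dotDl, dotDr, dotNl, dotNr, dotZl, dotZr, dot0l, dot0r).

Lemma dot_ge0 u : 0 <= dot u u.
Proof. by apply: sumr_ge0 => i _; rewrite -expr2 sqr_ge0. Qed.
Lemma dot_eq0 u : (dot u u == 0) = (u == 0).
Proof.
apply/eqP/eqP => [|->]; last exact: dot0l.
move=> /eqP; rewrite psumr_eq0 => [/allP H|i _]; last by rewrite -expr2 sqr_ge0.
apply/rowP => i; have := H i (mem_index_enum i) => /=.
by rewrite mulf_eq0 orbb mxE => /eqP.
Qed.
Lemma dot_gt0 u : (0 < dot u u) = (u != 0).
Proof. by rewrite lt_neqAle dot_ge0 andbT eq_sym dot_eq0. Qed.
Lemma enorm2 u : enorm u ^+ 2 = dot u u.
Proof. by rewrite sqr_sqrtr // dot_ge0. Qed.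
Lemma enorm_eq0 u : (enorm u == 0) = (u == 0).
Proof. by rewrite -(sqrf_eq0 (enorm u)) enorm2 dot_eq0. Qed.
Lemma enorm_ge0 u : 0 <= enorm u. Proof. exact: sqrtr_ge0. Qed.
Lemma enorm_gt0 u : (0 < enorm u) = (u != 0).
Proof. by rewrite lt_neqAle enorm_ge0 andbT eq_sym enorm_eq0. Qed.
End Dot.

Section Free.
Variables (K : fieldType) (U : vectType K).
Implicit Types a b c d : U.

Lemma free4Pn a b c d : reflect (exists k1 k2 k3 k4 : K,
   [|| k1 != 0, k2 != 0, k3 != 0 | k4 != 0] /\
   k1 *: a + k2 *: b + k3 *: c + k4 *: d = 0) (~~ free [:: a; b; c; d]).
Proof.
pose X : 4.-tuple U := [tuple a; b; c; d].
pose i1 : 'I_4 := fintype.lift ord0 ord0.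
pose i2 : 'I_4 := fintype.lift ord0 (fintype.lift ord0 ord0).
pose i3 : 'I_4 := fintype.lift ord0 (fintype.lift ord0 (fintype.lift ord0 ord0)).
have XE (k : 'I_4 -> K) : \sum_(i < 4) k i *: X`_i =
   k ord0 *: a + k i1 *: b + k i2 *: c + k i3 *: d.
  by rewrite !big_ord_recl big_ord0 addr0 /= !addrA.
rewrite -[_ :: _]/(val X).
apply: (iffP idP) => [|[k1 [k2 [k3 [k4 [kn0 E]]]]]].
  move=> /(elimN freeP)/existsNP[k].
  move=> /not_implyP[]; rewrite XE => E /existsNP[i /eqP ki].
  exists (k ord0), (k i1), (k i2), (k i3); split => //.
  apply: contraNT ki; rewrite !negb_or !negbK => /and4P[/eqP h0 /eqP h1 /eqP h2 /eqP h3].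
  case: i => -[|[|[|[|//]]]] hi; apply/eqP.
  - by rewrite -[RHS]h0; congr k; apply: val_inj.
  - by rewrite -[RHS]h1; congr k; apply: val_inj.
  - by rewrite -[RHS]h2; congr k; apply: val_inj.
  - by rewrite -[RHS]h3; congr k; apply: val_inj.
apply/negP => /freeP fX.
pose k (i : 'I_4) := [:: k1; k2; k3; k4]`_i.
have Ek : \sum_(i < 4) k i *: X`_i = 0 by rewrite XE.
have k0 := fX k Ek.
by move: kn0; rewrite -[k1]/(k ord0) -[k2]/(k i1) -[k3]/(k i2) -[k4]/(k i3) !k0 eqxx.
Qed.

Lemma free3P a b c : (forall k1 k2 k3 : K, k1 *: a + k2 *: b + k3 *: c = 0 ->
   [/\ k1 = 0, k2 = 0 & k3 = 0]) -> free [:: a; b; c].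
Proof.
move=> H; pose X : 3.-tuple U := [tuple a; b; c].
rewrite -[_ :: _]/(val X); apply/freeP => k.
rewrite !big_ord_recl big_ord0 addr0 /= addrA => /H[z0 z1 z2].
case=> -[|[|[|//]]] hi.
- by rewrite -[RHS]z0; congr k; apply: val_inj.
- by rewrite -[RHS]z1; congr k; apply: val_inj.
- by rewrite -[RHS]z2; congr k; apply: val_inj.
Qed.
End Free.

Section Lift.
Variables (R : realType) (m : nat).
Local Notation E := (Rinfty R m).
Local Notation V := ('rV[R]_m * R^o * R^o)%type.
Implicit Types (z a b c d x y : E) (u v w : V).

(** The light cone model of the inversive space: x is sent to an isotropic
    vector of the Lorentz form [bform], and a circle becomes a linear section of
    the light cone. *)
Definition nullvec z : V :=
  match z with None => (0, 1, 0) | Some x => (x, dot x x, 1) end.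

Definition bform u v : R := 2 * dot u.1.1 v.1.1 - u.1.2 * v.2 - u.2 * v.1.2.

Lemma bformDl u v w : bform (u + v) w = bform u w + bform v w.
Proof. by rewrite /bform /= dotDl; ring. Qed.
Lemma bformZl k u v : bform (k *: u) v = k * bform u v.
Proof. by rewrite /bform /= dotZl /GRing.scale /=; ring. Qed.
Lemma bform0l u : bform 0 u = 0.
Proof. by rewrite /bform /= dot0l; ring. Qed.

Lemma bform_null z : bform (nullvec z) (nullvec z) = 0.
Proof. by case: z => [x|]; rewrite /bform /= ?dot0l; ring. Qed.
Lemma bform_null_lt0 a b : a != b -> bform (nullvec a) (nullvec b) < 0.
Proof.
case: a b => [x|] [y|] //= ab; rewrite /bform /=.
- have : 0 < dot (x - y) (x - y).
    by rewrite dot_gt0 subr_eq0; apply: contra_neq ab => ->.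
  rewrite !dotE (dotC y x) => h; lra.
- rewrite dot0r; lra.
- rewrite dot0l; lra.
Qed.
Lemma bformC u v : bform u v = bform v u.
Proof. by rewrite /bform dotC; ring. Qed.

Lemma nullvec_inj a b k : nullvec a = k *: nullvec b -> a = b.
Proof.
move=> H; apply/eqP/negP => /negP /bform_null_lt0.
by rewrite H bformZl bform_null mulr0 ltxx.
Qed.

(** Lines are circles through [None]; a quadruple with a repetition is
    concyclic. *)
Definition conc a b c d := ~~ free [:: nullvec a; nullvec b; nullvec c; nullvec d].

Lemma concP a b c d : reflect (exists k1 k2 k3 k4 : R,
   [|| k1 != 0, k2 != 0, k3 != 0 | k4 != 0] /\
   k1 *: nullvec a + k2 *: nullvec b + k3 *: nullvec c + k4 *: nullvec d = 0) (conc a b c d).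
Proof. exact: free4Pn. Qed.

Lemma conc_perm a b c d a' b' c' d' :
  perm_eq [:: a; b; c; d] [:: a'; b'; c'; d'] -> conc a b c d = conc a' b' c' d'.
Proof. by move=> H; congr (~~ _); apply: perm_free; exact: (perm_map nullvec H). Qed.

Lemma conc_pairs a b c d : conc a b c d = conc c d a b.
Proof. by apply: conc_perm; rewrite (perm_catC [:: a; b] [:: c; d]). Qed.
Lemma conc_rot a b c d : conc a b c d = conc b c d a.
Proof. by apply: conc_perm; rewrite (perm_catC [:: a] [:: b; c; d]). Qed.
Lemma concC34 a b c d : conc a b c d = conc a b d c.
Proof. by apply: conc_perm; rewrite (perm_cat2l [:: a; b]) (perm_catC [:: c] [:: d]). Qed.

Lemma concC23 a b c d : conc a b c d = conc a c b d.
Proof. by apply: conc_perm; rewrite perm_cons (perm_catCA [:: b] [:: c] [:: d]). Qed.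

Lemma conc_dup a b c : conc a a b c.
Proof. by apply: contraT => /negPn/free_uniq; rewrite /= inE eqxx. Qed.

(** The Gram determinant of three distinct isotropic vectors is 2 A B C, where
    the mutual products A, B, C are negative. *)
Lemma free3 a b c : a != b -> a != c -> b != c -> free [:: nullvec a; nullvec b; nullvec c].
Proof.
move=> /bform_null_lt0 ab /bform_null_lt0 ac /bform_null_lt0 bc.
apply: free3P => k0 k1 k2 E.
have Ea := congr1 (bform ^~ (nullvec a)) E; have Eb := congr1 (bform ^~ (nullvec b)) E.
have Ec := congr1 (bform ^~ (nullvec c)) E.
move: Ea Eb Ec; rewrite !bformDl !bformZl !bform0l !bform_null.
rewrite !(bformC (nullvec b) (nullvec a)) !(bformC (nullvec c) (nullvec a)) !(bformC (nullvec c) (nullvec b)).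
set A := bform _ _ in ab *; set B := bform _ _ in ac *; set C := bform _ _ in bc *.
rewrite !mulr0 !addr0 !add0r => Ea Eb Ec.
have z2 : k2 = 0.
  have : 2 * k2 * (B * C) = 0.
    transitivity (C * (k1 * A + k2 * B) + B * (k0 * A + k2 * C) - A * (k0 * B + k1 * C)).
      by ring.
    by rewrite Ea Eb Ec !mulr0 addr0 subr0.
  by move/eqP; rewrite !mulf_eq0 pnatr_eq0 (lt_eqF ac) (lt_eqF bc) !orbF => /eqP.
move: Ea Eb; rewrite z2 !mul0r !addr0.
move=> /eqP; rewrite mulf_eq0 (lt_eqF ab) orbF => /eqP z1.
move=> /eqP; rewrite mulf_eq0 (lt_eqF ab) orbF => /eqP z0.
by [].
Qed.

(** The subspace that cuts out the circle through three distinct points, called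
    their block. *)
Definition span3 a b c := <<[:: nullvec a; nullvec b; nullvec c]>>%VS.

Lemma dim_span3 a b c : a != b -> a != c -> b != c -> \dim (span3 a b c) = 3.
Proof. by move=> ab ac bc; apply/eqP; exact: free3. Qed.

Definition inb (W : {vspace V}) z := nullvec z \in W.

Lemma conc_span a b c d : a != b -> a != c -> b != c ->
  conc a b c d = inb (span3 a b c) d.
Proof.
move=> ab ac bc; rewrite (conc_perm (a' := d) (b' := a) (c' := b) (d' := c)).
  by rewrite /conc free_cons negb_and negbK free3 // orbF.
by rewrite (perm_catC [:: a; b; c] [:: d]).
Qed.

Lemma span3_eq a b c (W : {vspace V}) : a != b -> a != c -> b != c ->
  \dim W = 3 -> nullvec a \in W -> nullvec b \in W -> nullvec c \in W -> span3 a b c = W.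
Proof.
move=> ab ac bc dW aW bW cW; apply/eqP; rewrite eqEdim dW dim_span3 // leqnn andbT.
by apply/span_subvP => v; rewrite !inE => /or3P[]/eqP ->.
Qed.
End Lift.

(** * Explicit circles and Moebius maps *)

Section ConcExplicit.
Variables (R : realType) (m : nat).
Local Notation E := (Rinfty R m).
Local Notation V := ('rV[R]_m * R^o * R^o)%type.
Implicit Types (z a b c d : E) (u v w A B : 'rV[R]_m).

Definition vec z : 'rV[R]_m := (nullvec z).1.1.
Definition nrm z : R := (nullvec z).1.2.
Definition fin z : R := (nullvec z).2.

Lemma conc_coefP a b c d : reflect (exists k1 k2 k3 k4 : R,
   [/\ [|| k1 != 0, k2 != 0, k3 != 0 | k4 != 0],
   k1 *: vec a + k2 *: vec b + k3 *: vec c + k4 *: vec d = 0,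
   k1 * nrm a + k2 * nrm b + k3 * nrm c + k4 * nrm d = 0 &
   k1 * fin a + k2 * fin b + k3 * fin c + k4 * fin d = 0]) (conc a b c d).
Proof.
apply: (iffP (concP _ _ _ _)) => -[k1 [k2 [k3 [k4]]]].
  case=> k0 H; exists k1, k2, k3, k4; split => //.
  - by have := congr1 (fun X : V => X.1.1) H.
  - by have := congr1 (fun X : V => X.1.2) H.
  - by have := congr1 (fun X : V => X.2) H.
case=> k0 H1 H2 H3; exists k1, k2, k3, k4; split => //.
apply: injective_projections; last exact: H3.
by apply: injective_projections; [exact: H1|exact: H2].
Qed.

Lemma conc_line A B t : conc None (Some A) (Some B) (Some (A + t *: (B - A))).
Proof.
apply/conc_coefP.
pose C := A + t *: (B - A).
exists ((1 - t) * dot A A + t * dot B B - dot C C), (-(1 - t)), (- t), 1.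
rewrite /vec /nrm /fin /= -/C; split; first by rewrite oner_neq0 !orbT.
- apply/rowP => i; rewrite !mxE; ring.
- ring.
- ring.
Qed.

Lemma conc_line_inv A B z : A != B -> conc None (Some A) (Some B) z ->
  z = None \/ exists t, z = Some (A + t *: (B - A)).
Proof.
move=> AB /conc_coefP[k1 [k2 [k3 [k4]]]]; case: z => [C|]; last by left.
rewrite /vec /nrm /fin /= => -[k0 H1 H2 H3]; right.
have k40 : k4 != 0.
  apply: contraNneq AB => k40; move: k0 H1 H2 H3; rewrite k40.
  rewrite eqxx orbF scale0r scaler0 add0r addr0 !mulr0 !mul0r !addr0 !mulr1 add0r => k0 H1 H2 H3.
  have k32 : k3 = - k2 by apply/eqP; rewrite -addr_eq0 addrC; apply/eqP.
  move: H1; rewrite k32 scaleNr -scalerBr => /eqP; rewrite scaler_eq0 subr_eq0.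
  case/orP => // /eqP k20; move: H2 k0; rewrite k32 k20 oppr0 !mul0r !addr0 => ->.
  by rewrite eqxx.
exists (- (k3 / k4)); congr Some.
apply: (scalerI k40).
move: H1; rewrite scaler0 add0r => /eqP; rewrite addr_eq0 eq_sym -(inj_eq oppr_inj) opprK => /eqP ->.
have -> : k2 = - k3 - k4 by move: H3; rewrite mulr0 add0r !mulr1; lra.
by apply/rowP => i; rewrite !mxE; field.
Qed.

Lemma conc_line3_inv A B C : A != B -> conc None (Some A) (Some B) (Some C) ->
  exists t, C = A + t *: (B - A).
Proof. by move=> AB /(conc_line_inv AB)[] // [t [->]]; exists t. Qed.

Lemma conc_ray u x1 x2 : conc None (Some 0) (Some (x1 *: u)) (Some (x2 *: u)).
Proof.
apply/conc_coefP; have [x10|x10] := eqVneq x1 0.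
  exists 0, 1, (-1), 0; rewrite /vec /nrm /fin /= x10 scale0r dot0l; split.
  - by rewrite oner_neq0 !orbT.
  - by rewrite !scale0r !scaler0 !addr0.
  - ring.
  - ring.
exists (x2 * x1 * (x1 - x2) * dot u u), (x2 - x1), (- x2), x1; rewrite /vec /nrm /fin /= !dotE; split.
- by rewrite x10 !orbT.
- by apply/rowP => i; rewrite !mxE; ring.
- ring.
- ring.
Qed.

(** The power of 0 with respect to the circle is x1 x2 |u|^2 = y1 y2 |v|^2. *)
Lemma conc_power u v x1 x2 y1 y2 : dot u u = dot v v -> x1 * x2 = y1 * y2 ->
  conc (Some (x1 *: u)) (Some (x2 *: u)) (Some (y1 *: v)) (Some (y2 *: v)).
Proof.
move=> uv xy; have [x12|x12] := eqVneq x1 x2; first by rewrite x12 conc_dup.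
have [y12|y12] := eqVneq y1 y2.
  by rewrite y12 (conc_perm (a' := Some (y2 *: v)) (b' := Some (y2 *: v)) (c' := Some (x1 *: u)) (d' := Some (x2 *: u))) ?conc_dup // (perm_catC [:: _; _] [:: _; _]).
apply/conc_coefP.
exists (x2 * (y1 - y2)), (- x1 * (y1 - y2)), (y2 * (x2 - x1)), (- y1 * (x2 - x1)).
rewrite /vec /nrm /fin /= !dotE -uv; split.
- apply: contraT; rewrite !negb_or !negbK !mulf_eq0 !oppr_eq0 !subr_eq0.
  rewrite (eq_sym x2 x1) (negPf x12) (negPf y12) !orbF => /and4P[/eqP h1 /eqP h2 _ _].
  by rewrite h1 h2 eqxx in x12.
- by apply/rowP => i; rewrite !mxE; ring.
- transitivity ((y1 - y2) * (x1 - x2) * (x1 * x2 - y1 * y2) * dot u u); first by ring.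
  by rewrite xy; ring.
- ring.
Qed.

(** The linear dependency splits into its components along u and w, and its
    quadratic part then gives the power of 0 along each of them. *)
Lemma conc_power_inv u w f1 f2 g1 g2 : dot u u = 1 -> dot w w = 1 ->
  (forall s t, s *: u + t *: w = 0 -> s = 0 /\ t = 0) ->
  conc (Some (f1 *: u)) (Some (f2 *: u)) (Some (g1 *: w)) (Some (g2 *: w)) ->
  f1 != f2 -> g1 != g2 -> f1 * f2 = g1 * g2.
Proof.
move=> u1 w1 uw /conc_coefP[k1 [k2 [k3 [k4]]]].
rewrite /vec /nrm /fin /= !dotE u1 w1 !mulr1 => -[k0 H1 H2 H3] f12 g12.
have [] := uw (k1 * f1 + k2 * f2) (k3 * g1 + k4 * g2).
  by rewrite -[RHS]H1 !scalerA !scalerDl -!addrA.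
move=> E1 E2.
have F1 : k1 * (f1 * f1) + k2 * (f2 * f2) = - (f1 * f2) * (k1 + k2).
  transitivity (f1 * (k1 * f1 + k2 * f2) + f2 * (k1 * f1 + k2 * f2) - (f1 * f2) * (k1 + k2)).
    by ring.
  by rewrite E1; ring.
have F2 : k3 * (g1 * g1) + k4 * (g2 * g2) = - (g1 * g2) * (k3 + k4).
  transitivity (g1 * (k3 * g1 + k4 * g2) + g2 * (k3 * g1 + k4 * g2) - (g1 * g2) * (k3 + k4)).
    by ring.
  by rewrite E2; ring.
have k34 : k3 + k4 = - (k1 + k2) by lra.
have : (k1 + k2) * (g1 * g2 - f1 * f2) = 0.
  transitivity (k1 * (f1 * f1) + k2 * (f2 * f2) + (k3 * (g1 * g1) + k4 * (g2 * g2))).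
    by rewrite F1 F2 k34; ring.
  by rewrite addrA.
move/eqP; rewrite mulf_eq0 => /orP[/eqP k12|]; last by rewrite subr_eq0 => /eqP.
have k2E : k2 = - k1 by lra. have k4E : k4 = - k3 by lra.
have : k1 * (f1 - f2) = 0 by rewrite -[RHS]E1 k2E; ring.
have : k3 * (g1 - g2) = 0 by rewrite -[RHS]E2 k4E; ring.
move/eqP; rewrite mulf_eq0 subr_eq0 (negPf g12) orbF => /eqP k30.
move/eqP; rewrite mulf_eq0 subr_eq0 (negPf f12) orbF => /eqP k10.
by move: k0; rewrite k2E k4E k10 k30 oppr0 eqxx.
Qed.

End ConcExplicit.

Section Moebius.
Variables (R : realType) (m : nat).
Local Notation E := (Rinfty R m).
Local Notation V := ('rV[R]_m * R^o * R^o)%type.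
Implicit Types (z : E) (u v w A B : 'rV[R]_m) (phi psi : E -> E).

(** The orthogonal reflection of the Lorentz space in a nonisotropic vector n.
    *)
Definition lrefl (n : V) (X : V) : V := X - (2 * bform X n / bform n n) *: n.

Lemma lrefl_linear n : linear (lrefl n).
Proof.
move=> k X Y; rewrite /lrefl bformDl bformZl.
rewrite (_ : 2 * _ / _ = k * (2 * bform X n / bform n n) + 2 * bform Y n / bform n n).
  by rewrite scalerDl -scalerA opprD scalerBr addrACA.
by ring.
Qed.

Lemma lreflK n X : bform n n != 0 -> lrefl n (lrefl n X) = X.
Proof.
move=> n0; rewrite /lrefl -!scaleNr bformDl bformZl -addrA -scalerDl.
by rewrite [X in X *: n](_ : _ = 0) ?scale0r ?addr0 //; field.
Qed.

(** For the sphere of centre a and radius r the vector n is (a, |a|^2 - r^2, 1),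
    and for the hyperplane dot x u = c it is (u, 2 c, 0). *)
Lemma reflection_lorentz phi : is_reflection phi ->
  exists2 n : V, bform n n != 0 &
    forall z, exists2 k : R, k != 0 & nullvec (phi z) = k *: lrefl n (nullvec z).
Proof.
case=> [[a [r [r0 ->]]]|[u [c [u0 ->]]]].
  have r00 : r != 0 by rewrite gt_eqF.
  have rr : r ^+ 2 != 0 by rewrite expf_neq0 // gt_eqF.
  pose n : V := (a, dot a a - r ^+ 2, 1).
  have nn : bform n n = 2 * r ^+ 2 by rewrite /bform /=; ring.
  exists n; first by rewrite nn mulf_neq0 // pnatr_eq0.
  case=> [x|]; rewrite /inversion; last first.
    exists (r ^+ 2); first by [].
    have B : bform (nullvec None) n = -1 by rewrite /bform /= dot0l; ring.
    rewrite /lrefl B nn; apply: injective_projections; [apply: injective_projections|] => /=.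
    - by apply/rowP => i; rewrite !mxE; fieldx.
    - by rewrite /GRing.scale /=; fieldx.
    - by rewrite /GRing.scale /=; fieldx.
  have B : bform (nullvec (Some x)) n = r ^+ 2 - dot (x - a) (x - a).
    by rewrite /bform /= !dotE (dotC a x); ring.
  have [xa|xa] := eqVneq x a.
    exists (r ^+ 2)^-1; first by rewrite invr_neq0.
    rewrite /lrefl B nn xa subrr dot0l subr0.
    apply: injective_projections; [apply: injective_projections|] => /=.
    - by apply/rowP => i; rewrite !mxE; fieldx.
    - by rewrite /GRing.scale /=; fieldx.
    - by rewrite /GRing.scale /=; fieldx.
  have N0 : dot (x - a) (x - a) != 0 by rewrite dot_eq0 subr_eq0.
  rewrite expr_div_n enorm2.
  set N := dot (x - a) (x - a) in N0 B *.
  exists (r ^+ 2 / N); first by rewrite mulf_neq0 ?invr_neq0.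
  rewrite /lrefl B nn; apply: injective_projections; [apply: injective_projections|] => /=.
  - by apply/rowP => i; rewrite !mxE; fieldx.
  - rewrite !(dotDl, dotDr, dotZl, dotZr, dotNl, dotNr) (dotC a x) /GRing.scale /=.
    have -> : dot x x = N + 2 * dot x a - dot a a.
      by rewrite /N !dotE (dotC a x); ring.
    by fieldx.
  - by rewrite /GRing.scale /=; fieldx.
pose n : V := (u, 2 * c, 0).
have u00 : dot u u != 0 by rewrite dot_eq0; apply/eqP.
have nn : bform n n = 2 * dot u u by rewrite /bform /=; ring.
exists n; first by rewrite nn mulf_neq0 // pnatr_eq0.
case=> [x|]; exists 1; rewrite ?oner_neq0 // scale1r /hyperplane_reflection /lrefl nn.
  have -> : bform (nullvec (Some x)) n = 2 * (dot x u - c) by rewrite /bform /=; ring.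
  apply: injective_projections; [apply: injective_projections|] => /=.
  - by apply/rowP => i; rewrite !mxE; field.
  - rewrite !(dotDl, dotDr, dotZl, dotZr, dotNl, dotNr) (dotC u x) /GRing.scale /=.
    by field.
  - by rewrite /GRing.scale /=; ring.
have -> : bform (nullvec None) n = 0 by rewrite /bform /= dot0l; ring.
by rewrite mulr0 mul0r scale0r subr0.
Qed.

Definition lorentz phi := exists L : 'End(V), lker L = 0%VS /\
  forall z, exists2 k : R, k != 0 & nullvec (phi z) = k *: L (nullvec z).

Lemma moebius_lorentz phi : moebius_Rinfty phi -> lorentz phi.
Proof.
elim=> [|f g /reflection_lorentz[n n0 Hf] _ [L [kL HL]]].
  exists \1%VF; split; first by apply/eqP/lker0P => x y; rewrite !id_lfunE.
  by move=> z; exists 1; rewrite ?oner_neq0 // scale1r id_lfunE.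
pose rn : {linear V -> V} := HB.pack (lrefl n) (GRing.isLinear.Build R V V *:%R (lrefl n) (lrefl_linear n)).
exists (linfun rn \o L)%VF; split.
  apply/eqP/lker0P => x y; rewrite !comp_lfunE !lfunE /= => H.
  have /eqP/lker0P injL := kL; apply: injL.
  by rewrite -[LHS](lreflK _ n0) H lreflK.
move=> z; have [k k0 Ek] := HL z; have [l l0 El] := Hf (g z).
exists (l * k); first by rewrite mulf_neq0.
have -> : (linfun rn \o L)%VF (nullvec z) = rn (L (nullvec z)).
  by rewrite comp_lfunE lfunE.
have Z : rn (k *: L (nullvec z)) = k *: rn (L (nullvec z)) by rewrite linearZ.
by rewrite /= El Ek -scalerA -Z.
Qed.

Lemma lorentz_conc phi a b c d : lorentz phi -> conc a b c d ->
  conc (phi a) (phi b) (phi c) (phi d).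
Proof.
case=> L [_ H] /concP[k1 [k2 [k3 [k4 [k0 E]]]]].
have [la la0 Ea] := H a; have [lb lb0 Eb] := H b.
have [lc lc0 Ec] := H c; have [ld ld0 Ed] := H d.
apply/concP; exists (k1 / la), (k2 / lb), (k3 / lc), (k4 / ld); split.
  by rewrite !mulf_eq0 !invr_eq0 (negPf la0) (negPf lb0) (negPf lc0) (negPf ld0) !orbF.
rewrite Ea Eb Ec Ed !scalerA !mulfVK // -!linearZ -!linearD E.
by rewrite linear0.
Qed.

Definition moeb phi := moebius_Rinfty phi.

Lemma moeb_conc phi a b c d : moeb phi -> conc a b c d ->
  conc (phi a) (phi b) (phi c) (phi d).
Proof. by move/moebius_lorentz; exact: lorentz_conc. Qed.

Lemma moeb_id : moeb id. Proof. exact: moebius_id. Qed.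

Lemma moeb_comp phi psi : moeb phi -> moeb psi -> moeb (phi \o psi).
Proof.
elim=> [|f g Hf Hg IH] Hpsi; first exact: Hpsi.
exact: (moebius_comp Hf (IH Hpsi)).
Qed.

Lemma moeb_refl phi : is_reflection phi -> moeb phi.
Proof. by move=> H; exact: (moebius_comp H moeb_id). Qed.

Lemma reflectionK phi : is_reflection phi -> involutive phi.
Proof.
move=> /reflection_lorentz[n n0 H] z.
have [k k0 Ek] := H z; have [l l0 El] := H (phi z).
apply: (@nullvec_inj _ _ _ _ (l * k)); rewrite El Ek.
pose rn : {linear V -> V} := HB.pack (lrefl n) (GRing.isLinear.Build R V V *:%R (lrefl n) (lrefl_linear n)).
have Z : rn (k *: rn (nullvec z)) = k *: rn (rn (nullvec z)) by rewrite linearZ.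
by rewrite -[lrefl n (k *: _)]/(rn _) Z scalerA /= lreflK.
Qed.

Lemma moeb_inv phi : moeb phi -> exists psi, [/\ moeb psi, cancel phi psi & cancel psi phi].
Proof.
elim=> [|f g Hf Hg [h [Hh gh hg]]]; first by exists id; split => //; exact: moeb_id.
exists (h \o f); split.
- exact: moeb_comp Hh (moeb_refl Hf).
- by move=> x /=; rewrite reflectionK // gh.
- by move=> x /=; rewrite hg reflectionK.
Qed.

(** The product of two reflections in parallel hyperplanes. *)
Lemma moeb_translate b : moeb (omap (fun x => x + b)).
Proof.
have [->|b0] := eqVneq b 0.
  have -> : omap (fun x => x + 0) = id :> (E -> E).
    by apply/funext => -[x|] //=; rewrite addr0.
  exact: moeb_id.
have bb : dot b b != 0 by rewrite dot_eq0.
have Hr c : is_reflection (hyperplane_reflection b c) by right; exists b, c; split=> //; apply/eqP.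
have -> : omap (fun x => x + b) =
    hyperplane_reflection b (dot b b / 2) \o hyperplane_reflection b 0 :> (E -> E).
  apply/funext => -[x|] //=; congr Some; apply/rowP => i; rewrite !(dotDl, dotNl, dotZl) !mxE.
  by field.
exact: moeb_comp (moeb_refl (Hr _)) (moeb_refl (Hr _)).
Qed.

Lemma moeb_inversion a r : 0 < r -> moeb (inversion a r : E -> E).
Proof. by move=> r0; apply: moeb_refl; left; exists a, r. Qed.

Lemma inversion1 (a x : 'rV[R]_m) : x != a ->
  inversion a 1 (Some x) = Some (a + (dot (x - a) (x - a))^-1 *: (x - a)).
Proof. by move=> xa; rewrite /= (negPf xa) expr_div_n enorm2 expr1n mul1r. Qed.

(** The product of two inversions in concentric spheres. *)
Lemma moeb_scale k : 0 < k -> moeb (omap (fun x => k *: x)).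
Proof.
move=> k0; have sk : 0 < Num.sqrt k by rewrite sqrtr_gt0.
have -> : omap (fun x => k *: x) = inversion 0 (Num.sqrt k) \o inversion 0 1 :> (E -> E).
  apply/funext => -[x|] /=; last by rewrite eqxx.
  have [->|x0] := eqVneq x 0; first by rewrite scaler0.
  have xx : dot x x != 0 by rewrite dot_eq0.
  rewrite /= !add0r !subr0 expr_div_n expr1n enorm2 div1r.
  rewrite scaler_eq0 invr_eq0 (negPf xx) (negPf x0) /= expr_div_n enorm2.
  rewrite !dotE sqr_sqrtr ?ltW // scalerA; congr (Some (_ *: _)).
  by field.
exact: moeb_comp (moeb_inversion _ sk) (moeb_inversion _ ltr01).
Qed.

(** The reflection that exchanges u and v. *)
Lemma moeb_rotate u v : dot u u = dot v v -> exists phi,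
  [/\ moeb phi, phi None = None, forall t, phi (Some (t *: u)) = Some (t *: v)
    & forall w t, dot w u = 0 -> dot w v = 0 -> phi (Some (t *: w)) = Some (t *: w)].
Proof.
move=> uv; have [->|neq] := eqVneq u v.
  by exists id; split => //; exact: moeb_id.
have uv0 : u - v != 0 by rewrite subr_eq0.
have N0 : dot (u - v) (u - v) != 0 by rewrite dot_eq0.
exists (hyperplane_reflection (u - v) 0); split => //.
- by apply: moeb_refl; right; exists (u - v), 0; split => //; apply/eqP.
- move=> t /=; congr Some.
  have -> : 2 * (dot (t *: u) (u - v) - 0) / dot (u - v) (u - v) = t.
    move: N0; rewrite !(dotDl, dotDr, dotNl, dotNr, dotZl) (dotC v u) -uv => N0.
    by field; apply: contra_neq N0 => h; rewrite -[RHS]h; ring.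
  by apply/rowP => i; rewrite !mxE; ring.
- move=> w t wu wv /=; rewrite !dotE wu wv !(oppr0, addr0, subr0, mulr0, mul0r).
  by rewrite scale0r subr0.
Qed.

Lemma moeb_reflect u : u != 0 -> exists phi,
  [/\ moeb phi, phi None = None & forall t, phi (Some (t *: u)) = Some (- t *: u)].
Proof.
move=> u0; have uu : dot u u != 0 by rewrite dot_eq0.
exists (hyperplane_reflection u 0); split => //.
  by apply: moeb_refl; right; exists u, 0; split => //; apply/eqP.
by move=> t /=; congr Some; apply/rowP => i; rewrite dotZl !mxE; field.
Qed.

Lemma moeb_to_inf z : exists phi, moeb phi /\ phi z = None.
Proof.
case: z => [x|]; last by exists id; split => //; exact: moeb_id.
exists (inversion x 1); split; first exact: moeb_inversion.
by rewrite /= eqxx.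
Qed.

Lemma moeb_inj phi : moeb phi -> injective phi.
Proof. by move/moeb_inv => [psi [_ K _]]; exact: can_inj K. Qed.

Lemma moeb_normalize u a b c : dot u u = 1 -> a != b -> a != c -> b != c ->
  exists phi, [/\ moeb phi, phi a = None, phi b = Some 0 & phi c = Some u].
Proof.
move=> u1 ab ac bc; have [f [mf fa]] := moeb_to_inf a.
have fI := moeb_inj mf.
case fb : (f b) => [B|]; last by move: ab; rewrite -(inj_eq fI) fa fb eqxx.
case fc : (f c) => [C|]; last by move: ac; rewrite -(inj_eq fI) fa fc eqxx.
have BC : C - B != 0.
  rewrite subr_eq0; apply: contra_neq bc => CB; apply: fI.
  by rewrite fb fc CB.
have e0 : 0 < enorm (C - B) by rewrite enorm_gt0.
have H1 : dot ((enorm (C - B))^-1 *: (C - B)) ((enorm (C - B))^-1 *: (C - B)) = dot u u.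
  by rewrite u1 dotZl dotZr -enorm2; field; rewrite gt_eqF.
have [h [mh h0 hu _]] := moeb_rotate H1.
exists (h \o (omap (fun x => (enorm (C - B))^-1 *: x) \o (omap (fun x => x - B) \o f))).
  split.
  - apply: moeb_comp mh _; apply: moeb_comp; first by apply: moeb_scale; rewrite invr_gt0.
    by apply: moeb_comp mf; exact: moeb_translate.
  - by rewrite /= fa.
  - by have := hu 0; rewrite /= fb /= subrr scaler0 !scale0r.
  - by have := hu 1; rewrite /= fc /= !scale1r.
Qed.

End Moebius.

(** * Finite circles whose colours are preserved by a pencil *)

Section Blocks.
Variables (R : realType) (n : nat).
Local Notation E := (Rinfty R n).
Local Notation V := ('rV[R]_n * R^o * R^o)%type.
Implicit Types (p q r s : E) (W : {vspace V}).

Lemma inb_conc W p q r s : \dim W = 3 -> p != q -> p != r -> q != r ->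
  inb W p -> inb W q -> inb W r -> conc p q r s = inb W s.
Proof. by move=> dW *; rewrite conc_span // (span3_eq (W := W)). Qed.

Lemma inb1 p q r : inb (span3 p q r) p.
Proof. by apply: memv_span; rewrite !inE eqxx. Qed.
Lemma inb2 p q r : inb (span3 p q r) q.
Proof. by apply: memv_span; rewrite !inE eqxx orbT. Qed.
Lemma inb3 p q r : inb (span3 p q r) r.
Proof. by apply: memv_span; rewrite !inE eqxx !orbT. Qed.

Lemma block_eq W W' p q r : \dim W = 3 -> \dim W' = 3 -> p != q -> p != r -> q != r ->
  inb W p -> inb W q -> inb W r -> inb W' p -> inb W' q -> inb W' r -> W = W'.
Proof. by move=> dW dW' *; rewrite -(span3_eq (a := p) (b := q) (c := r) (W := W)) // (span3_eq (W := W')). Qed.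
End Blocks.

Lemma third_value (T : eqType) (a b c p q : T) : a != b -> a != c -> b != c ->
  [|| (a != p) && (a != q), (b != p) && (b != q) | (c != p) && (c != q)].
Proof.
move=> ab ac bc; apply: contraT; rewrite !negb_or !negb_and !negbK.
by move=> /and3P[/orP[] /eqP Ea /orP[] /eqP Eb /orP[] /eqP Ec];
   move: ab ac bc; rewrite Ea Eb Ec ?eqxx.
Qed.

Section TwoLines.
Variables (R : realType) (n : nat).
Local Notation E := (Rinfty R n).
Local Notation V := ('rV[R]_n * R^o * R^o)%type.
Variables (f g : R -> E) (W1 W2 : {vspace V}).
Hypothesis K : forall x1 x2 y1 y2, x1 * x2 = y1 * y2 -> conc (f x1) (f x2) (g y1) (g y2).
Hypotheses (fW : forall x, inb W1 (f x)) (gW : forall y, inb W2 (g y)).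
Hypothesis dW1 : \dim W1 = 3.
Hypotheses (f0 : inb W2 (f 0)) (g0 : inb W1 (g 0)).

(** By K, the points x1, x2 of the first line are concyclic with y and x1 x2 / y
    on the second one. If the colour of the latter were in W1, the whole circle
    would have its colours in W1, including g y. *)
Lemma two_lines x1 x2 y : ~~ inb W2 (f x1) -> ~~ inb W2 (f x2) -> f x1 != f x2 ->
  ~~ inb W1 (g y) ->
  ~~ inb W1 (g (x1 * x2 / y)) /\ conc (f x1) (f x2) (g y) (g (x1 * x2 / y)).
Proof.
move=> U1 U2 n12 Uy.
have y0 : y != 0 by apply: contraNneq Uy => ->.
have C : conc (f x1) (f x2) (g y) (g (x1 * x2 / y)) by apply: K; field.
split=> //; apply/negP => W'.
have n1 : f x1 != g (x1 * x2 / y) by apply: contraNneq U1 => ->.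
have n2 : f x2 != g (x1 * x2 / y) by apply: contraNneq U2 => ->.
move/negP: Uy; apply.
by rewrite -(inb_conc (g y) dW1 n12 n1 n2) // concC34.
Qed.

(** The composite of the swaps with (x', xi) and (x, xi) is the multiplication
    by x / x', and the new colour of y lies on the block of f x, f xi and g y.
    For xi = x2 and xi = x3 these blocks share f x, g y and the new colour; were
    the latter different from g y, both blocks would be W1, which does not
    contain g y. *)
Lemma same_colour_acts x x' x2 x3 y : f x = f x' ->
  ~~ inb W2 (f x) -> ~~ inb W2 (f x2) -> ~~ inb W2 (f x3) ->
  f x2 != f x -> f x3 != f x -> f x2 != f x3 -> ~~ inb W1 (g y) ->
  g (x / x' * y) = g y.
Proof.
move=> E Ux U2 U3 n2 n3 n23 Uy.
have Ux' : ~~ inb W2 (f x') by rewrite -E.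
have [//|ne] := eqVneq (g (x / x' * y)) (g y).
have y0 : y != 0 by apply: contraNneq Uy => ->.
have x'0 : x' != 0 by apply: contraNneq Ux' => ->.
have key xi : ~~ inb W2 (f xi) -> f xi != f x ->
    exists W, [/\ \dim W = 3, inb W (f x), inb W (f xi), inb W (g y) & inb W (g (x / x' * y))].
  move=> Ui ni.
  have xi0 : xi != 0 by apply: contraNneq Ui => ->.
  have nx : f x' != f xi by rewrite -E eq_sym.
  have [Uz Cz] := two_lines Ux' Ui nx Uy.
  have nx2 : f x != f xi by rewrite E.
  have [Uw Cw] := two_lines Ux Ui nx2 Uz.
  move: Uw Cw; have -> : x * xi / (x' * xi / y) = x / x' * y by fieldx.
  set z := _ / y in Uz Cz *.
  move=> Uw Cw.
  have nz1 : f x != g z by apply: contraNneq Uz => <-.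
  have nz2 : f xi != g z by apply: contraNneq Uz => <-.
  exists (span3 (f x) (f xi) (g z)); split.
  - exact: dim_span3.
  - exact: inb1.
  - exact: inb2.
  - by rewrite -conc_span // E concC34.
  - by rewrite -conc_span.
have [Wa [dWa a1 a2 a3 a4]] := key x2 U2 n2.
have [Wb [dWb b1 b2 b3 b4]] := key x3 U3 n3.
have ny1 : f x != g y by apply: contraNneq Uy => <-.
have Uw : ~~ inb W1 (g (x / x' * y)).
  have n2' : f x' != f x2 by rewrite -E eq_sym.
  have [Uz _] := two_lines Ux' U2 n2' Uy.
  have n2'' : f x != f x2 by rewrite E.
  have [] := two_lines Ux U2 n2'' Uz.
  have x20 : x2 != 0 by apply: contraNneq U2 => ->.
  by have -> : x * x2 / (x' * x2 / y) = x / x' * y by fieldx.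
have ny2 : f x != g (x / x' * y) by apply: contraNneq Uw => <-.
have ne' : g y != g (x / x' * y) by rewrite eq_sym.
have EW : Wa = Wb by exact: (block_eq (p := f x) (q := g y) (r := g (x / x' * y))).
have n2'' : f x != f x2 by rewrite eq_sym.
have n3'' : f x != f x3 by rewrite eq_sym.
have EW1 : Wa = W1.
  rewrite -EW in b2.
  by apply: (block_eq dWa dW1 n2'' n3'' n23 a1 a2 b2).
by move: Uy; rewrite -EW1 a3.
Qed.
End TwoLines.

Section Regular.
Variables (R : realType) (n : nat).
Local Notation E := (Rinfty R n).
Local Notation V := ('rV[R]_n * R^o * R^o)%type.
Variables (f g : R -> E) (W1 : {vspace V}) (s0 t0 : R).
Hypothesis K : forall x1 x2 y1 y2, x1 * x2 = y1 * y2 -> conc (f x1) (f x2) (g y1) (g y2).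
Hypotheses (fW : forall x, inb W1 (f x)) (dW1 : \dim W1 = 3).
Let a := f 0.
Let W2 := span3 a (g s0) (g t0).
Hypotheses (g0 : g 0 = a) (gW : forall y, inb W2 (g y)).
Hypotheses (Us : ~~ inb W1 (g s0)) (Ut : ~~ inb W1 (g t0)) (nst : g s0 != g t0).
Hypothesis nopair : forall x x', f x != f x' -> ~~ conc (g s0) (g t0) (f x) (f x').

Let as0 : a != g s0. Proof. by apply: contraNneq Us => <-; exact: fW. Qed.
Let at0 : a != g t0. Proof. by apply: contraNneq Ut => <-; exact: fW. Qed.
Let dW2 : \dim W2 = 3. Proof. exact: dim_span3. Qed.
Let aW2 : inb W2 a. Proof. exact: inb1. Qed.

Lemma reg_offE x : ~~ inb W2 (f x) = (f x != a).
Proof.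
apply/idP/idP; first by apply: contraNneq => ->.
move=> nx; apply/negP; rewrite -conc_span // => H; move: (nopair nx).
by rewrite -conc_rot H.
Qed.

Let f0 : inb W2 (f 0). Proof. exact: aW2. Qed.
Let g0' : inb W1 (g 0). Proof. by rewrite g0; exact: fW. Qed.
Let K' y1 y2 x1 x2 : y1 * y2 = x1 * x2 -> conc (g y1) (g y2) (f x1) (f x2).
Proof.
by move=> H; rewrite conc_pairs; exact: K.
Qed.

Definition trivial_ratio m := m != 0 /\ forall x, f (m * x) = f x.
Local Notation triv := trivial_ratio.

Lemma trivM m m' : triv m -> triv m' -> triv (m * m').
Proof.
by move=> [m0 Hm] [m'0 Hm']; split; [rewrite mulf_neq0|move=> x; rewrite -mulrA Hm Hm'].
Qed.
Lemma trivV m : triv m -> triv m^-1.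
Proof.
by move=> [m0 Hm]; split; [rewrite invr_eq0|move=> x; rewrite -(Hm (m^-1 * x)) mulrA divff // mul1r].
Qed.

Let gnz y : ~~ inb W1 (g y) -> y != 0.
Proof. by apply: contraNneq => ->. Qed.
Let fnz x : f x != a -> x != 0.
Proof. by apply: contraNneq => ->. Qed.

(** The points x and s t / x of the first line are concyclic with s and t, and
    [nopair] forbids two different colours on this circle. *)
Lemma reg_invol s t x : g s = g s0 -> g t = g t0 -> x != 0 -> f (s * t / x) = f x.
Proof.
move=> Es Et x0; apply/eqP; apply: contraT => ne.
have := nopair ne; rewrite -Es -Et K' //; field.
exact: x0.
Qed.

Lemma reg_ratio s s' : g s = g s0 -> g s' = g s0 -> triv (s / s').
Proof.
move=> Es Es'; have s00 : s != 0 by apply: gnz; rewrite Es.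
have s'0 : s' != 0 by apply: gnz; rewrite Es'.
have t00 := gnz Ut.
split=> [|x]; first by rewrite mulf_neq0 ?invr_neq0.
have [->|x0] := eqVneq x 0; first by rewrite mulr0.
rewrite -(reg_invol Es' (erefl (g t0)) x0).
rewrite -(reg_invol Es (erefl (g t0)) (x := s' * t0 / x)); last by rewrite !mulf_neq0 ?invr_neq0.
by congr f; fieldx.
Qed.

Let tlf := two_lines K fW gW dW1 g0'.
Let tlg y1 y2 x : ~~ inb W1 (g y1) -> ~~ inb W1 (g y2) -> g y1 != g y2 -> f x != a ->
  f (y1 * y2 / x) != a /\ conc (g y1) (g y2) (f x) (f (y1 * y2 / x)).
Proof.
rewrite -!reg_offE => U1 U2 n12 Ux.
exact: (two_lines K' gW fW dW2 f0 U1 U2 n12 Ux).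
Qed.

(** Let s' be the second point of the second line on the circle through x1, x2
    and s0. If its colour is not that of s0, the pair s', t0 shares the property
    [nopair] of s0, t0 for lack of other colours. In both cases s' / s0 acts
    trivially. *)
Lemma reg_two_colours x1 x2 : f x1 != a -> f x2 != a -> f x1 != f x2 ->
  (forall x, f x != a -> f x = f x1 \/ f x = f x2) -> triv (x1 * x2 / s0 ^+ 2).
Proof.
move=> N1 N2 n12 two.
have U1 := N1; rewrite -reg_offE in U1; have U2 := N2; rewrite -reg_offE in U2.
have [Us' C] := tlf U1 U2 n12 Us.
set s' := x1 * x2 / s0 in Us' C.
have s00 := gnz Us; have t00 := gnz Ut; have s'0 := gnz Us'.
have -> : x1 * x2 / s0 ^+ 2 = s' / s0 by rewrite /s' expr2 invfM mulrA.
have [E|ne] := eqVneq (g s') (g s0); first exact: reg_ratio.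
have nst' : g s' != g t0.
  by apply: contraNneq (nopair n12) => <-; rewrite conc_pairs.
have n1 : f x1 != g s' by apply: contraNneq Us' => <-.
have n2 : f x2 != g s' by apply: contraNneq Us' => <-.
have n1' : f x1 != g s0 by apply: contraNneq Us => <-.
have n2' : f x2 != g s0 by apply: contraNneq Us => <-.
have bad : ~~ conc (g s') (g t0) (f x1) (f x2).
  apply/negP => C'.
  have dW' := dim_span3 n12 n1 n2.
  have := inb_conc (g t0) dW' n12 n1' n2' (inb1 _ _ _) (inb2 _ _ _).
  rewrite -!conc_span // concC34 => /(_ C).
  rewrite conc_pairs in C'; rewrite C'.
  by rewrite conc_pairs (negPf (nopair n12)).
have claim0 x : f x != a -> f (s' * t0 / x) = f x.
  move=> Nx; have [Nx' Cx] := tlg Us' Ut nst' Nx.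
  have [E1|E1] := two _ Nx; have [E2|E2] := two _ Nx'; rewrite E1 E2 //.
    by move: Cx; rewrite E1 E2 (negPf bad).
  by move: Cx; rewrite E1 E2 concC34 (negPf bad).
have claim x : x != 0 -> f (s' * t0 / x) = f x.
  move=> x0; have [Ea|] := eqVneq (f x) a; last exact: claim0.
  have [-> //|Nx'] := eqVneq (f (s' * t0 / x)) a.
  have := claim0 _ Nx'; have -> : s' * t0 / (s' * t0 / x) = x by fieldx.
  by [].
split=> [|x]; first by rewrite mulf_neq0 ?invr_neq0.
have [->|x0] := eqVneq x 0; first by rewrite mulr0.
rewrite -(reg_invol (erefl (g s0)) (erefl (g t0)) x0).
rewrite -(claim (s0 * t0 / x)); last by rewrite !mulf_neq0 ?invr_neq0.
by congr f; fieldx.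
Qed.

Section Many.
Variables x1 x2 x3 : R.
Hypotheses (N1 : f x1 != a) (N2 : f x2 != a) (N3 : f x3 != a).
Hypotheses (n12 : f x1 != f x2) (n13 : f x1 != f x3) (n23 : f x2 != f x3).

Let third x x' : exists x3', [/\ f x3' != a, f x3' != f x & f x3' != f x'].
Proof.
have /or3P[] := third_value (f x) (f x') n12 n13 n23 => /andP[h1 h2].
- by exists x1.
- by exists x2.
- by exists x3.
Qed.

(** The ratio x / x' fixes the colour of s0 by [same_colour_acts], and
    [reg_ratio] carries this back to the first line. *)
Lemma reg_same x x' : f x = f x' -> f x != a -> triv (x / x').
Proof.
move=> E Nx; have [y2 [Ny2 n2 _]] := third x x'.
have [y3 [Ny3 n3 n32]] := third x y2.
have U := Nx; have U2 := Ny2; have U3 := Ny3; rewrite -!reg_offE in U U2 U3.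
have n23' : f y2 != f y3 by rewrite eq_sym.
have := same_colour_acts K fW gW dW1 f0 g0' E U U2 U3 n2 n3 n23' Us.
move=> H; have := reg_ratio H (erefl _).
by rewrite mulfK // gnz.
Qed.

(** Otherwise the product of two points of different colours would be s0^2 up to
    a trivial ratio, and the quotient of two such products would identify two
    colours. *)
Lemma reg_third_g : exists2 y, ~~ inb W1 (g y) & (g y != g s0) && (g y != g t0).
Proof.
apply: contrapT => nex.
have st y : ~~ inb W1 (g y) -> g y = g s0 \/ g y = g t0.
  move=> Uy; have [|h1] := eqVneq (g y) (g s0); first by left.
  have [|h2] := eqVneq (g y) (g t0); first by right.
  by case: nex; exists y => //; rewrite h1.
have key z z' : f z != a -> f z' != a -> f z != f z' -> triv (z * z' / s0 ^+ 2).
  move=> Nz Nz' nz; have U := Nz; have U' := Nz'; rewrite -!reg_offE in U U'.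
  have [Uw Cw] := tlf U U' nz Us; have [E|E] := st _ Uw.
    by have := reg_ratio E (erefl _); rewrite expr2 invfM mulrA.
  by move: Cw; rewrite E conc_pairs (negPf (nopair nz)).
have [T2 T3] := (key _ _ N1 N2 n12, key _ _ N1 N3 n13).
have [_ /(_ x3)] := trivM T2 (trivV T3).
have z1 := fnz N1; have z2 := fnz N2; have z3 := fnz N3; have s00 := gnz Us.
have -> : x1 * x2 / s0 ^+ 2 / (x1 * x3 / s0 ^+ 2) * x3 = x2 by fieldx.
by move/eqP; rewrite (negPf n23).
Qed.

(** Multiplication by x' / x is the composite of the swaps with the pairs (s0,
    k) and (x' / x s0, k) of the second line, where a third colour on that line
    provides a suitable k. *)
Lemma reg_stab x x' z : f x != a -> f x' != a -> f z != a -> f (x' / x * z) != a.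
Proof.
move=> Nx Nx' Nz; have [h Uh /andP[hs ht]] := reg_third_g.
have sh : g s0 != g h by rewrite eq_sym.
have th : g t0 != g h by rewrite eq_sym.
have U := Nx; have U' := Nx'; rewrite -!reg_offE in U U'.
have [w [Nw nw nw']] := third x x'; have Uw := Nw; rewrite -reg_offE in Uw.
have nxw : f x != f w by rewrite eq_sym.
have nxw' : f x' != f w by rewrite eq_sym.
have [Uz _] := tlf U Uw nxw Us; have [Uy _] := tlf U' Uw nxw' Uz.
have x0 := fnz Nx; have x'0 := fnz Nx'; have z0 := fnz Nz; have w0 := fnz Nw; have s00 := gnz Us.
have Ey : x' * w / (x * w / s0) = x' / x * s0 by fieldx.
rewrite Ey in Uy.
have [k [Uk ky ks]] : exists k, [/\ ~~ inb W1 (g k), g k != g (x' / x * s0) & g k != g s0].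
  have /or3P[] := third_value (g (x' / x * s0)) (g s0) nst sh th => /andP[h1 h2].
  - by exists s0.
  - by exists t0.
  - by exists h.
have k0 := gnz Uk.
have nsk : g s0 != g k by rewrite eq_sym.
have nyk : g (x' / x * s0) != g k by rewrite eq_sym.
have [Nv _] := tlg Us Uk nsk Nz; have [N _] := tlg Uy Uk nyk Nv.
by move: N; have -> : x' / x * s0 * k / (s0 * k / z) = x' / x * z by fieldx.
Qed.

(** Three colours contain points u, v with |v / u| different from 1, and two
    points (v / u)^k u have the same colour by the pigeonhole principle. *)
Lemma reg_big (q : seq E) : (forall x, f x \in q) -> exists2 m, triv m & 1 < `|m|.
Proof.
move=> fq.
suff [m Tm m1] : exists2 m, triv m & `|m| != 1.
  have m0 : 0 < `|m| by rewrite normr_gt0; case: Tm.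
  have [lt|gt|e] := ltgtP 1 `|m|.
  - by exists m.
  - exists m^-1; first exact: trivV.
    by rewrite normfV invf_gt1.
  - by rewrite -e eqxx in m1.
have [u [v [Nu Nv nuv]]] : exists u v, [/\ f u != a, f v != a & `|v / u| != 1].
  have e x y : f x != a -> `|y / x| = 1 -> y = x \/ y = - x.
    move=> Nx; have x0 : `|x| != 0 by rewrite normr_eq0 (fnz Nx).
    rewrite normrM normfV => /(congr1 ( *%R^~ `|x|)); rewrite mulfVK // mul1r.
    by move/eqP; rewrite eqr_norm2 => /orP[]/eqP; [left|right].
  have [h2|h2] := eqVneq (`|x2 / x1|) 1; last by exists x1, x2.
  have [h3|h3] := eqVneq (`|x3 / x1|) 1; last by exists x1, x3.
  have [e2|e2] := e _ _ N1 h2; first by move: n12; rewrite e2 eqxx.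
  have [e3|e3] := e _ _ N1 h3; first by move: n13; rewrite e3 eqxx.
  by move: n23; rewrite e2 e3 eqxx.
have u0 := fnz Nu; have v0 := fnz Nv.
have Npow k : f ((v / u) ^+ k * u) != a.
  by elim: k => [|k IH]; [rewrite expr0 mul1r|rewrite exprS -mulrA; exact: reg_stab].
pose F k := f ((v / u) ^+ k * u).
have : ~~ uniq (map F (iota 0 (size q).+1)).
  apply/negP => /uniq_leq_size H.
  have := H q; rewrite size_map size_iota ltnn => H'; apply: notF; apply: H'.
  by move=> _ /mapP[k _ ->]; exact: fq.
move/(uniqPn (F 0%N)) => [i [j [ij]]]; rewrite size_map size_iota => jq.
have iq := ltn_trans ij jq.
rewrite !(nth_map 0%N) ?size_iota // !nth_iota // !add0n => Eij.
have := reg_same (esym Eij) (Npow j).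
have r0 : v / u != 0 by rewrite mulf_neq0 ?invr_neq0.
have -> : (v / u) ^+ j * u / ((v / u) ^+ i * u) = (v / u) ^+ (j - i).
  rewrite -{1}(subnK (ltnW ij)) exprD.
  have ri : (v / u) ^+ i != 0 by rewrite expf_neq0.
  by fieldx.
exists ((v / u) ^+ (j - i)) => //.
by rewrite normrX pexpr_eq1 ?subn_gt0 ?normr_ge0.
Qed.
End Many.
End Regular.

(** f and g are the colours along two circles through points 0 and infinity of
    the same colour f 0. The circles through the points s0, t0 of the second
    circle do not see two different colours on the first one. *)
Record trivial_pencil (R : realType) (n : nat) (f g : R -> Rinfty R n)
    (W1 : {vspace ('rV[R]_n * R^o * R^o)%type}) (s0 t0 : R) : Prop := TrivialPencil {
  tp_conc : forall x1 x2 y1 y2, x1 * x2 = y1 * y2 -> conc (f x1) (f x2) (g y1) (g y2);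
  tp_f : forall x, inb W1 (f x);
  tp_dim : \dim W1 = 3;
  tp_0 : g 0 = f 0;
  tp_g : forall y, inb (span3 (f 0) (g s0) (g t0)) (g y);
  tp_s : ~~ inb W1 (g s0);
  tp_t : ~~ inb W1 (g t0);
  tp_st : g s0 != g t0;
  tp_pair : forall x x', f x != f x' -> ~~ conc (g s0) (g t0) (f x) (f x') }.

Section RegularStructure.
Variables (R : realType) (n : nat) (f g : R -> Rinfty R n).
Variables (W1 : {vspace ('rV[R]_n * R^o * R^o)%type}) (s0 t0 : R).
Hypothesis TP : trivial_pencil f g W1 s0 t0.
Local Notation a := (f 0).
Local Notation triv := (trivial_ratio f).

Lemma trivial_pencilC : trivial_pencil f g W1 t0 s0.
Proof.
case: TP => K fW dW g0 gW Us Ut nst np; split => //; last 2 first.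
- by rewrite eq_sym.
- by move=> x x' /np; rewrite conc_pairs concC34 conc_pairs.
move=> y; have as0 : f 0 != g s0 by apply: contraNneq Us => <-; exact: fW.
have at0 : f 0 != g t0 by apply: contraNneq Ut => <-; exact: fW.
rewrite -conc_span // 1?eq_sym //.
have := gW y; rewrite -conc_span // => H.
by rewrite concC23.
Qed.

(** If the first line has only two colours apart from f 0, the products of two
    points of different colours are s0^2 and t0^2 up to trivial ratios, and the
    squares are s0 t0; the other case is covered by [reg_same], [reg_stab] and
    [reg_big]. *)
Lemma reg_structure (q : seq (Rinfty R n)) x1 x2 : (forall x, f x \in q) ->
  f x1 != a -> f x2 != a -> f x1 != f x2 ->
  [/\ forall x x', f x = f x' -> f x != a -> triv (x / x'),
      forall x x' z, f x != a -> f x' != a -> f z != a -> f (x' / x * z) != a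
    & exists2 m, triv m & 1 < `|m|].
Proof.
case: (TP) => K fW dW g0 gW Us Ut nst np fq N1 N2 n12.
have [[x3 [N3 n13 n23]]|two] := pselect (exists x3, [/\ f x3 != a, f x1 != f x3 & f x2 != f x3]).
  split.
  - by move=> x x'; apply: (reg_same K fW dW g0 gW Us Ut nst np (x1 := x1) (x2 := x2) (x3 := x3)).
  - by move=> x x' z; apply: (reg_stab K fW dW g0 gW Us Ut nst np (x1 := x1) (x2 := x2) (x3 := x3)).
  - exact: (reg_big K fW dW g0 gW Us Ut nst np N1 N2 N3 n12 n13 n23 fq).
have {}two z : f z != a -> f z = f x1 \/ f z = f x2.
  move=> Nz; have [|h1] := eqVneq (f z) (f x1); first by left.
  have [|h2] := eqVneq (f z) (f x2); first by right.
  by case: two; exists z; split => //; rewrite eq_sym.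
have fnz x : f x != a -> x != 0 by apply: contraNneq => ->.
have s00 : s0 != 0 by apply: contraNneq Us => ->; rewrite g0.
have t00 : t0 != 0 by apply: contraNneq Ut => ->; rewrite g0.
have two' x x' : f x != a -> f x' != a -> f x != f x' ->
    forall z, f z != a -> f z = f x \/ f z = f x'.
  move=> Nx Nx' nx z Nz; have [Ex|Ex] := two _ Nx; have [Ex'|Ex'] := two _ Nx';
    have [Ez|Ez] := two _ Nz; move: nx; rewrite Ex Ex' Ez ?eqxx //; by [left|right].
have Ps x x' : f x != a -> f x' != a -> f x != f x' -> triv (x * x' / s0 ^+ 2).
  by move=> *; apply: (reg_two_colours K fW dW g0 gW Us Ut nst np) => //; exact: two'.
have Pt x x' : f x != a -> f x' != a -> f x != f x' -> triv (x * x' / t0 ^+ 2).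
  case: trivial_pencilC => K' fW' dW' g0' gW' Us' Ut' nst' np' *.
  by apply: (reg_two_colours K' fW' dW' g0' gW' Us' Ut' nst' np') => //; exact: two'.
have SC x x' : f x = f x' -> f x != a -> triv (x / x').
  move=> E Nx; have Nx' : f x' != a by rewrite -E.
  have [w [Nw nw]] : exists w, f w != a /\ f x != f w.
    have [Ex|Ex] := two _ Nx; [exists x2|exists x1]; rewrite Ex //; split => //.
    by rewrite eq_sym.
  have nw' : f x' != f w by rewrite -E.
  have := trivM (Ps _ _ Nx Nw nw) (trivV (Ps _ _ Nx' Nw nw')).
  have x0 := fnz _ Nx; have x'0 := fnz _ Nx'; have w0 := fnz _ Nw.
  by have -> : x * w / s0 ^+ 2 / (x' * w / s0 ^+ 2) = x / x' by fieldx.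
have SQ x : f x != a -> triv (x ^+ 2 / (s0 * t0)).
  move=> Nx; have x0 := fnz _ Nx.
  have E := reg_invol K np (erefl (g s0)) (erefl (g t0)) x0.
  have := SC _ _ (esym E) Nx.
  by have -> : x / (s0 * t0 / x) = x ^+ 2 / (s0 * t0) by fieldx.
split => //.
  move=> x x' z Nx Nx' Nz; have x0 := fnz _ Nx; have x'0 := fnz _ Nx'; have z0 := fnz _ Nz.
  have [E|ne] := eqVneq (f x') (f x); first by have [_ ->] := SC _ _ E Nx'.
  have nx : f x != f x' by rewrite eq_sym.
  have [Ez|Ez] := two' _ _ Nx Nx' nx z Nz.
    have [_ /(_ x')] := SC _ _ Ez Nz.
    have -> : z / x * x' = x' / x * z by fieldx.
    by move=> ->.
  have T := trivM (SC _ _ Ez Nz) (trivM (SQ _ Nx') (trivV (SQ _ Nx))).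
  have [_ /(_ x)] := T.
  have -> : z / x' * (x' ^+ 2 / (s0 * t0) / (x ^+ 2 / (s0 * t0))) * x = x' / x * z by fieldx.
  by move=> ->.
have z1 := fnz _ N1; have z2 := fnz _ N2.
pose u := x1 / s0; have u0 : u != 0 by rewrite mulf_neq0 ?invr_neq0.
have T4 : triv (u ^+ 4).
  have := trivM (trivM (SQ _ N1) (SQ _ N1)) (trivM (trivV (Pt _ _ N1 N2 n12)) (Ps _ _ N1 N2 n12)).
  have -> // : x1 ^+ 2 / (s0 * t0) * (x1 ^+ 2 / (s0 * t0)) *
     ((x1 * x2 / t0 ^+ 2)^-1 * (x1 * x2 / s0 ^+ 2)) = u ^+ 4.
  by rewrite /u; fieldx.
have u1 : `|u| != 1.
  apply/negP => /eqP u1.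
  have uu : x1 ^+ 2 = s0 ^+ 2.
    have : u ^+ 2 = 1 by rewrite -real_normK ?num_real // u1 expr1n.
    by rewrite expr_div_n => /divr1_eq.
  have [_ /(_ x1)] := Ps _ _ N1 N2 n12; rewrite -uu.
  have -> : x1 * x2 / x1 ^+ 2 * x1 = x2 by fieldx.
  by move/eqP; rewrite eq_sym (negPf n12).
have un : 0 < `|u| by rewrite normr_gt0.
have [lt|gt|e] := ltgtP 1 `|u|.
- by exists (u ^+ 4) => //; rewrite normrX exprn_egt1.
- exists (u ^+ 4)^-1; first exact: trivV.
  by rewrite normfV normrX invf_gt1 ?exprn_gt0 // exprn_ilt1.
- by rewrite -e eqxx in u1.
Qed.
End RegularStructure.

(** * The same circle seen from two pairs of poles *)

(** By Bernoulli's inequality. *)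
Lemma expr_unbounded (R : realType) (x b : R) : 1 < x -> exists k, b < x ^+ k.
Proof.
move=> x1; have x0 : 0 < x - 1 by rewrite subr_gt0.
have ber k : 1 + k%:R * (x - 1) <= x ^+ k.
  elim: k => [|k IH]; first by rewrite mul0r addr0 expr0.
  rewrite exprS; apply: le_trans (_ : x * (1 + k%:R * (x - 1)) <= _); last first.
    by rewrite ler_pM2l // (lt_trans ltr01).
  rewrite -natr1 -subr_ge0 (_ : _ - _ = k%:R * (x - 1) ^+ 2); last by ring.
  by rewrite mulr_ge0 ?sqr_ge0.
exists (Num.truncn (b / (x - 1))).+1; apply: lt_le_trans (ber _).
have : b / (x - 1) < (Num.truncn (b / (x - 1))).+1%:R by exact: truncnS_gt.
by rewrite ltr_pdivrMr // => /lt_trans; apply; rewrite ltrDr ltr01.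
Qed.

Section Compat.
Variables (R : realType) (n : nat) (f g : R -> Rinfty R n).
Variables (W1 : {vspace ('rV[R]_n * R^o * R^o)%type}) (s0 t0 : R).
Hypothesis TP : trivial_pencil f g W1 s0 t0.
Variables (q : seq (Rinfty R n)) (x1 x2 : R).
Hypotheses (fq : forall x, f x \in q) (N1 : f x1 != f 0) (N2 : f x2 != f 0) (n12 : f x1 != f x2).

(** Multiplication by s induces a permutation of the colours. *)
Definition compat (h : R -> Rinfty R n) s :=
  s != 0 /\ forall x x', h x = h x' <-> h (s * x) = h (s * x').

Lemma reg_compat y1 y2 : f y1 != f 0 -> f y2 != f 0 ->
  exists s, compat f s /\ f (s * y1) = f y2.
Proof.
move=> M1 M2; have [SC ST _] := reg_structure TP fq N1 N2 n12.
have nz x : f x != f 0 -> x != 0 by apply: contraNneq => ->.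
have key u v : f u != f 0 -> f v != f 0 ->
    forall x x', f x = f x' -> f (v / u * x) = f (v / u * x').
  move=> Mu Mv x x' E; have u0 := nz _ Mu; have v0 := nz _ Mv.
  have [Ea|Nx] := eqVneq (f x) (f 0); last first.
    have [r0 H] := SC _ _ E Nx.
    have x'0 : x' != 0 by move: r0; rewrite mulf_eq0 negb_or invr_eq0 => /andP[].
    rewrite -[RHS]H; congr f; fieldx.
  have stay z : f z = f 0 -> f (v / u * z) = f 0.
    move=> Ez; apply/eqP; apply: contraT => N; have := ST _ _ _ Mv Mu N.
    rewrite (_ : u / v * (v / u * z) = z); last by fieldx.
    by rewrite Ez eqxx.
  by rewrite !stay // -E.
have y10 := nz _ M1; have y20 := nz _ M2.
exists (y2 / y1); split; last by rewrite divfK.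
split=> [|x x']; first by rewrite mulf_neq0 ?invr_neq0.
split; first exact: key.
move/(key _ _ M2 M1).
have K z : y1 / y2 * (y2 / y1 * z) = z by fieldx.
by rewrite !K.
Qed.

(** The quotient of two multiplications that agree at one colour acts trivially.
    *)
Lemma compat_unique s s' y : compat f s -> compat f s' -> f y != f 0 ->
  f (s * y) = f (s' * y) -> forall x, f (s * x) = f (s' * x).
Proof.
move=> [s0' Hs] [s'0 Hs'] My E x; have [SC _ _] := reg_structure TP fq N1 N2 n12.
have y0 : y != 0 by apply: contraNneq My => ->.
have N : f (s * y) != f 0.
  by apply: contraNneq My => Ea; apply/eqP/(Hs _ 0); rewrite mulr0.
have [_ H] := SC _ _ E N.
rewrite -[RHS]H; congr f; fieldx.
Qed.

Lemma reg_trivial_big : exists2 m, trivial_ratio f m & 1 < `|m|.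
Proof. by have [] := reg_structure TP fq N1 N2 n12. Qed.
End Compat.

Section TwoPoles.
Variables (R : realType) (n : nat) (f f2 g g2 : R -> Rinfty R n).
Variables (W1 W2 : {vspace ('rV[R]_n * R^o * R^o)%type}) (s0 t0 s2 t2 : R).
Hypotheses (TP : trivial_pencil f g W1 s0 t0) (TP2 : trivial_pencil f2 g2 W2 s2 t2).
Variables (q : seq (Rinfty R n)) (p' q' xc : R).
Hypotheses (fq : forall x, f x \in q) (fq2 : forall x, f2 x \in q).
Local Notation G w := ((q' * w + p') / (w + 1)).
Hypothesis f2E : forall w, w != -1 -> f2 w = f (G w).
Hypothesis f2_1 : f2 (-1) = f 0.
Hypotheses (fp : f p' != f 0) (fpq : f q' = f p') (pq : p' != q').
Hypotheses (fc : f xc != f 0) (fcp : f xc != f p').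

Let q0 : q' != 0. Proof. by apply: contraNneq fp => E; rewrite -fpq E eqxx. Qed.
Let f20 : f2 0 = f p'.
Proof.
have n01 : 0 != -1 :> R by rewrite eq_sym oppr_eq0 oner_neq0.
by rewrite (f2E n01) mulr0 !add0r divr1.
Qed.

(** The equation is quadratic in w, and its discriminant is a quadratic
    polynomial in s with the leading coefficient (q' s' - p')^2 > 0. *)
Lemma real_fixed_point (s s' : R) : s' != 0 -> s' != 1 -> q' * s' != p' -> 1 < `|s| ->
  (2 * `|(q' * s' + p') * (q' + p' * s') - 4 * (q' * p' * s')| +
    `|(q' + p' * s') ^+ 2 - 4 * (q' * p' * s')|) / (q' * s' - p') ^+ 2 < `|s| ->
  exists w, [/\ w != -1, s' * w != -1 & s * G (s' * w) = G w].
Proof.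
move=> s'0 s'1 qs s1 big.
set A := q' * s' + p' in big *; set B := q' + p' * s' in big *; set C := q' * p' * s' in big *.
have D0 : 0 < (q' * s' - p') ^+ 2 by rewrite exprn_even_gt0 //= subr_eq0.
pose al := q' * s' * (s - 1); pose be := s * A - B; pose ga := p' * (s - 1).
have s1' : s - 1 != 0 by rewrite subr_eq0; apply: contraTneq s1 => ->; rewrite normr1 ltxx.
have al0 : al != 0 by rewrite !mulf_neq0.
have disc : 0 <= be ^+ 2 - 4 * al * ga.
  have -> : be ^+ 2 - 4 * al * ga = s ^+ 2 * (q' * s' - p') ^+ 2
      - 2 * s * (A * B - 4 * C) + (B ^+ 2 - 4 * C).
    by rewrite /be /al /ga /A /B /C; ring.
  move: big; rewrite ltr_pdivrMr //.
  set X := A * B - _; set Y := B ^+ 2 - _; set D := (q' * s' - p') ^+ 2 in D0 *.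
  move=> big.
  have h1 : `|s| * (2 * `|X| + `|Y|) <= s ^+ 2 * D.
    rewrite -(real_normK (num_real s)) expr2 -mulrA ler_pM2l; last by rewrite (lt_trans ltr01).
    exact: ltW.
  have h2 : 2 * s * X <= `|s| * (2 * `|X|).
    rewrite -mulrA (mulrCA `|s|) ler_pM2l // -normrM; exact: ler_norm.
  have h3 : - Y <= `|s| * `|Y|.
    apply: le_trans (_ : `|Y| <= _); first by rewrite -normrN ler_norm.
    by rewrite -[leLHS]mul1r; apply: ler_wpM2r => //; exact: ltW.
  by rewrite mulrDr in h1; lra.
pose w := (- be + Num.sqrt (be ^+ 2 - 4 * al * ga)) / (2 * al).
have root : al * w ^+ 2 + be * w + ga = 0.
  have := sqr_sqrtr disc; rewrite /w; set r := Num.sqrt _ => rr.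
  have -> : al * ((- be + r) / (2 * al)) ^+ 2 + be * ((- be + r) / (2 * al)) + ga =
     (r ^+ 2 - (be ^+ 2 - 4 * al * ga)) / (4 * al) by field.
  by rewrite rr subrr mul0r.
have n1 : w != -1.
  apply: contraTneq isT => E; move: root; rewrite E.
  have -> : al * (-1) ^+ 2 + be * -1 + ga = (q' - p') * (1 - s').
    by rewrite /al /be /ga /A /B; ring.
  move/eqP; rewrite mulf_eq0 !subr_eq0 (eq_sym q') (negPf pq) /=.
  by rewrite eq_sym (negPf s'1).
have n2 : s' * w != -1.
  apply: contraTneq isT => E.
  have : s' * (al * w ^+ 2 + be * w + ga) = 0 by rewrite root mulr0.
  have -> : s' * (al * w ^+ 2 + be * w + ga) =
     q' * (s - 1) * (s' * w) ^+ 2 + be * (s' * w) + s' * ga.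
    by rewrite /al; ring.
  rewrite E; have -> : q' * (s - 1) * (-1) ^+ 2 + be * -1 + s' * ga = s * ((q' - p') * (1 - s')).
    by rewrite /be /ga /A /B; ring.
  move/eqP; rewrite !mulf_eq0 !subr_eq0 (eq_sym q') (negPf pq) /=.
  rewrite (eq_sym 1) (negPf s'1) orbF => /eqP s00; move: s1.
  by rewrite s00 normr0 ltr10.
exists w; split => //.
have w1 : w + 1 != 0 by rewrite addr_eq0.
have w2 : s' * w + 1 != 0 by rewrite addr_eq0.
apply/eqP; rewrite -subr_eq0; apply/eqP.
have -> : s * G (s' * w) - G w =
   (al * w ^+ 2 + be * w + ga) / ((w + 1) * (s' * w + 1)).
  by rewrite /al /be /ga /A /B; fieldx.
by rewrite root mul0r.
Qed.

(** The colours of the line are permuted by multiplications in the frame with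
    poles 0, infinity and in the frame with poles p', q'. Fix s1 moving the
    colour of p' in the first frame. If for every s' of the second frame the
    product of the two permutations fixed some colour xi, then s' |-> xi would
    be injective and miss at least one of the available colours, contrary to
    finiteness. So some product fixes no colour. But s1 may be multiplied by
    trivial ratios of large absolute value, and then the real map inducing the
    product has a fixed point. *)
Lemma two_poles_absurd : False.
Proof.
have f2n : f2 (-1) != f2 0 by rewrite f2_1 f20 eq_sym.
have xc0 : xc != 0 by apply: contraNneq fc => ->.
have [wc fwc] : exists wc, f2 wc = f xc.
  have xq : q' != xc by apply: contraNneq fcp => <-; rewrite fpq.
  have qxc : q' - xc != 0 by rewrite subr_eq0.
  have w1 : (xc - p') / (q' - xc) + 1 != 0.
    have -> : (xc - p') / (q' - xc) + 1 = (q' - p') / (q' - xc) by field.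
    by rewrite mulf_neq0 ?invr_neq0 // subr_eq0 eq_sym.
  exists ((xc - p') / (q' - xc)); rewrite f2E -?addr_eq0 //; congr f.
  have qp : q' - p' != 0 by rewrite subr_eq0 eq_sym.
  have -> : (xc - p') / (q' - xc) + 1 = (q' - p') / (q' - xc) by field.
  by fieldx.
have fwc0 : f2 wc != f2 0 by rewrite fwc f20.
have f2nc : f2 (-1) != f2 wc by rewrite f2_1 fwc eq_sym.
have fpc : f p' != f xc by rewrite eq_sym.
have [s1 [cs1 Es1]] := reg_compat TP fq fp fc fpc fp fc.
have [m Tm m1] := reg_trivial_big TP fq fp fc fpc.
have [s10 Hs1] := cs1.
(* L lists the colours of the line other than f 0 and f p' *)
pose isc z := exists x, f x = z.
pose L := undup [seq z <- q | `[< isc z >] && (z != f 0) && (z != f p')].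
have LP z : z \in L = [&& `[< isc z >], z != f 0 & z != f p'].
  rewrite mem_undup mem_filter; apply/idP/idP.
    by move=> /andP[/andP[/andP[-> ->] ->] _].
  move=> /and3P[h1 h2 h3]; rewrite h1 h2 h3 /=.
  by case/asboolP: h1 => x <-; exact: fq.
pose be := f (p' / s1).
have be_a : be != f 0.
  apply: contraNneq fp => E; apply/eqP.
  have := (Hs1 (p' / s1) 0).1 E; rewrite mulr0 => <-; congr f; field.
  exact: s10.
have be_b : be != f p'.
  apply: contraNneq fcp => E; apply/eqP; rewrite -Es1.
  have := (Hs1 (p' / s1) p').1 E => <-; congr f; field.
  exact: s10.
have beL : be \in L by rewrite LP be_a be_b !andbT; apply/asboolP; exists (p' / s1).
have f2c w : isc (f2 w).
  have [->|w1] := eqVneq w (-1); first by exists 0; rewrite f2_1.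
  by exists (G w); rewrite f2E.
have cf2 z : isc z -> z != f 0 -> z != f p' -> exists w, f2 w = z /\ w != -1.
  move=> [x Ex] za zb.
  have xq : q' != x by apply: contraNneq zb => E; rewrite -Ex -E fpq.
  have qxc : q' - x != 0 by rewrite subr_eq0.
  have qp : q' - p' != 0 by rewrite subr_eq0 eq_sym.
  have E1 : (x - p') / (q' - x) + 1 = (q' - p') / (q' - x) by field.
  have w1 : (x - p') / (q' - x) != -1.
    by rewrite -addr_eq0 E1 mulf_neq0 ?invr_neq0.
  exists ((x - p') / (q' - x)); split => //; rewrite f2E // -Ex; congr f.
  by rewrite E1; fieldx.
have s'ex c : c \in L -> exists s', compat f2 s' /\ f2 (s' * -1) = c.
  rewrite LP => /and3P[/asboolP ic ca cb].
  have [w [Ew w1]] := cf2 _ ic ca cb.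
  have wN : f2 w != f2 0 by rewrite Ew f20.
  have [s' [cs Es]] := reg_compat TP2 fq2 f2n fwc0 f2nc f2n wN.
  by exists s'; split=> //; rewrite Es.
(* some product of the two actions moves every colour *)
have [c [cL [s' [cs' Es' free]]]] : exists c, c \in L /\ exists s', [/\ compat f2 s',
    f2 (s' * -1) = c & forall x w, f2 w = f (s1 * x) -> f2 (s' * w) <> f x].
  apply: contrapT => nex.
  have bad c : exists xi, c \in L -> exists s' x w, [/\ compat f2 s', f2 (s' * -1) = c,
      f2 w = f (s1 * x), f2 (s' * w) = f x & xi = f x].
    have [cL|] := boolP (c \in L); last by exists c.
    have [s' [cs Es]] := s'ex c cL.
    have [[x [w [E1 E2]]]|no] := pselect (exists x w, f2 w = f (s1 * x) /\ f2 (s' * w) = f x).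
      by exists (f x) => _; exists s', x, w.
    case: nex; exists c; split => //; exists s'; split => // x w E1 E2.
    by apply: no; exists x, w.
  (* be is never of the form xi c, so xi is not onto L *)
  have [xi Hxi] := choice bad.
  have f2wb s' x w : compat f2 s' -> f2 w = f2 0 -> f2 (s' * w) = f x -> f x = f p'.
    move=> [s'0 Hs'] Ew <-; rewrite -f20 -[in RHS](mulr0 s'); exact: (Hs' w 0).1.
  have inj : {in L &, injective xi}.
    move=> c c' cL cL' E; have [s' [x [w [cs Es E1 E2 E3]]]] := Hxi c cL.
    have [s'' [x' [w' [cs' Es' E1' E2' E3']]]] := Hxi c' cL'.
    have ww : f2 w = f2 w'.
      by rewrite E1 E1'; apply: (Hs1 x x').1; rewrite -E3 -E3'.
    have wb : f2 w != f2 0.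
      apply/eqP => Ew; have Exb := f2wb _ _ _ cs Ew E2.
      move: E1; rewrite Ew f20 => E1; have := (Hs1 x p').1 Exb; rewrite -E1 Es1 => H.
      by move: fcp; rewrite -H eqxx.
    have E4 : f2 (s' * w) = f2 (s'' * w).
      by rewrite E2 -E3 E E3' -E2'; have [_ H] := cs'; exact/esym/(H w w').1.
    have := compat_unique TP2 fq2 f2n fwc0 f2nc cs cs' wb E4 (-1).
    by rewrite Es Es'.
  have sub : {subset map xi L <= rem be L}.
    move=> _ /mapP[c cL ->]; have [s' [x [w [cs Es E1 E2 E3]]]] := Hxi c cL.
    have [s'0 Hs'] := cs.
    rewrite mem_rem_uniq ?undup_uniq // inE /= LP E3; apply/and4P; split.
    - apply/negP => /eqP Ex; have := (Hs1 _ _).1 Ex.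
      have -> : s1 * (p' / s1) = p' by field.
      rewrite -E1 -f20 => Ew; have := f2wb _ _ _ cs Ew E2 => E4.
      by move: be_b; rewrite -Ex E4 eqxx.
    - by apply/asboolP; exists x.
    - apply/negP => /eqP Ex; have := (Hs1 _ _).1 Ex; rewrite mulr0 -E1 -f2_1 => Ew.
      have := (Hs' _ _).1 Ew; rewrite E2 Ex Es => E4.
      by move: cL; rewrite LP -E4 eqxx andbF.
    - apply/negP => /eqP Ex; have := (Hs1 _ _).1 Ex; rewrite Es1 -E1 => Ew.
      have : f2 (s' * w) = f2 (s' * 0) by rewrite mulr0 E2 Ex f20.
      by move/(Hs' _ _).2; rewrite Ew f20 => E4; move: fcp; rewrite E4 eqxx.
  have := uniq_leq_size _ sub; rewrite map_inj_in_uniq // undup_uniq => /(_ isT).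
  rewrite size_map size_rem // leqNgt => /negP; apply.
  by rewrite prednK // lt0n size_eq0; apply: contraTneq beL => ->.
have [s'0 Hs'] := cs'.
have [ca cb] : c != f 0 /\ c != f p' by move: cL; rewrite LP => /and3P[].
have s'1 : s' != 1 by apply: contraNneq ca => E; rewrite -Es' E mul1r f2_1.
have qs : q' * s' != p'.
  apply: contraNneq ca => E; rewrite -Es' f2E; last first.
    by rewrite mulrN1 eqr_opp.
  by apply/eqP; congr f; rewrite mulrN1 mulrN E addrC subrr mul0r.
set bound := (2 * `|(q' * s' + p') * (q' + p' * s') - 4 * (q' * p' * s')| +
    `|(q' + p' * s') ^+ 2 - 4 * (q' * p' * s')|) / (q' * s' - p') ^+ 2.
have [k Hk] := expr_unbounded ((1 + `|bound|) / `|s1|) m1.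
have big : 1 + `|bound| < `|m ^+ k * s1|.
  by rewrite [ltRHS]normrM [X in _ < X * _]normrX -ltr_pdivrMr ?normr_gt0.
have b1 : 1 < `|m ^+ k * s1| by apply: le_lt_trans big; rewrite lerDl.
have b2 : bound < `|m ^+ k * s1|.
  apply: le_lt_trans big; apply: le_trans (ler_norm _) _.
  by rewrite lerDr ler01.
have [w [w1 w2 Ew]] := real_fixed_point s'0 s'1 qs b1 b2.
have Tk y : f (m ^+ k * y) = f y.
  by case: Tm => _ H; elim: k {Hk big b1 b2 Ew} => [|k IH]; rewrite ?expr0 ?mul1r // exprS -mulrA H.
apply: (free (G (s' * w)) w); last by rewrite f2E.
by rewrite f2E // -Ew -mulrA Tk.
Qed.
End TwoPoles.

(** * Two colours off a finite circle *)

Section Plane.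
Variable (R : realType).
Local Notation E2 := (Rinfty R 2).

Definition pt (x y : R) : 'rV[R]_2 := \row_i (if i == 0 then x else y).

Lemma ptE (v : 'rV[R]_2) : v = pt (v 0 0) (v 0 1).
Proof.
apply/rowP => i; rewrite mxE; case: i => -[|[|//]] hi; congr (v 0 _); exact: val_inj.
Qed.
Lemma dot_pt a b c d : dot (pt a b) (pt c d) = a * c + b * d.
Proof. by rewrite /dot !big_ord_recl big_ord0 !mxE /= addr0. Qed.
Lemma ptD a b c d : pt a b + pt c d = pt (a + c) (b + d).
Proof. by apply/rowP => i; rewrite !mxE; case: ifP. Qed.
Lemma ptZ k a b : k *: pt a b = pt (k * a) (k * b).
Proof. by apply/rowP => i; rewrite !mxE; case: ifP. Qed.
Lemma ptN a b : - pt a b = pt (- a) (- b).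
Proof. by apply/rowP => i; rewrite !mxE; case: ifP. Qed.
Lemma pt0 : pt 0 0 = 0.
Proof. by apply/rowP => i; rewrite !mxE; case: ifP. Qed.
Lemma pt_inj a b c d : pt a b = pt c d -> a = c /\ b = d.
Proof.
move=> H; split; first by have := congr1 (fun v : 'rV_2 => v 0 0) H; rewrite !mxE eqxx.
by have := congr1 (fun v : 'rV_2 => v 0 1) H; rewrite !mxE.
Qed.

Definition ax (x : R) : E2 := Some (pt x 0).
Definition on_axis (z : E2) := z = None \/ exists x, z = ax x.

Lemma axE x : ax x = Some (x *: pt 1 0).
Proof. by rewrite ptZ mulr1 mulr0. Qed.
Lemma ax_inj : injective ax.
Proof. by move=> x y [/pt_inj[]]. Qed.
Lemma pt10 : dot (pt 1 0) (pt 1 0) = 1.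
Proof. by rewrite dot_pt; ring. Qed.
Lemma ax0 : ax 0 = Some 0. Proof. by rewrite /ax pt0. Qed.

Lemma axis_conc z : conc None (ax 0) (ax 1) z <-> on_axis z.
Proof.
have n01 : pt 0 0 != pt 1 0.
  by apply/eqP => /pt_inj[] /eqP; rewrite eq_sym oner_eq0.
split=> [/(conc_line_inv n01)[->|[t ->]]|[->|[x ->]]]; first by left.
- by right; exists t; rewrite /ax ptN !ptD ptZ ptD; congr (Some (pt _ _)); ring.
- by rewrite -conc_rot conc_dup.
- by have := conc_line (pt 0 0) (pt 1 0) x; rewrite ptN !ptD ptZ ptD /ax !(oppr0, addr0, add0r, mulr1, mulr0).
Qed.

(** The circles through D and E induce an involution of the axis, which has at
    most two fixed points. *)
Lemma nonfixed_axis (D E : E2) : ~ on_axis D -> ~ on_axis E -> D != E ->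
  exists p q, [/\ p \in [:: None; ax 0; ax 1], on_axis q, p != q & conc D E p q].
Proof.
case: D E => [d|] [e|] hD hE nDE; try by [case: hD; left|case: hE; left].
move: hD hE nDE; rewrite (ptE d) (ptE e).
move: (d 0 0) (d 0 1) (e 0 0) (e 0 1) => d1 d2 e1 e2 hD hE nDE.
have d20 : d2 != 0 by apply/eqP => E; apply: hD; right; exists d1; rewrite E.
have [E|ne] := eqVneq d2 e2; last first.
  have ne' : e2 - d2 != 0 by rewrite subr_eq0 eq_sym.
  exists None, (ax (d1 + (- d2 / (e2 - d2)) * (e1 - d1))); split => //.
    by right; eexists.
  have := conc_line (pt d1 d2) (pt e1 e2) (- d2 / (e2 - d2)).
  rewrite ptN !ptD ptZ ptD (_ : d2 + _ * _ = 0); last by field.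
  by rewrite conc_rot concC34.
have key p : conc (Some (pt d1 d2)) (Some (pt e1 e2)) (ax p) (ax (d1 + e1 - p)).
  have d1e1 : d1 - e1 != 0.
    by rewrite subr_eq0; apply: contra_neq nDE => ->; rewrite E.
  apply/conc_coefP; exists (2 * p - d1 - e1), (d1 + e1 - 2 * p), (e1 - d1), (d1 - e1).
  rewrite /vec /nrm /fin /= !dot_pt !ptZ !ptD E; split.
  - by rewrite d1e1 !orbT.
  - by rewrite -pt0; congr (pt _ _); ring.
  - ring.
  - ring.
have [h0|h0] := eqVneq (d1 + e1) 0.
  exists (ax 1), (ax (d1 + e1 - 1)); split => //; first by rewrite !inE eqxx !orbT.
    by right; eexists.
  rewrite h0 (inj_eq ax_inj) sub0r -subr_eq0 opprK.
  by rewrite (_ : 1 + 1 = 2%:R) // pnatr_eq0.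
exists (ax 0), (ax (d1 + e1 - 0)); split => //; first by rewrite !inE eqxx !orbT.
  by right; eexists.
by rewrite (inj_eq ax_inj) subr0 eq_sym.
Qed.

Definition fraclin (p q w : R) := (q * w + p) / (w + 1).

(** The map is w |-> q + (p - q) / (w + 1): a translation, an inversion, a
    dilation, possibly of negative ratio, and another translation. *)
Lemma moeb_fraclin_unit m (u : 'rV[R]_m) p q : dot u u = 1 -> p != q ->
  exists phi : Rinfty R m -> Rinfty R m,
  [/\ moeb phi, forall w, w != -1 -> phi (Some (w *: u)) = Some (fraclin p q w *: u),
     phi (Some (-1 *: u)) = None & phi None = Some (q *: u)].
Proof.
move=> u1 pq; have u0 : u != 0 by rewrite -dot_eq0 u1 oner_eq0.
pose k := p - q; have k0 : k != 0 by rewrite subr_eq0.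
have [rho [mrho rN rx]] := moeb_reflect u0.
have [sc [msc sN sx]] : exists sc : Rinfty R m -> Rinfty R m,
    [/\ moeb sc, sc None = None & forall x, sc (Some (x *: u)) = Some ((k * x) *: u)].
  have [kp|kn|e] := ltgtP 0 k; last by rewrite -e eqxx in k0.
    exists (omap (fun x => k *: x)); split => //; first exact: moeb_scale.
    by move=> x; rewrite /= scalerA.
  have kn' : 0 < - k by rewrite oppr_gt0.
  exists (rho \o omap (fun x => - k *: x)); split; first exact: moeb_comp (moeb_scale _ kn').
    by rewrite /= rN.
  by move=> x; rewrite /= scalerA rx mulNr opprK.
exists (omap (fun x => x + q *: u) \o (sc \o (inversion 0 1 \o omap (fun x => x + u)))).
split.
- apply: moeb_comp (moeb_translate _) _; apply: moeb_comp msc _.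
  exact: moeb_comp (moeb_inversion _ ltr01) (moeb_translate _).
- move=> w w1; have w10 : w + 1 != 0 by rewrite addr_eq0.
  have E : w *: u + u = (w + 1) *: u by rewrite scalerDl scale1r.
  rewrite [LHS]/= -[X in sc X]/(inversion 0 1 (Some (w *: u + u))) E.
  rewrite inversion1; last by rewrite scaler_eq0 negb_or w10.
  rewrite add0r subr0 dotZl dotZr u1 mulr1 scalerA sx /= -scalerDl.
  by congr (Some (_ *: _)); rewrite /fraclin /k; field.
- by rewrite [LHS]/= scaleN1r addNr eqxx sN.
- rewrite [LHS]/= -[X in sc (Some X)](scale0r u) sx mulr0 /= scale0r add0r //.
Qed.

Lemma moeb_fraclin p q : p != q -> exists phi : E2 -> E2,
  [/\ moeb phi, forall w, w != -1 -> phi (ax w) = ax (fraclin p q w),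
     phi (ax (-1)) = None & phi None = ax q].
Proof.
move=> /(moeb_fraclin_unit pt10)[phi [m1 m2 m3 m4]]; exists phi.
by split=> // [w w1||]; rewrite !axE // m2.
Qed.
End Plane.

Section MovedPair.
Variables (R : realType) (n : nat).
Local Notation E2 := (Rinfty R 2).
Local Notation En := (Rinfty R n).
Implicit Types (T : E2 -> En) (W : {vspace ('rV[R]_n * R^o * R^o)%type}).

Definition conc_preserving T :=
  forall a b c d, conc a b c d -> conc (T a) (T b) (T c) (T d).

Lemma conc_preserving_moeb T (phi : E2 -> E2) : conc_preserving T -> moeb phi -> conc_preserving (T \o phi).
Proof. by move=> HT mp a b c d /(moeb_conc mp)/HT. Qed.

(** When two points of the axis that are concyclic with D and E are moved to 0
    and infinity, the points D and E lie on a line through 0. *)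
Lemma pencil_frame T W (D E : E2) : conc_preserving T ->
  (forall z, on_axis z -> inb W (T z)) -> \dim W = 3 ->
  T None = T (ax 0) -> ~~ inb W (T D) -> ~~ inb W (T E) -> T D != T E ->
  conc D E None (ax 0) ->
  (forall z z', on_axis z -> on_axis z' -> T z != T z' -> ~~ conc (T D) (T E) (T z) (T z')) ->
  exists g s0 t0, trivial_pencil (fun x => T (ax x)) g W s0 t0.
Proof.
move=> HT axW dW T0 UD UE nDE cDE np.
have oax x : on_axis (ax x) by right; exists x.
case: D UD nDE cDE np => [d|] UD nDE cDE np; last by case/negP: UD; apply: axW; left.
case: E UE nDE cDE np => [e|] UE nDE cDE np; last by case/negP: UE; apply: axW; left.
have d0 : d != 0 by apply: contraNneq UD => ->; rewrite -ax0 axW.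
have dpos : 0 < enorm d by rewrite enorm_gt0.
have d0' : enorm d != 0 by rewrite gt_eqF.
pose v := (enorm d)^-1 *: d.
have dv : d = enorm d *: v by rewrite scalerA divff // scale1r.
have v1 : dot v v = 1 by rewrite dotZl dotZr -enorm2; field.
have [t et] : exists t, e = (t * enorm d) *: v.
  rewrite eq_sym in d0.
  have : conc None (Some 0) (Some d) (Some e) by rewrite -ax0 conc_pairs.
  case/(conc_line3_inv d0) => t ->; exists t; by rewrite add0r subr0 -scalerA -dv.
pose W2 := span3 None (ax 0) (Some v).
have v0 : v != 0 by rewrite -dot_eq0 v1 oner_eq0.
exists (fun y => T (Some (y *: v))), (enorm d), (t * enorm d); split => //.
- move=> x1 x2 y1 y2 xy; apply: HT; rewrite !axE; apply: conc_power => //.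
  by rewrite pt10 v1.
- by move=> x; exact: axW.
- by rewrite scale0r -ax0.
- move=> y /=; rewrite -dv -et -conc_span //; last first.
  + by apply: contraNneq UE => <-; exact: axW.
  + by apply: contraNneq UD => <-; exact: axW.
  apply: HT; have n0v : ax 0 != Some v by rewrite ax0; apply: contra_neq v0 => -[].
  have inW2 k : inb W2 (Some (k *: v)).
    rewrite -conc_span // ax0; have := conc_line 0 v k.
    by rewrite add0r subr0.
  have -> : Some d = Some (enorm d *: v) by rewrite -dv.
  rewrite (inb_conc (W := W2)) //.
  + exact: dim_span3.
  + by rewrite ax0 -dv; apply: contra_neq d0 => -[].
  + by apply: contraNneq UE => <-; exact: axW.
  + by rewrite -dv; apply: contra_neq nDE => ->.
  + exact: inb2.
  + by rewrite et.
- by rewrite -dv.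
- by rewrite -et.
- by rewrite -dv -et.
- by move=> x x' ne; rewrite -dv -et; apply: np.
Qed.

Lemma on_axis_block z : on_axis z <-> inb (span3 None (ax 0) (ax 1)) (z : E2).
Proof.
have n01 : ax 0 != ax 1 :> E2 by rewrite (inj_eq (@ax_inj R)) eq_sym oner_eq0.
by rewrite -conc_span //; split=> /axis_conc.
Qed.

Lemma axis_conc3 (p q r z : E2) : on_axis p -> on_axis q -> on_axis r ->
  p != q -> p != r -> q != r -> conc p q r z <-> on_axis z.
Proof.
move=> /on_axis_block hp /on_axis_block hq /on_axis_block hr pq pr qr.
have dW : \dim (span3 None (ax 0 : E2) (ax 1)) = 3.
  by apply: dim_span3 => //; rewrite (inj_eq (@ax_inj R)) eq_sym oner_eq0.
by rewrite (inb_conc z dW pq pr qr hp hq hr); split=> /on_axis_block.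
Qed.

Lemma circle_frame (A B C : E2) : A != B -> A != C -> B != C ->
  exists phi psi : E2 -> E2, [/\ moeb phi, moeb psi, cancel phi psi, cancel psi phi &
   [/\ phi None = A, phi (ax 0) = B, phi (ax 1) = C &
   forall z, conc A B C (phi z) <-> on_axis z]].
Proof.
move=> AB AC BC; have [psi [mpsi pA pB pC]] := moeb_normalize (pt10 R) AB AC BC.
have [phi [mphi K1 K2]] := moeb_inv mpsi.
exists phi, psi; split => //; split.
- by rewrite -pA K1.
- by rewrite ax0 -pB K1.
- by rewrite axE scale1r -pC K1.
move=> z; rewrite -axis_conc; split.
  by move/(moeb_conc mpsi); rewrite pA pB pC K2 -ax0.
by move/(moeb_conc mphi); rewrite ax0 -pA -pB -[ax 1]pC !K1.
Qed.

Lemma nonfixed3 (D E P1 P2 P3 : E2) : ~ on_axis D -> ~ on_axis E -> D != E ->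
  on_axis P1 -> on_axis P2 -> on_axis P3 -> P1 != P2 -> P1 != P3 -> P2 != P3 ->
  exists p q, [/\ p \in [:: P1; P2; P3], on_axis q, p != q & conc D E p q].
Proof.
move=> hD hE nDE o1 o2 o3 n12 n13 n23.
have [phi [psi [mphi mpsi K1 K2 [e1 e2 e3 H]]]] := circle_frame n12 n13 n23.
have ax_phi z : on_axis (phi z) <-> on_axis z.
  by rewrite -(H z); apply: iff_sym; exact: axis_conc3.
have hD' : ~ on_axis (psi D) by rewrite -ax_phi K2.
have hE' : ~ on_axis (psi E) by rewrite -ax_phi K2.
have nDE' : psi D != psi E by rewrite (inj_eq (can_inj K2)).
have [p [q [pin oq pq C]]] := nonfixed_axis hD' hE' nDE'.
exists (phi p), (phi q); split.
- have -> : [:: P1; P2; P3] = map phi [:: None; ax 0; ax 1] by rewrite /= e1 e2 e3.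
  exact: map_f.
- exact/ax_phi.
- by rewrite (inj_eq (can_inj K1)).
- by have := moeb_conc mphi C; rewrite !K2.
Qed.

(** If no two colours of the axis are concyclic with those of D and E, two
    points exchanged by the involution of D and E have the same colour; take
    such a pair as poles. The trivial ratios of this frame then provide three
    points of another colour, one of which is not fixed by the involution and
    gives a second pair of poles of that colour. This contradicts
    [two_poles_absurd]. *)
Lemma moved_pair_axis T (D E : E2) (q : seq En) : conc_preserving T ->
  T None != T (ax 0) -> T None != T (ax 1) -> T (ax 0) != T (ax 1) ->
  ~~ conc (T None) (T (ax 0)) (T (ax 1)) (T D) ->
  ~~ conc (T None) (T (ax 0)) (T (ax 1)) (T E) -> T D != T E ->
  (forall z, on_axis z -> T z \in q) ->
  exists z z', [/\ on_axis z, on_axis z', T z != T z' & conc (T D) (T E) (T z) (T z')].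
Proof.
move=> HT n01 n02 n12 UD UE nDE fq; apply: contrapT => nex.
have np z z' : on_axis z -> on_axis z' -> T z != T z' -> ~~ conc (T D) (T E) (T z) (T z').
  by move=> oz oz' ne; apply/negP => C; apply: nex; exists z, z'.
pose W := span3 (T None) (T (ax 0)) (T (ax 1)).
have dW : \dim W = 3 by exact: dim_span3.
have TW z : on_axis z -> inb W (T z).
  by move/axis_conc/HT; rewrite -conc_span.
rewrite !conc_span // -/W in UD UE.
have hD : ~ on_axis D by move/TW; apply/negP.
have hE : ~ on_axis E by move/TW; apply/negP.
have nDE0 : D != E by apply: contra_neq nDE => ->.
have [p [p' [pin op' pp' C]]] := nonfixed_axis hD hE nDE0.
have oax x : on_axis (ax x : E2) by right; exists x.
have [op [r [t [or ot pr pt_ rt]]]] : on_axis p /\ exists r t, [/\ on_axis r, on_axis t,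
    T p != T r, T p != T t & T r != T t].
  have oN : on_axis (None : E2) by left.
  move: pin; rewrite !inE => /or3P[] /eqP ->; split => //.
  - by exists (ax 0), (ax 1).
  - by exists None, (ax 1); split => //; rewrite eq_sym.
  - by exists None, (ax 0); split => //; rewrite eq_sym.
have Tpp : T p' = T p.
  apply/eqP; apply: contraT => ne; have := np _ _ op' op ne.
  by rewrite concC34 HT.
have p'r : p' != r by apply: contra_neq pr => <-.
have p'p : p' != p by rewrite eq_sym.
have pr0 : p != r by apply: contra_neq pr => ->.
have [phi [psi [mphi mpsi K1 K2 [e1 e2 e3 H]]]] := circle_frame p'p p'r pr0.
have ax_phi z : on_axis (phi z) <-> on_axis z.
  by rewrite -(H z); apply: iff_sym; exact: axis_conc3.
pose T1 := T \o phi.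
have HT1 : conc_preserving T1 by exact: conc_preserving_moeb.
have T1W z : on_axis z -> inb W (T1 z) by move/ax_phi/TW.
have T1psi z : T1 (psi z) = T z by rewrite /T1 /= K2.
have np1 z z' : on_axis z -> on_axis z' -> T1 z != T1 z' ->
    ~~ conc (T1 (psi D)) (T1 (psi E)) (T1 z) (T1 z').
  by move=> /ax_phi oz /ax_phi oz'; rewrite !T1psi; exact: np.
have [g [s0 [t0 TP]]] : exists g s0 t0, trivial_pencil (fun x => T1 (ax x)) g W s0 t0.
  apply: (pencil_frame HT1 T1W dW _ _ _ _ _ np1); rewrite ?T1psi //.
    by rewrite /T1 /= e1 e2.
  rewrite -e2 -e1 in C *.
  by have := moeb_conc mpsi C; rewrite !K1 concC34.
set f := fun x => T1 (ax x) in TP.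
have f0 : f 0 = T p by rewrite /f /T1 /= e2.
have f1 : f 1 = T r by rewrite /f /T1 /= e3.
have fq1 x : f x \in q by apply: fq; apply/ax_phi.
have [x2 Ex2] : exists x2, f x2 = T t.
  have := ot; rewrite -(K2 t) ax_phi => -[Et|[x2 Et]]; last first.
    by exists x2; rewrite /f /T1 /= -Et K2.
  by move: pt_; rewrite -(K2 t) Et e1 Tpp eqxx.
have N1 : f 1 != f 0 by rewrite f0 f1 eq_sym.
have N2 : f x2 != f 0 by rewrite f0 Ex2 eq_sym.
have N12 : f 1 != f x2 by rewrite f1 Ex2.
have [m [m0 Tm] m1] := reg_trivial_big TP fq1 N1 N2 N12.
have hD1 : ~ on_axis (psi D) by rewrite -ax_phi K2.
have hE1 : ~ on_axis (psi E) by rewrite -ax_phi K2.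
have nDE1 : psi D != psi E by rewrite (inj_eq (can_inj K2)).
have mn1 : m != 1 by apply: contraTneq m1 => ->; rewrite normr1 ltxx.
have mn2 : m * m != 1.
  by apply: contraTneq m1 => E1; rewrite -leNgt -(@expr_le1 _ 2) // -normrX expr2 E1 normr1.
have [P [Q [Pin oQ PQ CPQ]]] : exists p q, [/\ p \in [:: ax 1; ax m; ax (m * m)],
    on_axis q, p != q & conc (psi D) (psi E) p q].
  apply: nonfixed3 => //; rewrite (inj_eq (@ax_inj R)).
  - by rewrite eq_sym.
  - by rewrite eq_sym.
  - by rewrite -[X in X == _]mulr1 (inj_eq (mulfI m0)) eq_sym.
have [pp [EP fP]] : exists pp, P = ax pp /\ f pp = f 1.
  move: Pin; rewrite !inE => /or3P[] /eqP ->; eexists; split; try by [].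
  - by rewrite -(Tm 1) mulr1.
  - by rewrite -(Tm 1) mulr1 -(Tm m).
have T1PQ : T1 P = T1 Q.
  apply/eqP; apply: contraT => ne.
  have oP : on_axis P by rewrite EP.
  by have := np1 _ _ oP oQ ne; rewrite HT1.
have T1N : T1 None = f 0 by rewrite /T1 /= e1 Tpp f0.
have [qq [EQ fQ]] : exists qq, Q = ax qq /\ f qq = f pp.
  case: oQ => [EQ|[qq EQ]]; last by exists qq; split => //; rewrite /f -EQ -T1PQ EP.
  by move: N1; rewrite -fP -T1N -EQ -T1PQ EP eqxx.
have pq0 : pp != qq by apply: contra_neq PQ => E1; rewrite EP EQ E1.
have [gam [mgam gw gN1 gNone]] := moeb_fraclin pq0.
have [gam' [mgam' G1 G2]] := moeb_inv mgam.
have ax_gam z : on_axis z -> on_axis (gam z).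
  case=> [->|[w ->]]; first by rewrite gNone.
  have [->|w1] := eqVneq w (-1); first by rewrite gN1; left.
  by rewrite gw.
pose T2 := T1 \o gam.
have HT2 : conc_preserving T2 by exact: conc_preserving_moeb.
have g0 : gam (ax 0) = ax pp.
  have n01' : 0 != -1 :> R by rewrite eq_sym oppr_eq0 oner_neq0.
  by rewrite gw // /fraclin mulr0 !add0r divr1.
have [g2 [s2 [t2 TP2]]] : exists g s0 t0, trivial_pencil (fun x => T2 (ax x)) g W s0 t0.
  apply: (pencil_frame (D := gam' (psi D)) (E := gam' (psi E)) HT2 _ dW).
  - by move=> z oz; apply: T1W; exact: ax_gam.
  - by rewrite /T2 /= gNone g0; exact: fQ.
  - by rewrite /T2 /= G2 T1psi.
  - by rewrite /T2 /= G2 T1psi.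
  - by rewrite /T2 /= !G2 !T1psi.
  - rewrite EP EQ -g0 -gNone in CPQ.
    by have := moeb_conc mgam' CPQ; rewrite !G1 concC34.
  - move=> z z' oz oz' ne; rewrite /T2 /= !G2; apply: np1 => //; exact: ax_gam.
apply: (@two_poles_absurd _ _ f _ g g2 W W s0 t0 s2 t2 TP TP2 q pp qq x2 fq1) => //.
- by move=> x; apply: fq; apply/ax_phi; exact: ax_gam.
- by move=> w w1; rewrite /T2 /= gw.
- by rewrite /T2 /= gN1.
- by rewrite fP.
- by rewrite fP eq_sym.
Qed.

(** This is the only property of circles with finitely many colours that is used
    below. *)
Theorem moved_pair T (A B C D E : E2) (q : seq En) : conc_preserving T ->
  T A != T B -> T A != T C -> T B != T C ->
  ~~ conc (T A) (T B) (T C) (T D) -> ~~ conc (T A) (T B) (T C) (T E) -> T D != T E ->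
  (forall z, conc A B C z -> T z \in q) ->
  exists z z', [/\ conc A B C z, conc A B C z', T z != T z' &
                 conc (T D) (T E) (T z) (T z')].
Proof.
move=> HT nAB nAC nBC UD UE nDE fq.
have AB : A != B by apply: contra_neq nAB => ->.
have AC : A != C by apply: contra_neq nAC => ->.
have BC : B != C by apply: contra_neq nBC => ->.
have [phi [psi [mphi mpsi K1 K2 [e1 e2 e3 H]]]] := circle_frame AB AC BC.
have HT1 := conc_preserving_moeb HT mphi.
have [] := @moved_pair_axis (T \o phi) (psi D) (psi E) q HT1; rewrite /= ?e1 ?e2 ?e3 ?K2 //.
  by move=> z /H; exact: fq.
move=> z [z' [/H oz /H oz' ne CC]].
by exists (phi z), (phi z').
Qed.
End MovedPair.

(** * Pasch configurations of ordinary blocks *)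

(** The permutations of a quadruple are products of a rotation and a permutation
    of the last three points. *)
Ltac conc3 H := first [ exact: H | rewrite concC34; exact: H | rewrite concC23; exact: H
  | rewrite concC34 concC23; exact: H | rewrite concC23 concC34; exact: H
  | rewrite concC23 concC34 concC23; exact: H ].
Ltac conc_by H := first [ conc3 H | rewrite conc_rot; conc3 H | rewrite 2!conc_rot; conc3 H
  | rewrite 3!conc_rot; conc3 H ].

Section Planar.
Variable (R : realType).
Local Notation E2 := (Rinfty R 2).
Local Notation V2 := ('rV[R]_2 * R^o * R^o)%type.
Implicit Types (u v w : 'rV[R]_2).

Definition cross u v : R := u 0 0 * v 0 1 - u 0 1 * v 0 0.

Lemma cross_pt a b c d : cross (pt a b) (pt c d) = a * d - b * c.
Proof. by rewrite /cross !mxE. Qed.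

Lemma cross_eq0 u v : v != 0 -> cross u v = 0 -> exists k, u = k *: v.
Proof.
move=> v0 E; have d0 : dot v v != 0 by rewrite dot_eq0.
exists (dot u v / dot v v); move: E d0; rewrite (ptE u) (ptE v) cross_pt !dot_pt.
move: (u 0 0) (u 0 1) (v 0 0) (v 0 1) => a b c d E d0; rewrite ptZ.
have E2 : b * c = a * d by lra.
congr (pt _ _); apply: (mulIf d0); rewrite [RHS]mulrAC divfK //.
- have -> : (a * c + b * d) * c = a * (c * c) + d * (b * c) by ring.
  rewrite E2; ring.
- have -> : (a * c + b * d) * d = (a * d) * c + b * (d * d) by ring.
  rewrite -E2; ring.
Qed.

Lemma lines_meet A B C D : cross B D != 0 -> exists s t, A + s *: B = C + t *: D.
Proof.
rewrite (ptE A) (ptE B) (ptE C) (ptE D) cross_pt.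
move: (A 0 0) (A 0 1) (B 0 0) (B 0 1) (C 0 0) (C 0 1) (D 0 0) (D 0 1) => a a' b b' c c' d d' h.
exists (((c - a) * d' - (c' - a') * d) / (b * d' - b' * d)),
  (((c - a) * b' - (c' - a') * b) / (b * d' - b' * d)).
by rewrite !ptZ !ptD; congr (pt _ _); field.
Qed.

Lemma dot_solve u v al be : cross u v != 0 -> exists w, dot w u = al /\ dot w v = be.
Proof.
rewrite (ptE u) (ptE v) cross_pt.
move: (u 0 0) (u 0 1) (v 0 0) (v 0 1) => a b c d h.
exists (pt ((al * d - be * b) / (a * d - b * c)) ((be * a - al * c) / (a * d - b * c))).
by rewrite !dot_pt; split; field.
Qed.

(** N is the coefficient vector of an equation of a circle; four vectors in the
    orthogonal hyperplane of N are dependent as [V2] has dimension 4. *)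
Lemma conc_sphere (N : V2) a b c d : N != 0 ->
  bform (nullvec a) N = 0 -> bform (nullvec b) N = 0 -> bform (nullvec c) N = 0 ->
  bform (nullvec d) N = 0 -> conc a b c d.
Proof.
move=> N0 ha hb hc hd; apply/negP => fr.
have lin : linear (fun X : V2 => bform X N : R^o) by move=> k X Y; rewrite bformDl bformZl.
pose l : {linear V2 -> R^o} := HB.pack (fun X : V2 => bform X N : R^o) (GRing.isLinear.Build R V2 R^o *:%R _ lin).
pose L := linfun l.
have sub : (<<[:: nullvec a; nullvec b; nullvec c; nullvec d]>> <= lker L)%VS.
  apply/span_subvP => X; rewrite !inE memv_ker lfunE /= => /or4P[] /eqP ->;
  by rewrite ?ha ?hb ?hc ?hd.
have /eqP d4 : \dim <<[:: nullvec a; nullvec b; nullvec c; nullvec d]>> == 4 by [].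
have := dimvS sub; rewrite d4 => k4.
have dV : \dim (fullv : {vspace V2}) = 4 by rewrite dimvf.
have kE : lker L = fullv.
  by apply/eqP; rewrite eqEdim subvf dV.
have L0 X : bform X N = 0.
  have : X \in lker L by rewrite kE memvf.
  by rewrite memv_ker lfunE => /eqP.
move/eqP: N0; apply; move: L0; clear; case: N => -[n1 n2] n3 L0.
have n30 : n3 = 0 by have := L0 (0, 1, 0); rewrite /bform /= dot0l; lra.
have n20 : n2 = 0 by have := L0 (0, 0, 1); rewrite /bform /= dot0l; lra.
have /eqP : dot n1 n1 = 0 by have := L0 (n1, 0, 0); rewrite /bform /=; lra.
by rewrite dot_eq0 => /eqP ->; rewrite n20 n30.
Qed.

Definition in_circle (F : E2 -> Prop) := exists A B C : E2,
  [/\ A != B, A != C, B != C & forall z, F z -> conc A B C z].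

Lemma in_circle_moeb (F : E2 -> Prop) (phi : E2 -> E2) : moeb phi ->
  in_circle (fun z => F (phi z)) -> in_circle F.
Proof.
move=> mp [A [B [C [AB AC BC H]]]]; have [psi [mpsi K1 K2]] := moeb_inv mp.
exists (phi A), (phi B), (phi C); rewrite !(inj_eq (moeb_inj mp)); split => // z Fz.
by rewrite -(K2 z); apply: moeb_conc mp _; apply: H; rewrite K2.
Qed.

(** With P at infinity, the circle through P, A and B is a line, and the circles
    through P and Q tangent to it at P become the parallel through Q. *)
Lemma tangent_pencil (P A B Q : E2) (F : E2 -> Prop) : P != A -> P != B -> A != B -> P != Q ->
  (forall z, F z -> z != P /\ forall w : E2, conc P A B w -> conc P Q z w -> w = P) ->
  in_circle F.
Proof.
move=> PA PB AB PQ H; have [phi [mphi phP]] := moeb_to_inf P.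
have [psi [mpsi K1 K2]] := moeb_inv mphi.
apply: (in_circle_moeb mpsi).
have psN : psi None = P by rewrite -phP K1.
have fin0 z : P != z -> exists x, phi z = Some x.
  case E : (phi z) => [x|]; first by exists x.
  by rewrite -(K1 z) E psN eqxx.
have [a Ea] := fin0 _ PA; have [b Eb] := fin0 _ PB; have [c Ec] := fin0 _ PQ.
have ab : b - a != 0.
  by rewrite subr_eq0; apply: contra_neq AB => ab; apply: (moeb_inj mphi); rewrite Ea Eb ab.
exists None, (Some c), (Some (c + (b - a))); split => //.
  by apply/eqP => -[] /eqP; rewrite -subr_eq0 opprD addrA addrN sub0r oppr_eq0; apply/negP.
move=> z Fz; have [zP Hz] := H _ Fz.
case: z Fz zP Hz => [z|] Fz zP Hz; last by rewrite psN eqxx in zP.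
have [E|ne] := eqVneq (cross (b - a) (z - c)) 0; last first.
  have [s [t Est]] := lines_meet a c ne.
  suff : psi (Some (a + s *: (b - a))) = P by rewrite -psN => /(moeb_inj mpsi).
  apply: Hz.
    rewrite -(K1 P) -(K1 A) -(K1 B) phP Ea Eb; apply: moeb_conc mpsi _; exact: conc_line.
  rewrite -(K1 P) -(K1 Q) phP Ec Est; apply: moeb_conc mpsi _; exact: conc_line.
have [k Ek] : exists k, z - c = k *: (b - a).
  apply: (cross_eq0 ab); move: E; rewrite /cross => E; lra.
have -> : z = c + k *: (c + (b - a) - c).
  by rewrite [c + (b - a)]addrC addrK -Ek addrC subrK.
exact: conc_line.
Qed.
End Planar.

Section Pasch.
Variables (R : realType) (n : nat).
Local Notation E2 := (Rinfty R 2).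
Local Notation En := (Rinfty R n).
Implicit Types (T : E2 -> En) (x y z : En).

(** The analogue of the ordinary lines of Sylvester and Gallai. *)
Definition ordinary T (p q r : En) := forall w, conc p q r (T w) -> T w \in [:: p; q; r].

Lemma ordinary12 T p q r : ordinary T p q r -> ordinary T q p r.
Proof.
move=> H w C; have -> : (T w \in [:: q; p; r]) = (T w \in [:: p; q; r]) by rewrite !inE orbCA.
by apply: H; rewrite (conc_perm (a' := q) (b' := p) (c' := r) (d' := T w)) // (perm_catCA [:: _] [:: _]).
Qed.
Lemma ordinary23 T p q r : ordinary T p q r -> ordinary T p r q.
Proof.
move=> H w C; have -> : (T w \in [:: p; r; q]) = (T w \in [:: p; q; r]) by rewrite !inE; congr (_ || _); rewrite orbC.
by apply: H; rewrite concC23.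
Qed.

(** Four ordinary blocks, any two of which share one of six colours. The colours
    x and x', y and y', z and z' are opposite: no block of the four contains
    both. *)
Record pasch T x y z y' z' x' : Prop := Pasch {
  ps_conc : conc_preserving T;
  ps_uniq : uniq [:: x; y; z; y'; z'; x'];
  ps_img : forall p, p \in [:: x; y; z; y'; z'; x'] -> exists w, T w = p;
  ps1 : ordinary T x y z;
  ps2 : ordinary T x y' z';
  ps3 : ordinary T x' y z';
  ps4 : ordinary T x' y' z }.

Lemma pasch_moeb T x y z y' z' x' phi : moeb phi -> pasch T x y z y' z' x' ->
  pasch (T \o phi) x y z y' z' x'.
Proof.
move=> mp [c u im o1 o2 o3 o4].
have ord p q r : ordinary T p q r -> ordinary (T \o phi) p q r by move=> H w; exact: H.
split; [exact: conc_preserving_moeb|by []| |exact: ord|exact: ord|exact: ord|exact: ord].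
move=> p /im[w <-]; have [psi [mpsi K1 K2]] := moeb_inv mp.
by exists (psi w); rewrite /= K2.
Qed.

Lemma pasch_swap T x y z y' z' x' : pasch T x y z y' z' x' -> pasch T x y' z' y z x'.
Proof.
move=> [c u im o1 o2 o3 o4].
have pe : perm_eq [:: x; y; z; y'; z'; x'] [:: x; y'; z'; y; z; x'].
  by rewrite perm_cons (perm_catCA [:: y; z] [:: y'; z']).
split=> //; first by rewrite -(perm_uniq pe).
by move=> p; rewrite -(perm_mem pe); exact: im.
Qed.

Lemma pasch_flip T x y z y' z' x' : pasch T x y z y' z' x' -> pasch T x z y z' y' x'.
Proof.
move=> [c u im o1 o2 o3 o4].
have pe : perm_eq [:: x; y; z; y'; z'; x'] [:: x; z; y; z'; y'; x'].
  rewrite perm_cons; apply: (perm_trans (y := [:: z; y; y'; z'; x'])).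
    by rewrite (perm_catCA [:: y] [:: z]).
  by rewrite !perm_cons (perm_catCA [:: y'] [:: z']).
split=> //; try exact: ordinary23.
- by rewrite -(perm_uniq pe).
- by move=> p; rewrite -(perm_mem pe); exact: im.
Qed.

Lemma pasch_pole T x y z y' z' x' : pasch T x y z y' z' x' -> pasch T y x z x' z' y'.
Proof.
move=> [c u im o1 o2 o3 o4].
have pe : perm_eq [:: x; y; z; y'; z'; x'] [:: y; x; z; x'; z'; y'].
  rewrite (perm_catCA [:: x] [:: y]) !perm_cons.
  rewrite (perm_catCA [:: y'; z'] [:: x']) perm_cons.
  by rewrite (perm_catC [:: y'] [:: z']).
split=> //; try exact: ordinary12.
- by rewrite -(perm_uniq pe).
- by move=> p; rewrite -(perm_mem pe); exact: im.
Qed.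

Lemma uniq6 (x y z y' z' x' : En) : uniq [:: x; y; z; y'; z'; x'] ->
  [/\ [/\ x != y, x != z, x != y', x != z' & x != x'],
     [/\ y != z, y != y', y != z' & y != x'],
     [/\ z != y', z != z' & z != x'], (y' != z') && (y' != x') & z' != x'].
Proof.
rewrite /= !inE !negb_or -!andbA => H.
repeat (case/andP: H => ? H).
by split; [split|split|split|apply/andP; split|].
Qed.

(** A circle with the colours x, y, z and one with the colours x, y', z' that
    meet in two points; these have the colour x and are moved to 0 and infinity.
    *)
Record crossing T x y z y' z' (u v : 'rV[R]_2) : Prop := Crossing {
  cr_inf : T None = x;
  cr_0 : T (Some 0) = x;
  cr_u : dot u u = 1;
  cr_v : dot v v = 1;
  cr_f : forall t, T (Some (t *: u)) \in [:: x; y; z];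
  cr_g : forall t, T (Some (t *: v)) \in [:: x; y'; z'];
  cr_y : exists t, T (Some (t *: u)) = y;
  cr_z : exists t, T (Some (t *: u)) = z;
  cr_y' : exists t, T (Some (t *: v)) = y';
  cr_z' : exists t, T (Some (t *: v)) = z' }.

Lemma crossing_swap T x y z y' z' u v : crossing T x y z y' z' u v ->
  crossing T x y' z' y z v u.
Proof. by case=> *; split. Qed.

Lemma in_flip x y z t : (t \in [:: x; y; z]) = (t \in [:: x; z; y]).
Proof. by rewrite !inE; congr (_ || _); rewrite orbC. Qed.

Lemma crossing_flip T x y z y' z' u v : crossing T x y z y' z' u v ->
  crossing T x z y z' y' u v.
Proof. by case=> *; split=> // t; rewrite in_flip. Qed.

Section Crossing.
Variables (T : E2 -> En) (x y z y' z' x' : En) (u v : 'rV[R]_2).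
Hypotheses (P : pasch T x y z y' z' x') (C : crossing T x y z y' z' u v).

(** The points a, b of the first line are concyclic with t and a b / t on the
    second one; as the block of x, y, z is ordinary, it does not contain the
    colour of t. *)
Lemma cross_mult a b t : T (Some (a *: u)) = y -> T (Some (b *: u)) = z ->
  T (Some (t *: v)) != x -> T (Some ((a * b / t) *: v)) != x.
Proof.
move=> Ea Eb nt.
have t0 : t != 0 by apply: contraNneq nt => ->; rewrite scale0r (cr_0 C).
have K : conc (Some (a *: u)) (Some (b *: u)) (Some (t *: v)) (Some ((a * b / t) *: v)).
  by apply: conc_power; [rewrite (cr_u C) (cr_v C)|field].
apply/eqP => Ex; have := ps_conc P K; rewrite Ea Eb Ex.
move=> K2; have [[_ _ xy' xz' _] [_ yy' yz' _] [zy' zz' _] _ _] := uniq6 (ps_uniq P).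
have := ps1 P (w := Some (t *: v)) ltac:(conc_by K2).
have := cr_g C t; rewrite !inE (negbTE nt) /=.
case/orP => /eqP ->; first by rewrite !(eq_sym y') (negbTE yy') (negbTE zy').
by rewrite !(eq_sym z') (negbTE yz') (negbTE zz').
Qed.

(** If 0 separated a and b, every circle through them would meet the second
    line, but the circle through them and a point of colour x' shares no colour
    with that line. *)
Lemma cross_sign a b : T (Some (a *: u)) = y -> T (Some (b *: u)) = z -> 0 < a * b.
Proof.
move=> Ea Eb.
have [[xy xz xy' xz' xx'] [yz yy' yz' yx'] [zy' zz' zx'] /andP[y'z' y'x'] z'x'] := uniq6 (ps_uniq P).
have nz t : T (Some (t *: u)) != x -> t != 0.
  by apply: contraNneq => ->; rewrite scale0r (cr_0 C).
have a0 : a != 0 by apply: nz; rewrite Ea eq_sym.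
have b0 : b != 0 by apply: nz; rewrite Eb eq_sym.
rewrite lt_neqAle eq_sym mulf_neq0 //= leNgt; apply/negP => neg.
have [X' EX] : exists w, T w = x' by apply: (ps_img P); rewrite !inE eqxx !orbT.
case: X' EX => [p|] EX; last by move: xx'; rewrite -EX (cr_inf C) eqxx.
have u0 : u != 0 by rewrite -dot_eq0 (cr_u C) oner_eq0.
have D0 : cross u p != 0.
  apply/eqP => D; have [k Ek] : exists k, p = k *: u.
    apply: (cross_eq0 u0); move: D; rewrite /cross => D; lra.
  have := cr_f C k; rewrite -Ek EX !inE => /or3P[] /eqP E.
  - by rewrite E eqxx in xx'.
  - by rewrite E eqxx in yx'.
  - by rewrite E eqxx in zx'.
have [w [wu wp]] : exists w, dot w u = - (a + b) /\ dot w p = - (dot p p + a * b).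
  exact: dot_solve.
(* the circle of equation |X|^2 + dot w X + a b = 0 meets the second line at t *)
pose be := dot w v; pose de := be ^+ 2 - 4 * (a * b).
have de0 : 0 <= de by rewrite /de; have := sqr_ge0 be; lra.
pose t := (- be + Num.sqrt de) / 2.
have Et : t ^+ 2 + be * t + a * b = 0.
  have := sqr_sqrtr de0; rewrite /t /de; move: (Num.sqrt _) => r Er.
  have : r ^+ 2 = be ^+ 2 - 4 * (a * b) by [].
  move=> E; have -> : ((- be + r) / 2) ^+ 2 + be * ((- be + r) / 2) + a * b = (r ^+ 2 - be ^+ 2) / 4 + a * b by field.
  by rewrite E; field.
have K : conc (Some (a *: u)) (Some (b *: u)) (Some p) (Some (t *: v)).
  apply: (@conc_sphere _ ((2^-1 *: w, - (a * b), -1))).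
  - by apply/eqP => /(congr1 snd)/eqP; rewrite /= oppr_eq0 oner_eq0.
  - by rewrite /bform /= !(dotZl, dotZr) (dotC u) wu (cr_u C); field.
  - by rewrite /bform /= !(dotZl, dotZr) (dotC u) wu (cr_u C); field.
  - by rewrite /bform /= !(dotZl, dotZr) (dotC p) wp; field.
  - rewrite /bform /= !(dotZl, dotZr) (dotC v) (cr_v C) -/be.
    by rewrite -[RHS]Et; field.
have := ps_conc P K; rewrite Ea Eb EX => {}K.
have := cr_g C t; rewrite !inE => /or3P[] /eqP E; rewrite E in K.
- have := ps1 P (w := Some p); rewrite EX => /(_ ltac:(conc_by K)).
  by rewrite !inE !(eq_sym x') (negbTE xx') (negbTE yx') (negbTE zx').
- have [Y EY] : exists w, T w = y by apply: (ps_img P); rewrite !inE eqxx !orbT.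
  have := ps4 P (w := Y); rewrite EY => /(_ ltac:(conc_by K)).
  by rewrite !inE (negbTE yx') (negbTE yy') (negbTE yz).
- have [Z EZ] : exists w, T w = z by apply: (ps_img P); rewrite !inE eqxx !orbT.
  have := ps3 P (w := Z); rewrite EZ => /(_ ltac:(conc_by K)).
  by rewrite !inE (negbTE zx') eq_sym (negbTE yz) (negbTE zz').
Qed.

Lemma cross_ratio a a' t : T (Some (a *: u)) = y -> T (Some (a' *: u)) = y ->
  T (Some (t *: v)) != x -> T (Some ((a / a' * t) *: v)) != x.
Proof.
move=> Ea Ea' nt; have [b Eb] := cr_z C.
have t0 : t != 0 by apply: contraNneq nt => ->; rewrite scale0r (cr_0 C).
have /lt0r_neq0 := cross_sign Ea' Eb; rewrite mulf_eq0 negb_or => /andP[a'0 b0].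
have := cross_mult Ea Eb (cross_mult Ea' Eb nt).
by have -> : a * b / (a' * b / t) = a / a' * t by fieldx.
Qed.

(** By [cross_ratio] the quotient of two points of colour y acts on the points
    of the second line that are not of colour x; as these are bounded, it has
    absolute value 1, and it is positive by [cross_sign]. *)
Lemma cross_bounded M : (forall t, T (Some (t *: v)) != x -> `|t| <= M) ->
  forall a a', T (Some (a *: u)) = y -> T (Some (a' *: u)) = y -> a = a'.
Proof.
move=> HM.
suff le a a' : T (Some (a *: u)) = y -> T (Some (a' *: u)) = y -> `|a| <= `|a'|.
  move=> a a' Ea Ea'; have [b Eb] := cr_z C.
  have p1 := cross_sign Ea Eb; have p2 := cross_sign Ea' Eb.
  have E : `|a| = `|a'| by apply/eqP; rewrite eq_le !le.
  have /eqP := E; rewrite eqr_norm2 => /orP[/eqP //|/eqP E2].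
  by move: p1; rewrite E2 mulNr oppr_gt0 => /(lt_trans p2); rewrite ltxx.
move=> Ea Ea'; rewrite leNgt; apply/negP => lt.
have [b Eb] := cr_z C; have /lt0r_neq0 := cross_sign Ea' Eb.
rewrite mulf_eq0 negb_or => /andP[a'0 b0].
have a'p : 0 < `|a'| by rewrite normr_gt0.
have r1 : 1 < `|a / a'| by rewrite normf_div ltr_pdivlMr // mul1r.
have [t Et] := cr_y' C.
have [[_ _ xy' _ _] _ _ _ _] := uniq6 (ps_uniq P).
have nt : T (Some (t *: v)) != x by rewrite Et eq_sym.
have t0 : 0 < `|t| by rewrite normr_gt0; apply: contraNneq nt => ->; rewrite scale0r (cr_0 C).
have pw k : T (Some (((a / a') ^+ k * t) *: v)) != x.
  elim: k => [|k IH]; first by rewrite expr0 mul1r.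
  by rewrite exprS -mulrA; exact: cross_ratio.
have [k] := expr_unbounded (M / `|t|) r1.
rewrite -normrX ltr_pdivrMr // -normrM ltNge => /negP; apply.
exact: HM.
Qed.

Lemma cross_side a t : T (Some (a *: u)) = y -> T (Some (t *: u)) != x -> 0 < a * t.
Proof.
move=> Ea nt; have := cr_f C t; rewrite !inE (negbTE nt) /= => /orP[] /eqP Et; last first.
  exact: cross_sign Ea Et.
have [b Eb] := cr_z C.
have p1 := cross_sign Ea Eb; have p2 := cross_sign Et Eb.
have : 0 < (a * b) * (t * b) by rewrite mulr_gt0.
have -> : (a * b) * (t * b) = a * t * (b ^+ 2) by ring.
rewrite pmulr_lgt0 // exprn_even_gt0 //=.
by move/lt0r_neq0: p1; rewrite mulf_eq0 negb_or => /andP[].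
Qed.
End Crossing.

Definition single_pair T (y' z' : En) (Q Y Z : E2) :=
  (forall w, conc Q Y Z w -> T w = y' -> w = Y) /\
  (forall w, conc Q Y Z w -> T w = z' -> w = Z).

(** On the first line, the side of 0 that does not contain the colours y and z
    has the colour x throughout. A circle through points of the colours y' and
    z' of the second line and a point q of this side meets the first line again
    in a point p of the same side, as the power of 0 is positive. If p and q are
    moved to 0 and infinity, the points of the colours y and z are bounded, so
    that [cross_bounded] applies to the circle. *)
Lemma crossing_single T x y z y' z' x' u v : pasch T x y z y' z' x' ->
  crossing T x y z y' z' u v -> exists Q Y Z, [/\ T Q = x, T Y = y', T Z = z' & single_pair T y' z' Q Y Z].
Proof.
move=> P C.
have [[xy xz xy' xz' xx'] [yz yy' yz' yx'] [zy' zz' zx'] /andP[y'z' y'x'] z'x'] := uniq6 (ps_uniq P).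
have [a Ea] := cr_y C; have [b Eb] := cr_y' C; have [c Ec] := cr_z' C.
have bc : 0 < b * c by exact: cross_sign (pasch_swap P) (crossing_swap C) _ _ Eb Ec.
have [d Ed] := cr_z C.
have /lt0r_neq0 := cross_sign P C Ea Ed; rewrite mulf_eq0 negb_or => /andP[a0 _].
have aa : 0 < a * a by rewrite -expr2 exprn_even_gt0.
(* q is on the side of 0 away from a, and q^2 <> b c makes p = b c / q differ from q *)
have [q [q0 aq qbc]] : exists q, [/\ q != 0, a * q < 0 & q * q != b * c].
  have [E|ne] := eqVneq (a * a) (b * c); last first.
    by exists (- a); rewrite oppr_eq0 mulrNN; split=> //; rewrite mulrN oppr_lt0.
  exists (- (2 * a)); rewrite oppr_eq0 mulf_neq0 ?pnatr_eq0 //; split=> //; first lra.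
  rewrite mulrNN -E; apply/eqP; lra.
pose p := b * c / q.
have pq : p * q = b * c by rewrite /p divfK.
have ap : a * p < 0.
  have -> : a * p = (a * q) * (b * c) / (q * q) by rewrite /p; fieldx.
  have qq : 0 < (q * q)^-1 by rewrite invr_gt0 -expr2 exprn_even_gt0.
  by rewrite pmulr_llt0 // nmulr_rlt0.
have npq : p != q by apply: contra_neq qbc => E; rewrite -pq E.
have neg t : a * t < 0 -> T (Some (t *: u)) = x.
  move=> h; apply/eqP; apply: contraT => /(cross_side P C Ea); lra.
have [phi [mphi ph ph1 phN]] := moeb_fraclin_unit (cr_u C) npq.
have [psi [mpsi K1 K2]] := moeb_inv mphi.
have p0w : phi (Some 0) = Some (p *: u).
  rewrite -[in LHS](scale0r u) ph; first by rewrite /fraclin mulr0 !add0r divr1.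
  by rewrite eq_sym oppr_eq0 oner_neq0.
pose T1 := T \o phi; have P1 : pasch T1 x y z y' z' x' := pasch_moeb mphi P.
have T1N : T1 None = x by rewrite /T1 /= phN neg.
have T10 : T1 (Some 0) = x by rewrite /T1 /= p0w neg.
have fin w : T w != x -> exists r, psi w = Some r /\ r != 0.
  move=> nw; case E : (psi w) => [r|]; last by move: nw; rewrite -(K2 w) E -[T _]/(T1 _) T1N eqxx.
  exists r; split => //; apply: contraNneq nw => r0.
  by rewrite -(K2 w) E r0 -[T _]/(T1 _) T10.
have nEb : T (Some (b *: v)) != x by rewrite Eb eq_sym.
have nEc : T (Some (c *: v)) != x by rewrite Ec eq_sym.
have [r [Er r0]] := fin _ nEb; have [r' [Er' r'0]] := fin _ nEc.
have phr : phi (Some r) = Some (b *: v) by rewrite -Er K2.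
have phr' : phi (Some r') = Some (c *: v) by rewrite -Er' K2.
have Cqp : conc (Some (q *: u)) (Some (p *: u)) (Some (b *: v)) (Some (c *: v)).
  by apply: conc_power; [rewrite (cr_u C) (cr_v C)|rewrite mulrC].
have [k Ek] : exists k, r' = k *: r.
  have : conc None (Some 0) (Some r) (Some r').
    by have := moeb_conc mpsi Cqp; rewrite -phN -p0w !K1 Er Er'.
  have r0' : 0 != r by rewrite eq_sym.
  by case/(conc_line3_inv r0') => k; rewrite add0r subr0; exists k.
have er0 : enorm r != 0 by rewrite gt_eqF // enorm_gt0.
pose w := (enorm r)^-1 *: r.
have w1 : dot w w = 1 by rewrite dotZl dotZr -enorm2; field.
have rw : r = enorm r *: w by rewrite scalerA divff // scale1r.
have rw' : r' = (k * enorm r) *: w by rewrite -scalerA -rw.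
have nrr' : r != r'.
  by apply: contra_neq y'z' => E; rewrite -Eb -Ec -phr -phr' E.
have kr0 : k * enorm r - enorm r != 0.
  rewrite subr_eq0; apply: contra_neq nrr' => E; by rewrite rw' E -rw.
have lineE t : r + t *: (r' - r) = (enorm r + t * (k * enorm r - enorm r)) *: w.
  by rewrite scalerDl -scalerA -rw scalerBl -rw' -rw.
have lineC t : conc None (Some r) (Some r') (Some (t *: w)).
  have := conc_line r r' ((t - enorm r) / (k * enorm r - enorm r)).
  by rewrite lineE (_ : enorm r + _ = t) //; field.
have circ t : conc x y' z' (T1 (Some (t *: w))).
  have := ps_conc P1 (lineC t); by rewrite T1N /T1 /= phr phr' Eb Ec.
have C1 : crossing T1 x y z y' z' u w.
  have wE t : t != q -> exists w0, w0 != -1 /\ fraclin p q w0 = t.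
    move=> tq; have tq0 : q - t != 0 by rewrite subr_eq0 eq_sym.
    have n1 : (t - p) / (q - t) != -1.
      rewrite -subr_eq0 opprK; have -> : (t - p) / (q - t) + 1 = (q - p) / (q - t) by field.
      by rewrite mulf_neq0 ?invr_eq0 // subr_eq0 eq_sym.
    exists ((t - p) / (q - t)); split => //; rewrite /fraclin.
    have n2 : q - p != 0 by rewrite subr_eq0 eq_sym.
    have -> : (t - p) / (q - t) + 1 = (q - p) / (q - t) by field.
    by fieldx.
  have att t : T (Some (t *: u)) != x -> exists s, T1 (Some (s *: u)) = T (Some (t *: u)).
    move=> nt; have [s [s1 Es]] : exists s, s != -1 /\ fraclin p q s = t.
      by apply: wE; apply: contraNneq nt => ->; rewrite neg.
    by exists s; rewrite /T1 /= ph // Es.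
  split=> //.
  - exact: cr_u C.
  - move=> t; have [->|t1] := eqVneq t (-1); last by rewrite /T1 /= ph //; exact: cr_f C _.
    by rewrite /T1 /= ph1 (cr_inf C) inE eqxx.
  - by move=> t; apply: ps2 P1 _ _; exact: circ.
  - by have [|s Es] := att a; [rewrite Ea eq_sym|exists s; rewrite Es].
  - by have [|s Es] := att d; [rewrite Ed eq_sym|exists s; rewrite Es].
  - by exists (enorm r); rewrite -rw /T1 /= phr.
  - by exists (k * enorm r); rewrite -rw' /T1 /= phr'.
have bd t : T1 (Some (t *: u)) != x -> `|t| <= 1 + p / q.
  have [->|t1] := eqVneq t (-1); first by rewrite /T1 /= ph1 (cr_inf C) eqxx.
  rewrite /T1 /= ph // => /(cross_side P C Ea); set s := fraclin p q t => pos.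
  have t10 : t + 1 != 0 by rewrite addr_eq0.
  have Et : t * (a * s - a * q) = a * p - a * s by rewrite /s /fraclin; field.
  have pq0 : 0 < p / q.
    have -> : p / q = (a * p) / (a * q) by fieldx.
    by rewrite nmulr_rgt0 // invr_lt0.
  have h : 0 < a * s - a * q by lra.
  rewrite -(ler_pM2r h) -{1}(gtr0_norm h) -normrM Et ler0_norm; last lra.
  have -> : (1 + p / q) * (a * s - a * q) = a * s - a * q + p / q * (a * s) - a * p by field.
  have := mulr_gt0 pq0 pos; lra.
have uniqy := cross_bounded (pasch_swap P1) (crossing_swap C1) bd.
have uniqz := cross_bounded (pasch_swap (pasch_flip P1)) (crossing_swap (crossing_flip C1)) bd.
have key s : conc (Some (q *: u)) (Some (b *: v)) (Some (c *: v)) s -> T s != x ->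
    exists t, s = phi (Some (t *: w)).
  move=> /(moeb_conc mpsi) Cs ns; rewrite -phN K1 Er Er' in Cs.
  case: (conc_line_inv nrr' Cs) => [E|[t E]].
    by move: ns; rewrite -(K2 s) E -[T _]/(T1 _) T1N eqxx.
  by exists (enorm r + t * (k * enorm r - enorm r)); rewrite -(K2 s) E lineE.
exists (Some (q *: u)), (Some (b *: v)), (Some (c *: v)); split=> //; first exact: neg.
split=> s Cs Es.
- have [|t Et] := key _ Cs; first by rewrite Es eq_sym.
  rewrite Et; have -> : t = enorm r; last by rewrite -rw.
  by apply: uniqy; [rewrite /T1 /= -Et|rewrite -rw /T1 /= phr].
- have [|t Et] := key _ Cs; first by rewrite Es eq_sym.
  rewrite Et; have -> : t = k * enorm r; last by rewrite -rw'.
  by apply: uniqz; [rewrite /T1 /= -Et|rewrite -rw' /T1 /= phr'].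
Qed.
End Pasch.

Section Pole.
Variables (R : realType) (n : nat).
Local Notation E2 := (Rinfty R 2).
Local Notation En := (Rinfty R n).
Implicit Types (T : E2 -> En) (x y z : En).

(** The circle through Y, a point of colour z and a point of colour x' has only
    the colour y' in common with the circle through Q, Y and Z, so that it is
    tangent to that circle at Y. *)
Lemma single_tangent T x y z y' z' x' Q Y Z : pasch T x y z y' z' x' ->
  T Q = x -> T Y = y' -> T Z = z' -> (forall w, conc Q Y Z w -> T w = y' -> w = Y) ->
  in_circle (fun w => T w = z).
Proof.
move=> P EQ EY EZ H.
have [[xy xz xy' xz' xx'] [yz yy' yz' yx'] [zy' zz' zx'] /andP[y'z' y'x'] z'x'] := uniq6 (ps_uniq P).
have [X' EX'] : exists w, T w = x' by apply: (ps_img P); rewrite !inE eqxx !orbT.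
apply: (@tangent_pencil _ Y Q Z X').
- by apply: contra_neq xy' => E; rewrite -EQ -EY E.
- by apply: contra_neq y'z' => E; rewrite -EY -EZ E.
- by apply: contra_neq xz' => E; rewrite -EQ -EZ E.
- by apply: contra_neq y'x' => E; rewrite -EX' -EY E.
move=> u Eu; split; first by apply: contra_neq zy' => E; rewrite -Eu -EY E.
move=> w C1 C2; apply: H; first by conc_by C1.
have := ps_conc P C1; rewrite EY EQ EZ => {}C1.
have := ps_conc P C2; rewrite EY EX' Eu => {}C2.
have := ps2 P (w := w) ltac:(conc_by C1); have := ps4 P (w := w) ltac:(conc_by C2).
rewrite !inE => /or3P[] /eqP -> //.
  by rewrite !(eq_sym x') (negbTE xx') (negbTE y'x') (negbTE z'x').
by rewrite (negbTE zy') (negbTE zz') eq_sym (negbTE xz).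
Qed.

Lemma crossing_classes T x y z y' z' x' u v : pasch T x y z y' z' x' ->
  crossing T x y z y' z' u v -> in_circle (fun w => T w = z) /\ in_circle (fun w => T w = y).
Proof.
move=> P C; have [Q [Y [Z [EQ EY EZ [H1 H2]]]]] := crossing_single P C; split.
  exact: single_tangent P EQ EY EZ H1.
apply: single_tangent (pasch_flip P) EQ EZ EY _ => w Cw; apply: H2; by rewrite concC23.
Qed.

Lemma pole_crossing T x y z y' z' x' X Y Z Y' Z' w : pasch T x y z y' z' x' ->
  T X = x -> T Y = y -> T Z = z -> T Y' = y' -> T Z' = z' ->
  conc X Y Z w -> conc X Y' Z' w -> w != X ->
  exists phi u v, moeb phi /\ crossing (T \o phi) x y z y' z' u v.
Proof.
move=> P EX EY EZ EY' EZ' C1 C2 wX.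
have [[xy xz xy' xz' xx'] [yz yy' yz' yx'] [zy' zz' zx'] /andP[y'z' y'x'] z'x'] := uniq6 (ps_uniq P).
have c1 := ps_conc P C1; have c2 := ps_conc P C2; rewrite EX EY EZ in c1; rewrite EX EY' EZ' in c2.
have Ew : T w = x.
  have := ps1 P c1; have := ps2 P c2; rewrite !inE => /or3P[] /eqP -> //.
    by rewrite !(eq_sym y') (negbTE xy') (negbTE yy') (negbTE zy').
  by rewrite !(eq_sym z') (negbTE xz') (negbTE yz') (negbTE zz').
have nXY : X != Y by apply: contra_neq xy => E; rewrite -EX -EY E.
have nwY : w != Y by apply: contra_neq xy => E; rewrite -Ew -EY E.
have nXw : X != w by rewrite eq_sym.
have [psi [mpsi pX pw _]] := moeb_normalize (pt10 R) nXw nXY nwY.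
have [phi [mphi K1 K2]] := moeb_inv mpsi.
have phN : phi None = X by rewrite -pX K1.
have ph0 : phi (Some 0) = w by rewrite -pw K1.
have fin s : T s != x -> exists r, psi s = Some r /\ r != 0.
  move=> ns; case E : (psi s) => [r|]; last by move: ns; rewrite -(K1 s) E phN EX eqxx.
  exists r; split => //; apply: contraNneq ns => r0.
  by rewrite -(K1 s) E r0 ph0 Ew.
have line A B p q : T A = p -> T B = q -> x != p -> x != q -> p != q -> conc X A B w ->
    ordinary T x p q -> exists v, [/\ dot v v = 1, forall t, T (phi (Some (t *: v))) \in [:: x; p; q],
      exists t, T (phi (Some (t *: v))) = p & exists t, T (phi (Some (t *: v))) = q].
  move=> EA EB np nq npq C ord.
  have [|r [Er r0]] := fin A; first by rewrite EA eq_sym.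
  have [|r' [Er' r'0]] := fin B; first by rewrite EB eq_sym.
  have er0 : enorm r != 0 by rewrite gt_eqF // enorm_gt0.
  pose v := (enorm r)^-1 *: r.
  have rv : r = enorm r *: v by rewrite scalerA divff // scale1r.
  have {}C := moeb_conc mpsi C; rewrite pX pw Er Er' in C.
  have r0' : 0 != r by rewrite eq_sym.
  have [k Ek] : exists k, r' = k *: r.
    have C' : conc None (Some 0) (Some r) (Some r') by conc_by C.
    by case/(conc_line3_inv r0'): C' => k; rewrite add0r subr0; exists k.
  have rv' : r' = (k * enorm r) *: v by rewrite -scalerA -rv.
  have kr0 : k * enorm r - enorm r != 0.
    rewrite subr_eq0; apply: contra_neq npq => E.
    by rewrite -EA -EB -(K1 A) -(K1 B) Er Er' rv' E -rv.
  exists v; split.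
  - by rewrite dotZl dotZr -enorm2; field.
  - move=> t; apply: ord; rewrite -{1}EX -{1}EA -{1}EB; apply: (ps_conc P).
    rewrite -(K1 X) -(K1 A) -(K1 B) pX Er Er'; apply: moeb_conc mphi _.
    have := conc_line r r' ((t - enorm r) / (k * enorm r - enorm r)).
    have -> : r' - r = (k * enorm r - enorm r) *: v by rewrite scalerBl -rv' -rv.
    rewrite scalerA divfK // scalerBl -rv; by rewrite addrC subrK.
  - by exists (enorm r); rewrite -rv -Er K1.
  - by exists (k * enorm r); rewrite -rv' -Er' K1.
have [u [u1 uf [t1 Ht1] [t2 Ht2]]] := line _ _ _ _ EY EZ xy xz yz C1 (ps1 P).
have [v [v1 vf [t1' Ht1'] [t2' Ht2']]] := line _ _ _ _ EY' EZ' xy' xz' y'z' C2 (ps2 P).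
exists phi, u, v; split => //; split=> //; rewrite /= ?phN ?ph0 //.
- by exists t1.
- by exists t2.
- by exists t1'.
- by exists t2'.
Qed.

(** Fix a point X of colour x. If the circles through X with the colours y, z
    are tangent to all those with the colours y', z', then [tangent_pencil]
    applies at X; otherwise two of them cross. *)
Theorem pole T x y z y' z' x' : pasch T x y z y' z' x' ->
  [/\ in_circle (fun w => T w = y), in_circle (fun w => T w = z),
      in_circle (fun w => T w = y') & in_circle (fun w => T w = z')].
Proof.
move=> P.
have [[xy xz xy' xz' xx'] [yz yy' yz' yx'] [zy' zz' zx'] /andP[y'z' y'x'] z'x'] := uniq6 (ps_uniq P).
have im p : p \in [:: x; y; z; y'; z'; x'] -> exists w, T w = p := ps_img P (p := p).
have [X EX] : exists w, T w = x by apply: im; rewrite !inE eqxx.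
have [Y EY] : exists w, T w = y by apply: im; rewrite !inE eqxx !orbT.
have [Z EZ] : exists w, T w = z by apply: im; rewrite !inE eqxx !orbT.
have [Y' EY'] : exists w, T w = y' by apply: im; rewrite !inE eqxx !orbT.
have [Z' EZ'] : exists w, T w = z' by apply: im; rewrite !inE eqxx !orbT.
have [[Y1 [Z1 [Y2 [Z2 [w [[E1 E2 E3 E4] [C1 C2 wX]]]]]]]|ncr] :=
  pselect (exists Y1 Z1 Y2 Z2 w, [/\ T Y1 = y, T Z1 = z, T Y2 = y' & T Z2 = z'] /\
     [/\ conc X Y1 Z1 w, conc X Y2 Z2 w & w != X]).
  have [phi [u [v [mphi C]]]] := pole_crossing P EX E1 E2 E3 E4 C1 C2 wX.
  have P1 := pasch_moeb mphi P.
  have [c1 c2] := crossing_classes P1 C.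
  have [c3 c4] := crossing_classes (pasch_swap P1) (crossing_swap C).
  by split; apply: in_circle_moeb mphi _.
have tan Y1 Z1 Y2 Z2 w : T Y1 = y -> T Z1 = z -> T Y2 = y' -> T Z2 = z' ->
    conc X Y1 Z1 w -> conc X Y2 Z2 w -> w = X.
  move=> *; apply/eqP; apply: contrapT => /negP wX; apply: ncr.
  by exists Y1, Z1, Y2, Z2, w.
have ne A B p q : T A = p -> T B = q -> p != q -> A != B.
  by move=> EA EB; apply: contra_neq => E; rewrite -EA -EB E.
split.
- apply: (@tangent_pencil _ X Y' Z' Z); try (by apply: ne; eassumption).
  move=> s Es; split; first by rewrite eq_sym; apply: ne; eassumption.
  by move=> w Ca Cb; apply: (tan s Z Y' Z') => //; conc_by Cb.
- apply: (@tangent_pencil _ X Y' Z' Y); try (by apply: ne; eassumption).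
  move=> s Es; split; first by rewrite eq_sym; apply: ne; eassumption.
  by move=> w Ca Cb; apply: (tan Y s Y' Z').
- apply: (@tangent_pencil _ X Y Z Z'); try (by apply: ne; eassumption).
  move=> s Es; split; first by rewrite eq_sym; apply: ne; eassumption.
  by move=> w Ca Cb; apply: (tan Y Z s Z') => //; conc_by Cb.
- apply: (@tangent_pencil _ X Y Z Y'); try (by apply: ne; eassumption).
  move=> s Es; split; first by rewrite eq_sym; apply: ne; eassumption.
  by move=> w Ca Cb; apply: (tan Y Z Y' s).
Qed.

(** The colours x and x' are reached by taking y as the pole. *)
Corollary pasch_circles T x y z y' z' x' : pasch T x y z y' z' x' ->
  forall p, p \in [:: x; y; z; y'; z'; x'] -> in_circle (fun w => T w = p).
Proof.
move=> P; have [c1 c2 c3 c4] := pole P; have [c5 _ c6 _] := pole (pasch_pole P).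
by move=> p; rewrite !inE => /orP[|/orP[|/orP[|/orP[|/orP[|]]]]] /eqP ->.
Qed.
End Pole.

(** * The Sylvester-Gallai theorem *)

Section FinitePigeonhole.
Variables (R : realType) (C : eqType).

Lemma fresh_real (s : seq R) : exists x, x \notin s.
Proof.
have [M HM] : exists M, forall x, x \in s -> x < M.
  elim: s => [|y s [M HM]]; first by exists 0.
  exists (Num.max M (y + 1)) => x; rewrite inE lt_max => /predU1P[->|/HM ->] //.
  by rewrite orbC ltrDl ltr01.
by exists M; apply/negP => /HM; rewrite ltxx.
Qed.

Lemma infinite_fibre (f : R -> C) (q : seq C) : (forall x, f x \in q) ->
  exists k, forall s : seq R, exists2 x, f x = k & x \notin s.
Proof.
move=> fq; apply: contrapT => nk.
have H k : exists s : seq R, forall x, f x = k -> x \in s.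
  apply: contrapT => ns; apply: nk; exists k => s; apply: contrapT => nx.
  apply: ns; exists s => x fx; apply: contrapT => /negP xs; apply: nx; by exists x.
have [S HS] := choice H.
have [x xn] := fresh_real (flatten (map S q)).
move/negP: xn; apply; apply/flattenP; exists (S (f x)); first exact: map_f.
exact: HS.
Qed.
End FinitePigeonhole.

Lemma seq_argmin (R : realType) (T : eqType) (f : T -> R) (x0 : T) (s : seq T) :
  exists2 x, x \in x0 :: s & forall y, y \in x0 :: s -> f x <= f y.
Proof.
elim: s x0 => [|a s IH] x0.
  by exists x0; rewrite ?inE // => y; rewrite inE => /eqP ->.
have [x xin xmin] := IH a; have [le|lt] := lerP (f x0) (f x).
  exists x0; first by rewrite inE eqxx.
  by move=> y; rewrite inE => /predU1P[->|/xmin]; last exact: le_trans.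
exists x; first by rewrite inE xin orbT.
by move=> y; rewrite inE => /predU1P[->|/xmin //]; exact: ltW.
Qed.

Section Sylvester.
Variables (R : realType) (m : nat).
Implicit Types (p b c d : 'rV[R]_m).

(** The squared area of the parallelogram spanned by u and v. *)
Definition gram (u v : 'rV[R]_m) : R := dot u u * dot v v - dot u v ^+ 2.

Lemma gram_decomp u v : v != 0 ->
  exists k n, [/\ u = n + k *: v, dot n v = 0 & gram u v = dot n n * dot v v].
Proof.
move=> v0; have vv : dot v v != 0 by rewrite dot_eq0.
exists (dot u v / dot v v), (u - (dot u v / dot v v) *: v); split.
- by rewrite subrK.
- by rewrite dotDl dotNl dotZl divfK // subrr.
- rewrite /gram !dotE (dotC v u); field; exact: vv.
Qed.

Lemma gram_line u v : v != 0 -> gram u v = 0 -> exists k, u = k *: v.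
Proof.
move=> v0 g0; have [k [n [E _ G]]] := gram_decomp u v0.
exists k; move: G; rewrite g0 => /esym/eqP; rewrite mulf_eq0 !dot_eq0 (negbTE v0) orbF => /eqP n0.
by rewrite E n0 add0r.
Qed.

(** Two of the three numbers have a nonnegative product; s is the one of smaller
    absolute value. *)
Lemma two_same_side (x y z : R) : x != y -> x != z -> y != z ->
  exists s t, [/\ s \in [:: x; y; z], t \in [:: x; y; z], s != t & (t - s) ^+ 2 <= t ^+ 2].
Proof.
have side (s t : R) : 0 <= s * t -> `|s| <= `|t| -> (t - s) ^+ 2 <= t ^+ 2.
  move=> st le; have : s ^+ 2 <= s * t.
    by rewrite -[s * t]ger0_norm // normrM -real_normK ?num_real // expr2 ler_wpM2l.
  have -> : (t - s) ^+ 2 = t ^+ 2 - 2 * (s * t) + s ^+ 2 by ring.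
  by move=> ?; lra.
have key (s t : R) : 0 <= s * t -> (t - s) ^+ 2 <= t ^+ 2 \/ (s - t) ^+ 2 <= s ^+ 2.
  move=> st; have [h|/ltW h] := lerP `|s| `|t|; [left|right]; apply: side => //.
  by rewrite mulrC.
move=> xy xz yz.
have [s [t [sin tin st pos]]] : exists s t, [/\ s \in [:: x; y; z], t \in [:: x; y; z], s != t & 0 <= s * t].
  have [h|h] := lerP 0 (x * y); first by exists x, y; rewrite !inE !eqxx ?orbT.
  have [h2|h2] := lerP 0 (x * z); first by exists x, z; rewrite !inE !eqxx ?orbT.
  exists y, z; rewrite !inE !eqxx ?orbT; split=> //.
  have x0 : 0 < x ^+ 2 by rewrite exprn_even_gt0 //=; apply: contraTneq h => ->; rewrite mul0r ltxx.
  have : 0 < (x * y) * (x * z) by rewrite nmulr_rgt0.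
  have -> : (x * y) * (x * z) = x ^+ 2 * (y * z) by ring.
  by rewrite pmulr_rgt0 // => /ltW.
case: (key s t pos) => le; first by exists s, t.
by exists t, s; rewrite eq_sym.
Qed.

(** Take a point p and a line b c not containing p at minimal distance. If b c
    contained a third point, two of the three would be on the same side of the
    foot of the perpendicular from p, and the inner one of them would be closer
    to the line that joins p to the outer one. *)
Lemma sylvester (s : seq 'rV[R]_m) p0 b0 c0 : p0 \in s -> b0 \in s -> c0 \in s ->
  c0 != b0 -> gram (p0 - b0) (c0 - b0) != 0 ->
  exists b c, [/\ b \in s, c \in s, b != c &
    forall e t, e \in s -> e = b + t *: (c - b) -> e = b \/ e = c].
Proof.
move=> p0s b0s c0s cb0 g0.
pose tri := [seq x <- [seq (pb, c) | pb <- [seq (p, b) | p <- s, b <- s], c <- s] |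
  (x.2 != x.1.2) && (gram (x.1.1 - x.1.2) (x.2 - x.1.2) != 0)].
have trE p b c : ((p, b, c) \in tri) = [&& p \in s, b \in s, c \in s, c != b & gram (p - b) (c - b) != 0].
  rewrite mem_filter /= andbC; apply/idP/idP.
    case/and3P => /allpairsP[[[p' b'] c']] /= [H cs [-> -> ->]] -> ->.
    by case/allpairsP: H => -[p'' b''] /= [ps bs [-> ->]]; rewrite ps bs cs.
  case/and5P => ps bs cs -> ->; rewrite !andbT.
  by apply/allpairsP; exists (p, b, c); split => //=; apply/allpairsP; exists (p, b).
(* h (p, b, c) is the squared distance of p from the line b c *)
pose h (x : 'rV[R]_m * 'rV[R]_m * 'rV[R]_m) := gram (x.1.1 - x.1.2) (x.2 - x.1.2) / dot (x.2 - x.1.2) (x.2 - x.1.2).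
have in0 : (p0, b0, c0) \in tri by rewrite trE p0s b0s c0s cb0.
have [[[p b] c] xin xmin] := seq_argmin h (p0, b0, c0) tri.
have {}xin : (p, b, c) \in tri by move: xin; rewrite inE => /predU1P[->|].
have {}xmin y : y \in tri -> h (p, b, c) <= h y.
  by move=> yt; apply: xmin; rewrite inE yt orbT.
move: (xin); rewrite trE => /and5P[ps bs cs cb g].
exists b, c; split; rewrite 1?eq_sym // => e t es Ee.
have [->|eb] := eqVneq e b; first by left.
have [->|ec] := eqVneq e c; first by right.
pose d := c - b; have d0 : d != 0 by rewrite subr_eq0.
have dd : 0 < dot d d by rewrite dot_gt0.
have dd0 : dot d d != 0 by rewrite gt_eqF.
have t0 : t != 0 by apply: contra_neq eb => E; rewrite Ee E scale0r addr0.
have t1 : t != 1 by apply: contra_neq ec => E; rewrite Ee E scale1r addrC subrK.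
(* b + k d is the foot of the perpendicular n from p *)
have [k [n [En nd G]]] := gram_decomp (p - b) d0.
have hE : h (p, b, c) = dot n n by rewrite /h /= -/d G mulfK.
have nn : 0 < dot n n.
  rewrite lt_neqAle dot_ge0 andbT eq_sym; apply: contra_neq g => E.
  by rewrite -/d G E mul0r.
have [|||al [be [ali bei ne le]]] := @two_same_side (0 - k) (1 - k) (t - k).
- by rewrite (inj_eq (addIr _)) eq_sym oner_neq0.
- by rewrite (inj_eq (addIr _)) eq_sym.
- by rewrite (inj_eq (addIr _)) eq_sym.
have pin x : x \in [:: 0 - k; 1 - k; t - k] -> b + (k + x) *: d \in s.
  rewrite !inE => /or3P[] /eqP ->; rewrite [k + _]addrC subrK.
  - by rewrite scale0r addr0.
  - by rewrite scale1r addrC subrK.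
  - by rewrite -Ee.
pose A := b + (k + al) *: d; pose B := b + (k + be) *: d.
have As : A \in s := pin _ ali; have Bs : B \in s := pin _ bei.
have EAB : A - B = (al - be) *: d.
  by rewrite /A /B opprD addrACA subrr add0r -scalerBl; congr (_ *: _); ring.
have EpB : p - B = n - be *: d.
  rewrite /B opprD addrA En -addrA -scalerBl; congr (_ + _); rewrite -scaleNr; congr (_ *: _); ring.
clearbody d.
have gE : gram (A - B) (p - B) = (al - be) ^+ 2 * dot d d * dot n n.
  rewrite EAB EpB /gram !dotE (dotC d n) nd; ring.
have dE : dot (p - B) (p - B) = dot n n + be ^+ 2 * dot d d.
  by rewrite EpB !dotE (dotC d n) nd; ring.
have dp : 0 < dot (p - B) (p - B).
  by rewrite dE ltr_wpDr // mulr_ge0 ?sqr_ge0 // ltW.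
have tin : (A, B, p) \in tri.
  rewrite trE As Bs ps gE -subr_eq0 -dot_eq0 gt_eqF //=.
  by rewrite !mulf_neq0 ?expf_neq0 ?subr_eq0 // gt_eqF.
have := xmin _ tin; rewrite hE /h /= gE ler_pdivlMr // dE mulrC ler_pM2r // => H.
have : (be - al) ^+ 2 * dot d d <= be ^+ 2 * dot d d by rewrite ler_pM2r.
have -> : (be - al) ^+ 2 = (al - be) ^+ 2 by ring.
move=> H2; have := le_trans H H2; by rewrite gerDr leNgt nn.
Qed.
End Sylvester.

(** * The image is infinite *)

Section Closure.
Variables (R : realType) (n : nat).
Local Notation En := (Rinfty R n).
Implicit Types p q r s t : En.

Lemma conc_dim_le3 (W : {vspace 'rV[R]_n * R^o * R^o}) p q r s : (\dim W <= 3)%N ->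
  inb W p -> inb W q -> inb W r -> inb W s -> conc p q r s.
Proof.
move=> dW hp hq hr hs; apply/negP => fr.
have sub : (<<[:: nullvec p; nullvec q; nullvec r; nullvec s]>> <= W)%VS.
  by apply/span_subvP => X; rewrite !inE => /or4P[] /eqP ->.
have := leq_trans (dimvS sub) dW.
by have /eqP -> : \dim <<[:: nullvec p; nullvec q; nullvec r; nullvec s]>> == 4 by [].
Qed.

Lemma inb_conc4 (W : {vspace 'rV[R]_n * R^o * R^o}) p q r s : \dim W = 3 ->
  inb W p -> inb W q -> inb W r -> inb W s -> conc p q r s.
Proof. by move=> dW; apply: conc_dim_le3; rewrite dW. Qed.

Lemma conc_trans p q r s t : p != q -> p != r -> q != r ->
  conc p q r s -> conc p q r t -> conc p q s t.
Proof.
move=> pq pr qr; rewrite !(conc_span _ pq pr qr) => hs ht.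
by apply: (inb_conc4 (dim_span3 pq pr qr)); [exact: inb1|exact: inb2|..].
Qed.
End Closure.

Section FiniteImage.
Variables (R : realType) (n : nat).
Local Notation E2 := (Rinfty R 2).
Local Notation En := (Rinfty R n).
Implicit Types (T : E2 -> En) (a b c d e f : En).

Definition general T := forall a b c, a != b -> a != c -> b != c ->
  exists w w', [/\ T w != T w', ~~ conc a b c (T w) & ~~ conc a b c (T w')].

Lemma general_avoid T a b c d : general T -> a != b -> a != c -> b != c ->
  exists2 w, T w != d & ~~ conc a b c (T w).
Proof.
move=> G ab ac bc; have [w [w' [ww' h h']]] := G _ _ _ ab ac bc.
have [E|ne] := eqVneq (T w) d; last by exists w.
by exists w' => //; rewrite -E eq_sym.
Qed.

(** On each horizontal line some colour is taken infinitely often, and its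
    circle is then this line; but there are more horizontal lines than colours.
    *)
Lemma circles_cover T (q : seq En) : (forall w, T w \in q) ->
  (forall w, in_circle (fun z => T z = T w)) -> False.
Proof.
move=> fq H.
pose h s t : E2 := Some (pt t s).
have hinj s : injective (h s) by move=> t t' [/pt_inj[]].
have lineP s t1 t2 z : t1 != t2 -> conc (h s t1) (h s t2) None z -> z = None \/ exists t, z = h s t.
  move=> t12 C.
  have C' : conc None (h s t1) (h s t2) z by conc_by C.
  have n12 : pt t1 s != pt t2 s by apply: contra_neq t12 => /pt_inj[].
  case: (conc_line_inv n12 C') => [->|[t ->]]; first by left.
  right; rewrite ptN !ptD ptZ ptD /h subrr mulr0 addr0; by eexists.
have hconc s t1 t2 t3 : conc None (h s t1) (h s t2) (h s t3).
  have [E|n12] := eqVneq t1 t2.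
    by have K := conc_dup (h s t1) None (h s t3); rewrite -E; conc_by K.
  have := conc_line (pt t1 s) (pt t2 s) ((t3 - t1) / (t2 - t1)).
  have nz : t2 - t1 != 0 by rewrite subr_eq0 eq_sym.
  rewrite ptN !ptD ptZ ptD /h subrr mulr0 addr0.
  by have -> : t1 + (t3 - t1) / (t2 - t1) * (t2 - t1) = t3 by field.
have cls s : exists k, (exists t, T (h s t) = k) /\ forall w, T w = k -> w = None \/ exists t, w = h s t.
  have [k Hk] := infinite_fibre (fun t => fq (h s t)).
  have [t1 E1 _] := Hk [::]; have [t2 E2' n2] := Hk [:: t1]; have [t3 E3 n3] := Hk [:: t1; t2].
  have t12 : h s t1 != h s t2 by rewrite (inj_eq (@hinj s)); move: n2; rewrite inE eq_sym.
  move: n3; rewrite !inE negb_or => /andP[n31 n32].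
  have t13 : h s t1 != h s t3 by rewrite (inj_eq (@hinj s)) eq_sym.
  have t23 : h s t2 != h s t3 by rewrite (inj_eq (@hinj s)) eq_sym.
  exists k; split; first by exists t1.
  move=> w Ew; have [A [B [C [AB AC BC Hc]]]] := H (h s t1).
  have in3 z : T z = k -> inb (span3 A B C) z by move=> Ez; rewrite -conc_span // Hc // Ez E1.
  have d3 := dim_span3 AB AC BC.
  have C0 : conc (h s t1) (h s t2) (h s t3) w by apply: (inb_conc4 d3); apply: in3.
  apply: (lineP s t1 t2); first by rewrite -(inj_eq (@hinj s)).
  have C1 : conc (h s t1) (h s t2) (h s t3) None by have K := hconc s t1 t2 t3; conc_by K.
  have := conc_trans t12 t13 t23 C1 C0; by [].
have [k Hk] := choice cls.
have kq s : k s \in q by have [[t <-] _] := Hk s.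
have [c Hc] := infinite_fibre kq.
have [s Es _] := Hc [::]; have [s' Es' ns'] := Hc [:: s].
have [[w Ew] _] := Hk s.
have [_ Hs'] := Hk s'; case: (Hs' (h s w)); rewrite ?Ew ?Es ?Es' // => -[t /esym[/pt_inj[_ E]]].
by move: ns'; rewrite inE E eqxx.
Qed.

Section Ordinary.
Variable T : E2 -> En.
Hypotheses (HT : conc_preserving T) (G : general T).

Lemma ordinary_off a b c w : ordinary T a b c -> T w \notin [:: a; b; c] -> ~~ conc a b c (T w).
Proof. by move=> o; apply: contra; exact: o. Qed.

Lemma off3 a b c d : d \notin [:: a; b; c] -> [/\ a != d, b != d & c != d].
Proof. by rewrite !inE !negb_or !(eq_sym d) => /and3P[]. Qed.

(** Call the pair of the colours a, b, c found here the label of the edge from D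
    to E; it is provided by [moved_pair]. *)
Lemma label A B C D E : T A != T B -> T A != T C -> T B != T C ->
  ordinary T (T A) (T B) (T C) -> T D \notin [:: T A; T B; T C] ->
  T E \notin [:: T A; T B; T C] -> T D != T E ->
  [|| conc (T A) (T B) (T D) (T E), conc (T B) (T C) (T D) (T E) | conc (T C) (T A) (T D) (T E)].
Proof.
move=> ab ac bc o hD hE de.
have oD := ordinary_off o hD; have oE := ordinary_off o hE.
have fq z : conc A B C z -> T z \in [:: T A; T B; T C] by move/HT/o.
have [z [z' [Cz Cz' nz K]]] := moved_pair HT ab ac bc oD oE de fq.
move: (fq _ Cz) (fq _ Cz') nz K; rewrite !inE.
case/or3P => /eqP -> /or3P[] /eqP ->; rewrite ?eqxx // => _ K.
- by apply/or3P/Or31; conc_by K.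
- by apply/or3P/Or33; conc_by K.
- by apply/or3P/Or31; conc_by K.
- by apply/or3P/Or32; conc_by K.
- by apply/or3P/Or33; conc_by K.
- by apply/or3P/Or32; conc_by K.
Qed.

(** A further colour on the block of a, d, f would have a label with d, and each
    of the three labels puts b or c on this block. *)
Lemma ordinary_face A B C D F : T A != T B -> T A != T C -> T B != T C ->
  ordinary T (T A) (T B) (T C) -> T D \notin [:: T A; T B; T C] ->
  T F \notin [:: T A; T B; T C] -> T D != T F -> conc (T B) (T C) (T D) (T F) ->
  ordinary T (T A) (T D) (T F).
Proof.
move=> ab ac bc o hD hF df K w Kw; apply: contraT => hw.
have oD := ordinary_off o hD.
have [ad bd cd] := off3 hD; have [af bf cf] := off3 hF.
have [aw dw fw] := off3 hw.
have nB : ~~ conc (T A) (T D) (T F) (T B).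
  apply: contra oD => KB.
  have K1 : conc (T B) (T D) (T F) (T C) by conc_by K.
  have K2 : conc (T B) (T D) (T F) (T A) by conc_by KB.
  by have K3 := conc_trans bd bf df K1 K2; conc_by K3.
have nC : ~~ conc (T A) (T D) (T F) (T C).
  apply: contra oD => KC.
  have K1 : conc (T C) (T D) (T F) (T B) by conc_by K.
  have K2 : conc (T C) (T D) (T F) (T A) by conc_by KC.
  by have K3 := conc_trans cd cf df K1 K2; conc_by K3.
have wB : T w != T B by apply: contraNneq nB => <-.
have wC : T w != T C by apply: contraNneq nC => <-.
have hw' : T w \notin [:: T A; T B; T C] by rewrite !inE !negb_or wB wC eq_sym aw.
have wd : T w != T D by rewrite eq_sym.
have Kt : conc (T A) (T D) (T w) (T F) by conc_by Kw.
case/or3P: (label ab ac bc o hw' hD wd) => L.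
- have K1 : conc (T A) (T D) (T w) (T B) by conc_by L.
  by move/negP: nB; case; have K2 := conc_trans ad aw dw Kt K1; conc_by K2.
- have K1 : conc (T D) (T B) (T C) (T w) by conc_by L.
  have K2 : conc (T D) (T B) (T C) (T F) by conc_by K.
  have db : T D != T B by rewrite eq_sym.
  have dc : T D != T C by rewrite eq_sym.
  have K3 := conc_trans db dc bc K1 K2.
  have K4 : conc (T D) (T w) (T F) (T B) by conc_by K3.
  have K5 : conc (T D) (T w) (T F) (T A) by conc_by Kw.
  have wf : T w != T F by rewrite eq_sym.
  move/negP: nB; case; have K6 : conc (T D) (T F) (T w) (T A) by conc_by Kw.
  have K7 : conc (T D) (T F) (T w) (T B) by conc_by K4.
  have fw' : T F != T w by [].
  by have K8 := conc_trans df dw fw' K6 K7; conc_by K8.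
- have K1 : conc (T A) (T D) (T w) (T C) by conc_by L.
  by move/negP: nC; case; have K2 := conc_trans ad aw dw Kt K1; conc_by K2.
Qed.

(** If the three edges of a triangle have three different labels, then its edges
    span ordinary blocks with a, b and c by [ordinary_face]. *)
Lemma octahedron A B C D E F : T A != T B -> T A != T C -> T B != T C ->
  ordinary T (T A) (T B) (T C) -> T D \notin [:: T A; T B; T C] ->
  T E \notin [:: T A; T B; T C] -> T F \notin [:: T A; T B; T C] ->
  T D != T E -> T D != T F -> T E != T F ->
  conc (T B) (T C) (T D) (T F) -> conc (T A) (T B) (T D) (T E) -> conc (T C) (T A) (T E) (T F) ->
  pasch T (T A) (T B) (T C) (T D) (T F) (T E).
Proof.
move=> ab ac bc o hD hE hF de df ef K1 K2 K3.
have [ad bd cd] := off3 hD; have [ae be ce] := off3 hE; have [af bf cf] := off3 hF.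
have ba : T B != T A by rewrite eq_sym.
have ca : T C != T A by rewrite eq_sym.
have cb : T C != T B by rewrite eq_sym.
have ob := ordinary12 o; have oc := ordinary12 (ordinary23 o).
have mb u : (u \notin [:: T A; T B; T C]) = (u \notin [:: T B; T A; T C]).
  by rewrite !inE orbCA.
have mc u : (u \notin [:: T A; T B; T C]) = (u \notin [:: T C; T A; T B]).
  by rewrite !inE !negb_or andbA andbC.
split=> //.
- rewrite /= !inE !negb_or ab ac ad ae af bc bd be bf cd ce cf de df.
  by rewrite eq_sym ef.
- by move=> p; rewrite !inE => /orP[|/orP[|/orP[|/orP[|/orP[|]]]]] /eqP ->; eexists.
- exact: (ordinary_face ab ac bc o hD hF df K1).
- move: hE hF; rewrite !mb => hE hF.
  have H : ordinary T (T B) (T E) (T F) by apply: ordinary_face ba bc ac ob hE hF ef _; conc_by K3.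
  exact: ordinary12 H.
- move: hD hE; rewrite !mc => hD hE.
  have H : ordinary T (T C) (T D) (T E) by apply: ordinary_face ca cb ab oc hD hE de _.
  exact: ordinary12 (ordinary23 (ordinary12 H)).
Qed.

(** Two different labels at d force the third label on the opposite edge. *)
Lemma octahedron_two A B C D E F : T A != T B -> T A != T C -> T B != T C ->
  ordinary T (T A) (T B) (T C) -> T D \notin [:: T A; T B; T C] ->
  T E \notin [:: T A; T B; T C] -> T F \notin [:: T A; T B; T C] ->
  T D != T E -> T D != T F -> T E != T F ->
  conc (T B) (T C) (T D) (T F) -> conc (T A) (T B) (T D) (T E) -> ~~ conc (T B) (T C) (T D) (T E) ->
  pasch T (T A) (T B) (T C) (T D) (T F) (T E).
Proof.
move=> ab ac bc o hD hE hF de df ef K1 K2 nE.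
have [ad bd cd] := off3 hD; have [ae be ce] := off3 hE; have [af bf cf] := off3 hF.
have oD := ordinary_off o hD.
case/or3P: (label ab ac bc o hE hF ef) => L.
- move/negP: oD; case.
  have M1 : conc (T A) (T B) (T E) (T D) by conc_by K2.
  have M2 := conc_trans ab ae be M1 L.
  have M3 : conc (T B) (T D) (T F) (T A) by conc_by M2.
  have M4 : conc (T B) (T D) (T F) (T C) by conc_by K1.
  by have M5 := conc_trans bd bf df M3 M4; conc_by M5.
- move/negP: nE; case.
  have M1 : conc (T B) (T C) (T F) (T D) by conc_by K1.
  have M2 : conc (T B) (T C) (T F) (T E) by conc_by L.
  by have M3 := conc_trans bc bf cf M1 M2.
- exact: octahedron.
Qed.

(** General position gives a colour e off the block of b, c, d, and the label of
    the edge from D to E is then not that of the edge from D to F. *)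
Lemma octahedron_bc A B C D F : T A != T B -> T A != T C -> T B != T C ->
  ordinary T (T A) (T B) (T C) -> T D \notin [:: T A; T B; T C] ->
  T F \notin [:: T A; T B; T C] -> T D != T F -> conc (T B) (T C) (T D) (T F) ->
  forall w, T w \in [:: T A; T B; T C; T D] -> in_circle (fun z => T z = T w).
Proof.
move=> ab ac bc o hD hF df K1 w hw.
have [ad bd cd] := off3 hD.
have [E Ea nE] := general_avoid (T A) G bc bd cd.
have [Eb Ec Ed Ef] : [/\ T E != T B, T E != T C, T E != T D & T E != T F].
  split; apply: contraNneq nE => ->; last exact: K1.
  - by have K := conc_dup (T B) (T C) (T D); conc_by K.
  - by have K := conc_dup (T C) (T B) (T D); conc_by K.
  - by have K := conc_dup (T D) (T B) (T C); conc_by K.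
have hE : T E \notin [:: T A; T B; T C] by rewrite !inE !negb_or Ea Eb Ec.
have de : T D != T E by rewrite eq_sym.
case/or3P: (label ab ac bc o hD hE de) => L.
- have P := octahedron_two ab ac bc o hD hE hF de df Ef K1 L nE.
  by apply: (pasch_circles P); move: hw; rewrite !inE => /or4P[] ->; rewrite ?orbT.
- by rewrite L in nE.
- have mc u : (u \notin [:: T A; T B; T C]) = (u \notin [:: T A; T C; T B]).
    by rewrite !inE [(_ == T B) || _]orbC.
  move: hD hE hF; rewrite !mc => hD hE hF.
  have cb : T C != T B by rewrite eq_sym.
  have K1' : conc (T C) (T B) (T D) (T F) by conc_by K1.
  have L' : conc (T A) (T C) (T D) (T E) by conc_by L.
  have nE' : ~~ conc (T C) (T B) (T D) (T E) by apply: contra nE => K; conc_by K.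
  have P := octahedron_two ac ab cb (ordinary23 o) hD hE hF de df Ef K1' L' nE'.
  by apply: (pasch_circles P); move: hw; rewrite !inE => /or4P[] ->; rewrite ?orbT.
Qed.

(** General position gives a colour off the block of a, b, d, hence an edge at D
    whose label is not a, b. *)
Lemma ordinary_circles A B C D : T A != T B -> T A != T C -> T B != T C ->
  ordinary T (T A) (T B) (T C) -> T D \notin [:: T A; T B; T C] ->
  forall w, T w \in [:: T A; T B; T C; T D] -> in_circle (fun z => T z = T w).
Proof.
move=> ab ac bc o hD w hw.
have [ad bd cd] := off3 hD; have oD := ordinary_off o hD.
have [F Fc nF] := general_avoid (T C) G ab ad bd.
have [Fa Fb Fd] : [/\ T F != T A, T F != T B & T F != T D].
  split; apply: contraNneq nF => ->.
  - by have K := conc_dup (T A) (T B) (T D); conc_by K.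
  - by have K := conc_dup (T B) (T A) (T D); conc_by K.
  - by have K := conc_dup (T D) (T A) (T B); conc_by K.
have hF : T F \notin [:: T A; T B; T C] by rewrite !inE !negb_or Fa Fb Fc.
have df : T D != T F by rewrite eq_sym.
case/or3P: (label ab ac bc o hD hF df) => L.
- by rewrite L in nF.
- exact: octahedron_bc ab ac bc o hD hF df L w hw.
- have mb u : (u \notin [:: T A; T B; T C]) = (u \notin [:: T B; T A; T C]).
    by rewrite !inE orbCA.
  move: hD hF; rewrite !mb => hD hF.
  have ba : T B != T A by rewrite eq_sym.
  have L' : conc (T A) (T C) (T D) (T F) by conc_by L.
  apply: (octahedron_bc ba bc ac (ordinary12 o) hD hF df L').
  by move: hw; rewrite !inE => /or4P[] ->; rewrite ?orbT.
Qed.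

Lemma ordinary_absurd (q : seq En) A B C : (forall w, T w \in q) -> T A != T B -> T A != T C -> T B != T C ->
  ~ ordinary T (T A) (T B) (T C).
Proof.
move=> fq ab ac bc o; apply: (circles_cover fq) => w.
have [hw|hw] := boolP (T w \in [:: T A; T B; T C]); last first.
  apply: (ordinary_circles ab ac bc o hw); by rewrite !inE eqxx !orbT.
have [D Da nD] := general_avoid (T A) G ab ac bc.
have hD : T D \notin [:: T A; T B; T C].
  apply: contra nD; rewrite !inE => /or3P[] /eqP ->.
  - by have K := conc_dup (T A) (T B) (T C); conc_by K.
  - by have K := conc_dup (T B) (T A) (T C); conc_by K.
  - by have K := conc_dup (T C) (T A) (T B); conc_by K.
apply: (ordinary_circles ab ac bc o hD).
by move: hw; rewrite !inE => /or3P[] ->; rewrite ?orbT.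
Qed.

(** After moving one colour to infinity, an ordinary line through two of the
    other colours is an ordinary block. *)
Theorem finite_absurd (q : seq En) A B C : (forall w, T w \in q) ->
  T A != T B -> T A != T C -> T B != T C -> False.
Proof.
move=> fq ab ac bc.
have [psi [mpsi psA]] := moeb_to_inf (T A).
have [phi [mphi K1 K2]] := moeb_inv mpsi.
pose rs := pmap psi [seq p <- q | `[< exists w, T w = p >]].
have rsP r : reflect (exists w, psi (T w) = Some r) (r \in rs).
  rewrite mem_pmap; apply: (iffP mapP) => [[p]|[w Ew]].
    rewrite mem_filter => /andP[/asboolP[w <-] _] ->; by exists w.
  exists (T w) => //; rewrite mem_filter fq andbT; apply/asboolP; by exists w.
have fin w : T A != T w -> exists2 r, psi (T w) = Some r & r \in rs.
  move=> aw; case E : (psi (T w)) => [r|]; last first.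
    by move: aw; rewrite -(K1 (T A)) psA -E K1 eqxx.
  by exists r => //; apply/rsP; exists w.
have [b Eb bin] := fin _ ab; have [c Ec cin] := fin _ ac.
have [D Da nD] := general_avoid (T A) G ab ac bc.
have ad : T A != T D by rewrite eq_sym.
have [d Ed din] := fin _ ad.
have cb : c != b by apply: contra_neq bc => E; rewrite -(K1 (T B)) -(K1 (T C)) Eb Ec E.
have cb0 : c - b != 0 by rewrite subr_eq0.
have g0 : gram (d - b) (c - b) != 0.
  apply: contraNneq nD => /(gram_line cb0)[k Ek].
  rewrite -(K1 (T A)) -(K1 (T B)) -(K1 (T C)) -(K1 (T D)) psA Eb Ec Ed.
  apply: moeb_conc mphi _; have := conc_line b c k; by rewrite -Ek addrC subrK.
have [b' [c' [/rsP[B' EB] /rsP[C' EC] bc' H]]] := sylvester din bin cin cb g0.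
have nA W r : psi (T W) = Some r -> T A != T W.
  by move=> E; apply/eqP => EA; move: E; rewrite -EA psA.
apply: (@ordinary_absurd q A B' C' fq (nA _ _ EB) (nA _ _ EC)).
  by apply: contra_neq bc' => E; move: EB; rewrite E EC => -[].
move=> w Kw; have [->|aw] := eqVneq (T w) (T A); first by rewrite inE eqxx.
rewrite eq_sym in aw; have [e Ee ein] := fin _ aw.
have := moeb_conc mpsi Kw; rewrite psA EB EC Ee => /(conc_line3_inv bc')[t Et].
have [E|E] := H _ _ ein Et.
  have -> : T w = T B' by rewrite -(K1 (T w)) -(K1 (T B')) Ee EB E.
  by rewrite !inE eqxx orbT.

have -> : T w = T C' by rewrite -(K1 (T w)) -(K1 (T C')) Ee EC E.
by rewrite !inE eqxx !orbT.
Qed.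
End Ordinary.
End FiniteImage.

(** * Circles with three colours have infinitely many *)

Section InfiniteImage.
Variables (R : realType) (n : nat).
Local Notation E2 := (Rinfty R 2).
Local Notation En := (Rinfty R n).
Variable T : E2 -> En.
Hypotheses (HT : conc_preserving T) (G : general T).
Implicit Types (a b c d e f g : En) (W : {vspace ('rV[R]_n * R^o * R^o)%type}).

Definition infinitely_many (P : En -> Prop) := forall s : seq En, exists2 w, P (T w) & T w \notin s.

Lemma infinite_pigeonhole (K : eqType) (ks : seq K) (Q : K -> En -> Prop) P : infinitely_many P ->
  (forall w, P (T w) -> exists2 k, k \in ks & Q k (T w)) ->
  exists2 k, k \in ks & infinitely_many (fun x => P x /\ Q k x).
Proof.
move=> inf cov; apply: contrapT => nk.
have H k : exists s : seq En, k \in ks -> forall w, P (T w) -> Q k (T w) -> T w \in s.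
  have [kin|kn] := boolP (k \in ks); last by exists [::].
  apply: contrapT => ns; apply: nk; exists k => // s; apply: contrapT => nx.
  apply: ns; exists s => _ w Pw Qw; apply: contrapT => /negP ws; apply: nx; by exists w.
have [S HS] := choice H.
have [w Pw] := inf (flatten (map S ks)); have [k kin Qk] := cov _ Pw.
move/negP; apply; apply/flattenP; exists (S k); first exact: map_f.
exact: HS Qk.
Qed.

Lemma infinite_three P : infinitely_many P -> exists w1 w2 w3,
  [/\ P (T w1), P (T w2), P (T w3) & [/\ T w1 != T w2, T w1 != T w3 & T w2 != T w3]].
Proof.
move=> inf; have [w1 P1 _] := inf [::]; have [w2 P2] := inf [:: T w1]; have [w3 P3] := inf [:: T w1; T w2].
rewrite !inE negb_or => /andP[n13 n23] n12.
by exists w1, w2, w3; split=> //; split; rewrite eq_sym.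
Qed.

Lemma infinite_block P W W' : infinitely_many P -> \dim W = 3 -> \dim W' = 3 ->
  (forall w, P (T w) -> inb W (T w)) -> (forall w, P (T w) -> inb W' (T w)) -> W = W'.
Proof.
move=> /infinite_three[w1 [w2 [w3 [P1 P2 P3 [n12 n13 n23]]]]] dW dW' H H'.
by apply: (block_eq dW dW' n12 n13 n23); auto.
Qed.

(** By [moved_pair], all colours off the circle lie on finitely many circles
    through one of them, d, so that one of these circles, W, has infinitely many
    of them. If e were another one, off W, the same argument at e would give a
    circle through e with infinitely many colours of W. *)
Lemma finite_circle_rest (q : seq En) A B C : T A != T B -> T A != T C -> T B != T C ->
  (forall z, conc A B C z -> T z \in q) -> infinitely_many (fun x => ~~ conc (T A) (T B) (T C) x) ->
  exists2 W, \dim W = 3 & forall w, ~~ conc (T A) (T B) (T C) (T w) -> inb W (T w).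
Proof.
move=> ab ac bc fq inf.
pose Q d (fg : En * En) x := [/\ fg.1 != fg.2, conc (T A) (T B) (T C) fg.1,
  conc (T A) (T B) (T C) fg.2 & conc d x fg.1 fg.2].
pose ks := [seq (f, g) | f <- q, g <- q].
have cov w w' : ~~ conc (T A) (T B) (T C) (T w) -> ~~ conc (T A) (T B) (T C) (T w') -> T w != T w' ->
    exists2 k, k \in ks & Q (T w) k (T w').
  move=> o o' ww'; have [z [z' [Cz Cz' nz K]]] := moved_pair HT ab ac bc o o' ww' fq.
  exists (T z, T z'); first by apply/allpairsP; exists (T z, T z'); split => //=; exact: fq.
  by split=> //; apply: HT.
have dQ d fg : ~~ conc (T A) (T B) (T C) d -> (exists x, Q d fg x) -> d != fg.1 /\ d != fg.2.
  by move=> o [x [_ c1 c2 _]]; split; apply: contraNneq o => ->.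
have [d od _] := inf [::].
have inf1 : infinitely_many (fun x => ~~ conc (T A) (T B) (T C) x /\ x != T d).
  move=> s; have [w ow] := inf (T d :: s); rewrite inE negb_or => /andP[n1 n2]; by exists w.
have [|[f g] kin inf2] := infinite_pigeonhole (ks := ks) (Q := Q (T d)) inf1.
  by move=> w [ow nw]; apply: cov => //; rewrite eq_sym.
have [w0 [_ Q0] _] := inf2 [::].
have [df dg] := dQ _ _ od (ex_intro _ _ Q0).
have fg : f != g by case: Q0.
pose W := span3 (T d) f g; have dW : \dim W = 3 by exact: dim_span3.
have inW x : Q (T d) (f, g) x -> inb W x.
  by case=> _ _ _ /= K; rewrite -conc_span //; conc_by K.
exists W => // e oe; apply: contrapT => /negP nW.
have inf3 : infinitely_many (fun x => ~~ conc (T A) (T B) (T C) x /\ inb W x).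
  by move=> s; have [w [[ow _] Qw] ws] := inf2 s; exists w => //; split => //; exact: inW.
have [|[f' g'] kin' inf4] := infinite_pigeonhole (ks := ks) (Q := Q (T e)) inf3.
  by move=> w [ow inw]; apply: cov => //; apply: contraNneq nW => ->.
have [w1 [_ Q1] _] := inf4 [::].
have [ef eg] := dQ _ _ oe (ex_intro _ _ Q1).
have fg' : f' != g' by case: Q1.
have dW' : \dim (span3 (T e) f' g') = 3 by exact: dim_span3.
have EW : W = span3 (T e) f' g'.
  apply: (infinite_block inf4 dW dW') => w [[_ i] [_ _ _ /= K]]; first by [].
  by rewrite -conc_span //; conc_by K.
by move: nW; rewrite EW inb1.
Qed.

(** Let c and c2 be colours off the block W of [finite_circle_rest]. For d1, d2
    in W, the circle through c, d1, d2 has finitely many colours, since its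
    block meets W and the block of the given circle in at most two points each.
    Hence [finite_circle_rest], applied to it, yields the same W and shows that
    c2 is on that circle. With d2 varying, the block of c, c2 and d1 becomes W.
    *)
Lemma finite_circle_not_many (q : seq En) A B C : T A != T B -> T A != T C -> T B != T C ->
  (forall z, conc A B C z -> T z \in q) -> ~ infinitely_many (fun x => ~~ conc (T A) (T B) (T C) x).
Proof.
move=> ab ac bc fq inf.
have [W dW HW] := finite_circle_rest ab ac bc fq inf.
pose off x := ~~ conc (T A) (T B) (T C) x.
have [x1 [x2 [x3 [o1 o2 o3 [n12 n13 n23]]]]] := infinite_three inf.
have W123 s : conc (T x1) (T x2) (T x3) s = inb W s by apply: inb_conc => //; exact: HW.
have [c [c2 [cc2]]] := G n12 n13 n23; rewrite !W123 => nc nc2.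
have key (d1 d2 : E2) : off (T d1) -> off (T d2) -> T d1 != T d2 -> conc (T c) (T d1) (T d2) (T c2).
  move=> od1 od2 d12; apply: contrapT => /negP no.
  have cd1 : T c != T d1 by apply: contraNneq nc => ->; exact: HW.
  have cd2 : T c != T d2 by apply: contraNneq nc => ->; exact: HW.
  pose W3 := span3 (T c) (T d1) (T d2); have dW3 : \dim W3 = 3 by exact: dim_span3.
  have W3W x : inb W3 x -> inb W x -> x \in [:: T d1; T d2].
    move=> i3 i; rewrite !inE; apply: contraT; rewrite negb_or => /andP[m1 m2].
    have E : W3 = W.
      rewrite eq_sym in m1; rewrite eq_sym in m2.
      by apply: (block_eq dW3 dW d12 m1 m2); rewrite /W3 ?inb2 ?inb3 ?HW.
    by move: nc; rewrite -E inb1.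
  have [q3 Hq3] : exists q3 : seq En, forall z, inb W3 (T z) -> T z \in q3.
    have [[w0 [wc i0 j0]]|nw] := pselect (exists w0, [/\ T w0 != T c, inb W3 (T w0) & ~~ off (T w0)]).
      exists [:: T d1; T d2; T c; T w0] => z iz.
      have [oz|noz] := boolP (off (T z)).
        by have := W3W _ iz (HW _ oz); rewrite !inE => /orP[] ->; rewrite ?orbT.
      rewrite !inE; apply: contraT; rewrite !negb_or => /and4P[_ _ z1 z2].
      have E : W3 = span3 (T A) (T B) (T C).
        have z12 : T c != T w0 by rewrite eq_sym.
        rewrite eq_sym in z1; rewrite eq_sym in z2.
        apply: (block_eq dW3 _ z12 z1 z2); rewrite ?inb1 //; first exact: dim_span3.
        - rewrite -conc_span //; apply: contrapT => /negP oc; by rewrite HW in nc.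
        - by rewrite -conc_span //; move: j0; rewrite negbK.
        - by rewrite -conc_span //; move: noz; rewrite negbK.
      by move: od1; rewrite /off conc_span // -E inb2.
    exists [:: T d1; T d2; T c] => z iz.
    have [oz|noz] := boolP (off (T z)).
      by have := W3W _ iz (HW _ oz); rewrite !inE => /orP[] ->; rewrite ?orbT.
    rewrite !inE; have [->|zc] := eqVneq (T z) (T c); first by rewrite !orbT.
    by case: nw; exists z.
  have Hq3' z : conc c d1 d2 z -> T z \in q3 by move/HT; rewrite conc_span //; exact: Hq3.
  have sub x : off x -> x \notin [:: T d1; T d2] -> (exists w, x = T w) -> ~~ conc (T c) (T d1) (T d2) x.
    move=> ox nx [w E]; rewrite conc_span //; apply: contra nx => i3; apply: W3W => //.
    by rewrite E HW // -E.
  have inf3 : infinitely_many (fun x => ~~ conc (T c) (T d1) (T d2) x).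
    move=> s; have [w ow] := inf (T d1 :: T d2 :: s); rewrite !inE !negb_or => /and3P[m1 m2 ms].
    exists w => //; apply: sub => //; last by exists w.
    by rewrite !inE negb_or m1.
  have [W4 dW4 HW4] := finite_circle_rest cd1 cd2 d12 Hq3' inf3.
  have inf5 : infinitely_many (fun x => off x /\ x \notin [:: T d1; T d2]).
    move=> s; have [w ow] := inf (T d1 :: T d2 :: s); rewrite !inE !negb_or => /and3P[m1 m2 ms].
    by exists w => //; split => //; rewrite !inE negb_or m1.
  have E : W = W4.
    apply: (infinite_block inf5 dW dW4) => w [ow nw]; first exact: HW.
    by apply: HW4; apply: sub => //; exists w.
  by move: nc2; rewrite E HW4.
have cx x : off (T x) -> T c != T x /\ T c2 != T x.
  by move=> ox; split; [apply: contraNneq nc|apply: contraNneq nc2] => ->; exact: HW.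
have [m1 m1'] := cx _ o1.
have K2 := key _ _ o1 o2 n12; have K3 := key _ _ o1 o3 n13.
have E : span3 (T c) (T c2) (T x1) = W.
  have dS : \dim (span3 (T c) (T c2) (T x1)) = 3 by exact: dim_span3.
  apply: (block_eq dS dW n12 n13 n23); rewrite ?HW ?inb3 // -conc_span //.
  - by conc_by K2.
  - by conc_by K3.
by move: nc; rewrite -E inb1.
Qed.

(** If the circle had finitely many colours, finitely many colours would lie off
    its block by [finite_circle_not_many]. Then the circle through A, B and a
    point D of one of them has finitely many colours too, because the two blocks
    share only two colours, and infinitely many colours lie off its block. *)
Theorem circle_infinite (A B C : E2) (q : seq En) : infinitely_many (fun _ => True) ->
  T A != T B -> T A != T C -> T B != T C -> exists2 z, conc A B C z & T z \notin q.
Proof.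
move=> inf ab ac bc; apply: contrapT => nz.
have fq z : conc A B C z -> T z \in q.
  by move=> Cz; apply: contrapT => /negP zq; apply: nz; exists z.
have [M|fin] := pselect (infinitely_many (fun x => ~~ conc (T A) (T B) (T C) x)).
  exact: (finite_circle_not_many ab ac bc fq M).
have [s Hs] : exists s : seq En, forall w, ~~ conc (T A) (T B) (T C) (T w) -> T w \in s.
  apply: contrapT => ns; apply: fin => s; apply: contrapT => nw; apply: ns; exists s => w ow.
  by apply: contrapT => /negP ws; apply: nw; exists w.
have [D Da nD] := general_avoid (T A) G ab ac bc.
have ad : T A != T D by rewrite eq_sym.
have bd : T B != T D.
  by apply: contraNneq nD => <-; have K := conc_dup (T B) (T A) (T C); conc_by K.
pose W := span3 (T A) (T B) (T D); have dW : \dim W = 3 by exact: dim_span3.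
have two w : inb W (T w) -> conc (T A) (T B) (T C) (T w) -> T w \in [:: T A; T B].
  move=> iw Cw; rewrite !inE; apply: contraT; rewrite negb_or !(eq_sym (T w)) => /andP[m1 m2].
  move/negP: nD; case; rewrite (conc_span _ ab ac bc); rewrite (conc_span _ ab ac bc) in Cw.
  have -> : span3 (T A) (T B) (T C) = W.
    by apply: (block_eq (dim_span3 ab ac bc) dW ab m1 m2); rewrite /W ?inb1 ?inb2.
  exact: inb3.
apply: (@finite_circle_not_many (T A :: T B :: s) A B D ab ad bd).
  move=> z /HT; rewrite conc_span // => iz.
  have [Cz|nCz] := boolP (conc (T A) (T B) (T C) (T z)).
    by have := two _ iz Cz; rewrite !inE => /orP[] ->; rewrite ?orbT.
  by rewrite !inE Hs // !orbT.
move=> s'; have [w _] := inf (T A :: T B :: s ++ s').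
rewrite !inE mem_cat !negb_or => /and4P[m1 m2 ms ms']; exists w => //.
rewrite conc_span //; apply/negP => iw.
have Cw : conc (T A) (T B) (T C) (T w) by apply: contraT => /Hs; rewrite (negbTE ms).
by have := two _ iw Cw; rewrite !inE (negbTE m1) (negbTE m2).
Qed.
End InfiniteImage.

(** * Real places along lines *)

Section Good.
Variables (R : realType) (n : nat).
Local Notation E2 := (Rinfty R 2).
Local Notation En := (Rinfty R n).
Implicit Types (T : E2 -> En).

(** The properties of [T] that survive the composition with Moebius maps on both
    sides. *)
Record good T : Prop := Good {
  gd_conc : conc_preserving T;
  gd_gen : general T;
  gd_rich : forall A B C (q : seq En), T A != T B -> T A != T C -> T B != T C ->
    exists2 z, conc A B C z & T z \notin q }.

Lemma good_pre T phi : good T -> moeb phi -> good (T \o phi).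
Proof.
move=> [h1 h2 h3] mp; have [psi [mpsi K1 K2]] := moeb_inv mp; split.
- exact: conc_preserving_moeb.
- move=> a b c ab ac bc; have [w [w' H]] := h2 _ _ _ ab ac bc.
  by exists (psi w), (psi w'); rewrite /= !K2.
- move=> A B C q ab ac bc; have [z Cz nz] := h3 _ _ _ q ab ac bc.
  exists (psi z); last by rewrite /= K2.
  by have := moeb_conc mpsi Cz; rewrite !K1.
Qed.

Lemma good_post T phi : good T -> moeb phi -> good (phi \o T).
Proof.
move=> [h1 h2 h3] mp; have [psi [mpsi K1 K2]] := moeb_inv mp; have inj := can_inj K1; split.
- by move=> a b c d /h1; exact: moeb_conc.
- move=> a b c ab ac bc.
  have inj' := can_inj K2.
  have [|||w [w' [nw C1 C2]]] := h2 (psi a) (psi b) (psi c); rewrite ?(inj_eq inj') //.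
  exists w, w'; split; first by rewrite /= (inj_eq inj).
    by apply: contra C1 => /(moeb_conc mpsi); rewrite K1.
  by apply: contra C2 => /(moeb_conc mpsi); rewrite K1.
- move=> A B C q; rewrite /= !(inj_eq inj) => ab ac bc.
  have [z Cz nz] := h3 _ _ _ (map psi q) ab ac bc; exists z => //.
  by apply: contra nz => zq; rewrite -(K1 (T z)) map_f.
Qed.

Lemma moeb_line m (u A B : 'rV[R]_m) : dot u u = 1 -> A != B ->
  exists phi : Rinfty R m -> Rinfty R m,
  [/\ moeb phi, phi None = None & forall t, phi (Some (t *: u)) = Some (A + t *: (B - A))].
Proof.
move=> u1 AB; have d0 : B - A != 0 by rewrite subr_eq0 eq_sym.
pose k := enorm (B - A); have kp : 0 < k by rewrite enorm_gt0.
have k0 : k != 0 by rewrite gt_eqF.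
pose v := k^-1 *: (B - A).
have v1 : dot v v = 1 by rewrite dotZl dotZr -enorm2 -/k; field.
have [rho [mrho rN rt _]] := moeb_rotate (etrans u1 (esym v1)).
exists (omap (fun x => x + A) \o (omap (fun x => k *: x) \o rho)); split.
- apply: moeb_comp (moeb_translate _) _; exact: moeb_comp (moeb_scale _ kp) mrho.
- by rewrite /= rN.
- move=> t; rewrite /= rt /=; congr Some; rewrite addrC; congr (_ + _).
  by rewrite /v !scalerA mulrAC mulfV // mul1r.
Qed.

(** [swap_hom], for the given line and a line through 0 and a point D whose
    colour is off the block of the former; the relations [swap_rel] come from
    the power of a point in both spaces. *)
Lemma line_mult_at0 T (u : 'rV[R]_n) (f : R -> option R) : good T -> T None = None ->
  T (ax 0) = Some 0 -> dot u u = 1 -> (forall x, T (ax x) = omap (fun t => t *: u) (f x)) ->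
  forall x y z a b c, f x = Some a -> f y = Some b -> f z = Some c ->
  a != 0 -> b != 0 -> c != 0 -> f (x * y / z) = Some (a * b / c).
Proof.
move=> gT TN T0 u1 fE x y z a b c fx fy fz a0 b0 c0.
have u0 : u != 0 by rewrite -dot_eq0 u1 oner_eq0.
have inju s t : s *: u = t *: u -> s = t.
  by move/eqP; rewrite -subr_eq0 -scalerBl scaler_eq0 (negbTE u0) orbF subr_eq0 => /eqP.
pose cv (o : option R) := odflt 0 o; pose F x := cv (f x).
have f0 : f 0 = Some 0.
  have := fE 0; rewrite T0; case: (f 0) => [t [E]|//].
  by congr Some; apply: inju; rewrite -E scale0r.
have N1 : T None != T (ax 0) by rewrite TN T0.
have N2 : T None != T (ax x) by rewrite TN fE fx.
have N3 : T (ax 0) != T (ax x).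
  rewrite T0 fE fx /=; apply: contra_neq a0 => -[E]; apply: inju; by rewrite -E scale0r.
(* the second line passes through D *)
have [[D|] nDa nD] := general_avoid None (gd_gen gT) N1 N2 N3; last first.
  by case/negP: nDa; rewrite TN.
move: nD; rewrite TN T0 fE fx /= => nD.
case ED : (T (Some D)) nDa nD => [d|] // _ nD.
have ind s t : s *: u + t *: d = 0 -> s = 0 /\ t = 0.
  move=> E; have t0 : t = 0.
    apply/eqP; apply: contraNT nD => t0.
    have -> : d = ((- s / t) / a) *: (a *: u).
      rewrite scalerA divfK //; move/eqP: E; rewrite addrC addr_eq0 => /eqP E.
      by rewrite -[d](scalerK t0) E -scaleNr scalerA mulrC.
    rewrite -{1}[a *: u]scale1r; exact: conc_ray.
  split => //; move: E; rewrite t0 scale0r addr0 => /eqP.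
  by rewrite scaler_eq0 (negbTE u0) orbF => /eqP.
have d0 : d != 0 by apply: contra_neq (oner_neq0 R) => E; have [|_ ->] := ind 0 1; first by rewrite E scale0r scaler0 addr0.
have D0 : D != 0 by apply: contra_neq d0 => E; move: ED; rewrite E -ax0 T0 => -[].
have eD : enorm D != 0 by rewrite gt_eqF // enorm_gt0.
have ed : enorm d != 0 by rewrite gt_eqF // enorm_gt0.
pose v := (enorm D)^-1 *: D; pose w := (enorm d)^-1 *: d.
have v1 : dot v v = 1 by rewrite dotZl dotZr -enorm2; field.
have w1 : dot w w = 1 by rewrite dotZl dotZr -enorm2; field.
have Dv : D = enorm D *: v by rewrite scalerA divff // scale1r.
have dw : d = enorm d *: w by rewrite scalerA divff // scale1r.
have indw s t : s *: u + t *: w = 0 -> s = 0 /\ t = 0.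
  rewrite scalerA => /ind[-> /eqP]; rewrite mulf_eq0 invr_eq0 (negbTE ed) orbF => /eqP ->.
  by [].
have w0 : w != 0 by rewrite -dot_eq0 w1 oner_eq0.
have injw s t : s *: w = t *: w -> s = t.
  by move/eqP; rewrite -subr_eq0 -scalerBl scaler_eq0 (negbTE w0) orbF subr_eq0 => /eqP.
have gex y0 : exists o, T (Some (y0 *: v)) = omap (fun t => t *: w) o.
  have C : conc None (Some 0) (Some D) (Some (y0 *: v)) by rewrite Dv; exact: conc_ray.
  have := gd_conc gT C; rewrite TN -ax0 T0 ED => C'.
  have d0' : 0 != d by rewrite eq_sym.
  case: (conc_line_inv d0' C') => [->|[t ->]]; first by exists None.
  by exists (Some (t * enorm d)); rewrite add0r subr0 /= -scalerA -dw.
have [g gE] := choice gex; pose H y0 := cv (g y0).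
have g0 : g 0 = Some 0.
  have := gE 0; rewrite scale0r -ax0 T0; case: (g 0) => [t [E]|//].
  by congr Some; apply: injw; rewrite -E scale0r.
have cvP (o : option R) : cv o != 0 -> o = Some (cv o) by case: o => //=; rewrite /cv /= eqxx.
pose W1 := span3 None (Some 0) (Some u) : {vspace 'rV[R]_n * R^o * R^o}.
pose W2 := span3 None (Some 0) (Some w) : {vspace 'rV[R]_n * R^o * R^o}.
have dim (v0 : 'rV[R]_n) : v0 != 0 -> \dim (span3 None (Some 0) (Some v0) : {vspace 'rV[R]_n * R^o * R^o}) = 3.
  by move=> v00; apply: dim_span3 => //; apply: contra_neq v00 => -[].
have dW1 : \dim W1 = 3 by exact: dim. 
have dW2 : \dim W2 = 3 by exact: dim.
have inW (v0 : 'rV[R]_n) t : v0 != 0 -> inb (span3 None (Some 0) (Some v0)) (Some (t *: v0)).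
  move=> v00; rewrite -conc_span //; last by apply: contra_neq v00 => -[].
  rewrite -{1}[v0]scale1r; exact: conc_ray.
have inWi (v0 : 'rV[R]_n) s : v0 != 0 -> inb (span3 None (Some 0) (Some v0)) (Some s) -> exists t, s = t *: v0.
  move=> v00; rewrite -conc_span //; last by apply: contra_neq v00 => -[].
  rewrite eq_sym in v00.
  by case/(conc_line3_inv v00) => t ->; exists t; rewrite add0r subr0.
have fW1 x0 : inb W1 (T (ax x0)) by rewrite fE; case: (f x0) => [t|]; [exact: inW|exact: inb1].
have gW2 y0 : inb W2 (T (Some (y0 *: v))) by rewrite gE; case: (g y0) => [t|]; [exact: inW|exact: inb1].
have fW2 x0 : ~~ inb W2 (T (ax x0)) = (F x0 != 0).
  rewrite fE /F; case: (f x0) => [t|] /=; last by rewrite inb1 eqxx.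
  congr (~~ _); apply/idP/eqP => [/(inWi _ _ w0)[s E]|->]; last by rewrite scale0r inb2.
  by have [] := indw t (- s); rewrite // scaleNr E subrr.
have gW1 y0 : ~~ inb W1 (T (Some (y0 *: v))) = (H y0 != 0).
  rewrite gE /H; case: (g y0) => [t|] /=; last by rewrite inb1 eqxx.
  congr (~~ _); apply/idP/eqP => [/(inWi _ _ u0)[s E]|->]; last by rewrite scale0r inb2.
  by have [] := indw (- s) t; rewrite // scaleNr E addrC subrr.
have FE x0 : F x0 != 0 -> T (ax x0) = Some (F x0 *: u) by move/cvP => E; rewrite fE E.
have HE y0 : H y0 != 0 -> T (Some (y0 *: v)) = Some (H y0 *: w) by move/cvP => E; rewrite gE E.
have K x1 x2 y1 y2 : x1 * x2 = y1 * y2 ->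
    conc (T (ax x1)) (T (ax x2)) (T (Some (y1 *: v))) (T (Some (y2 *: v))).
  move=> E; apply: (gd_conc gT); rewrite !axE; apply: conc_power => //; by rewrite pt10 v1.
have K' y1 y2 x1 x2 : y1 * y2 = x1 * x2 ->
    conc (T (Some (y1 *: v))) (T (Some (y2 *: v))) (T (ax x1)) (T (ax x2)).
  by move=> E; rewrite conc_pairs; apply: K.
have f0W2 : inb W2 (T (ax 0)) by rewrite T0 inb2.
have g0W1 : inb W1 (T (Some (0 *: v))) by rewrite scale0r -ax0 T0 inb2.
have sw1 : swap_rel F H.
  move=> x1 x2 y0 F1 F2 n12 Hy.
  have [|||| U C] := two_lines K fW1 gW2 dW1 g0W1 (x1 := x1) (x2 := x2) (y := y0);
    rewrite ?fW2 ?gW1 //; first by rewrite !FE //; apply: contra_neq n12 => -[/inju].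
  rewrite gW1 in U; split => //.
  move: C; rewrite !FE // !HE // => C.
  have [->|ne] := eqVneq (H y0) (H (x1 * x2 / y0)); first by left.
  by right; rewrite (conc_power_inv u1 w1 indw C).
have sw2 : swap_rel H F.
  move=> y1 y2 x0 F1 F2 n12 Hy.
  have [|||| U C] := two_lines K' gW2 fW1 dW2 f0W2 (x1 := y1) (x2 := y2) (y := x0);
    rewrite ?fW2 ?gW1 //; first by rewrite !HE //; apply: contra_neq n12 => -[/injw].
  rewrite fW2 in U; split => //.
  move: C; rewrite !FE // !HE // => C.
  have [->|ne] := eqVneq (F x0) (F (y1 * y2 / x0)); first by left.
  rewrite conc_pairs in C.
  by right; rewrite (conc_power_inv u1 w1 indw C).
have infv (P : 'rV[R]_2) h (e : 'rV[R]_n) V : P != 0 -> T (Some P) != None -> T (Some P) != Some 0 ->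
    (forall t, exists t', Some (t *: P) = h t') ->
    (forall t, T (h t) = omap (fun t => t *: e) (V t)) -> inf_values (cv \o V).
  move=> P0 TPN TP0 hP hV s; rewrite eq_sym in TPN; rewrite eq_sym in TP0; rewrite eq_sym in P0.
  have [z0] : exists2 z, conc None (ax 0) (Some P) z & T z \notin None :: Some 0 :: [seq Some (t *: e) | t <- s].
    by apply: (gd_rich gT) => //; rewrite ?TN // T0.
  rewrite ax0 => /(conc_line_inv P0)[->|[t ->]]; first by rewrite TN inE eqxx.
  rewrite add0r subr0; have [t' ->] := hP t; rewrite hV !inE !negb_or.
  case EV : (V t') => [r|] //= /andP[r0 rs]; exists t'; rewrite /= EV /=.
    by apply: contra_neq r0 => ->; rewrite scale0r.
  by apply: contra rs => /(map_f (fun t => Some (t *: e))).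
have iF : inf_values F.
  apply: (infv (pt x 0) (fun t => ax t) u f) => //.
  - by apply/eqP; rewrite -pt0 => /pt_inj[E _]; move: a0 fx; rewrite E f0 => + [E']; rewrite E' eqxx.
  - by rewrite -[Some _]/(ax x) -TN eq_sym.
  - by rewrite -[Some _]/(ax x) -T0 eq_sym.
  - by move=> t; exists (t * x); rewrite ptZ mulr0.
have iH : inf_values H.
  apply: (infv D (fun t => Some (t *: v)) w g) => //; rewrite ?ED //.
  by move=> t; exists (t * enorm D); rewrite -scalerA -Dv.
have F0 : F 0 = 0 by rewrite /F f0.
have H0 : H 0 = 0 by rewrite /H g0.
have Fv r k : f r = Some k -> F r = k by rewrite /F => ->.
have := swap_hom F0 H0 sw1 sw2 iF iH (x1 := x) (x2 := y) (x3 := z).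
rewrite (Fv _ _ fx) (Fv _ _ fy) (Fv _ _ fz) => /(_ a0 b0 c0) E.
have /cvP : F (x * y / z) != 0 by rewrite E !mulf_neq0 ?invr_neq0.
by rewrite -/(F _) E.
Qed.

(** [line_mult_at0], after translations that move the pole and its colour to 0.
    *)
Lemma mult_finite_poles T (u : 'rV[R]_n) (f : R -> option R) : good T -> T None = None ->
  dot u u = 1 -> (forall x, T (ax x) = omap (fun t => t *: u) (f x)) -> mult_at_poles f.
Proof.
move=> gT TN u1 fE c x y z kc kx ky kz hc hx hy hz nx ny nz.
pose ph : E2 -> E2 := omap (fun z => z + pt c 0).
pose ps : En -> En := omap (fun z => z + (- kc *: u)).
have gT' : good (ps \o (T \o ph)).
  by apply: good_post (good_pre gT _) _; exact: moeb_translate.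
have fE' t : (ps \o (T \o ph)) (ax t) = omap (fun s => s *: u) (omap (fun s => s - kc) (f (t + c))).
  rewrite /= ptD addr0 -[Some _]/(ax (t + c)) fE; case: (f _) => //= s.
  by rewrite scalerBl scaleNr.
have T0' : (ps \o (T \o ph)) (ax 0) = Some 0.
  by rewrite fE' add0r hc /= subrr scale0r.
have N' : (ps \o (T \o ph)) None = None by rewrite /= TN.
have fE2 t k : f t = Some k -> omap (fun s => s - kc) (f (t - c + c)) = Some (k - kc).
  by rewrite subrK => ->.
have := line_mult_at0 gT' N' T0' u1 fE' (fE2 _ _ hx) (fE2 _ _ hy) (fE2 _ _ hz).
rewrite !subr_eq0 => /(_ nx ny nz).
rewrite [_ / _ + c]addrC; case: (f _) => //= s [E]; congr Some.
by rewrite -E addrC subrK.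
Qed.

(** The dual place describes the colours after inversions of both spaces. *)
Lemma line_id T (u : 'rV[R]_n) : good T -> T None = None -> T (ax 0) = Some 0 ->
  T (ax 1) = Some u -> dot u u = 1 -> forall x, T (ax x) = Some (x *: u).
Proof.
move=> gT TN T0 T1 u1.
have u0 : u != 0 by rewrite -dot_eq0 u1 oner_eq0.
have inju s t : s *: u = t *: u -> s = t.
  by move/eqP; rewrite -subr_eq0 -scalerBl scaler_eq0 (negbTE u0) orbF subr_eq0 => /eqP.
have fex x : exists o, T (ax x) = omap (fun t => t *: u) o.
  have C : conc None (ax 0) (ax 1) (ax x) by apply/axis_conc; right; exists x.
  have := gd_conc gT C; rewrite TN T0 T1 => C'.
  have u0' : 0 != u by rewrite eq_sym.
  case: (conc_line_inv u0' C') => [->|[t ->]]; first by exists None.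
  by exists (Some t); rewrite add0r subr0.
have [f fE] := choice fex.
have f0 : f 0 = Some 0.
  have := fE 0; rewrite T0; case: (f 0) => [t [E]|//].
  by congr Some; apply: inju; rewrite -E scale0r.
have f1 : f 1 = Some 1.
  have := fE 1; rewrite T1; case: (f 1) => [t [E]|//].
  by congr Some; apply: inju; rewrite -E scale1r.
have fH := mult_finite_poles gT TN u1 fE.
have N1 : T None != T (ax 0) by rewrite TN T0.
have N2 : T None != T (ax 1) by rewrite TN T1.
have N3 : T (ax 0) != T (ax 1) by rewrite T0 T1; apply: contra_neq u0 => -[].
have finf : inf_range f.
  move=> s; have [z /axis_conc[->|[x ->]]] := gd_rich gT (None :: [seq Some (t *: u) | t <- s]) N1 N2 N3.
    by rewrite TN inE eqxx.
  rewrite fE inE negb_or; case E : (f x) => [k|] //= ks; exists x, k; split => //.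
  by apply: contra ks => /(map_f (fun t => Some (t *: u))).
have dH : mult_at_poles (dual_place f).
  pose i2 : E2 -> E2 := inversion 0 1; pose i_n : En -> En := inversion 0 1.
  have gI : good (i_n \o (T \o i2)).
    by apply: good_post (good_pre gT _) _; exact: moeb_inversion.
  have i2x x : x != 0 -> i2 (ax x) = ax x^-1.
    move=> x0; rewrite /i2 /ax inversion1; last first.
      by rewrite -pt0; apply: contra_neq x0 => /pt_inj[].
    rewrite add0r subr0 dot_pt ptZ !mulr0 addr0; congr (Some (pt _ _)); by field.
  apply: (mult_finite_poles gI _ u1).
    by rewrite /= -ax0 T0 /= eqxx.
  move=> x; rewrite /dual_place; have [->|x0] := eqVneq x 0.
    by rewrite /= scale0r /i2 /ax pt0 /= eqxx TN.
  rewrite -[LHS]/(i_n (T (i2 (ax x)))) i2x // fE; case: (f x^-1) => [k|] /=; last by rewrite scale0r.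
  have [->|k0] := eqVneq k 0; first by rewrite scale0r eqxx.
  rewrite -[LHS]/(inversion 0 1 (Some (k *: u))) inversion1; last by rewrite scaler_eq0 negb_or k0.
  rewrite add0r subr0 dotZl dotZr u1 mulr1 scalerA /=; congr (Some (_ *: _)); by field.
by move=> x; rewrite fE (place_id f0 f1 fH finf dH).
Qed.

Lemma line_affine T A B (a b : 'rV[R]_n) : good T -> T None = None -> T (Some A) = Some a ->
  T (Some B) = Some b -> a != b -> forall t, T (Some (A + t *: (B - A))) = Some (a + t *: (b - a)).
Proof.
move=> gT TN TA TB ab t.
have AB : A != B by apply: contra_neq ab => E; move: TA; rewrite E TB => -[].
have ba0 : b - a != 0 by rewrite subr_eq0 eq_sym.
have k0 : enorm (b - a) != 0 by rewrite gt_eqF // enorm_gt0.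
pose u := (enorm (b - a))^-1 *: (b - a).
have u1 : dot u u = 1 by rewrite dotZl dotZr -enorm2; field.
have [ph [mph phN phE]] := moeb_line (pt10 R) AB.
have [rh [mrh rhN rhE]] := moeb_line u1 ab.
have [ps [mps K1 K2]] := moeb_inv mrh.
have gT' : good (ps \o (T \o ph)) by apply: good_post (good_pre gT mph) mps.
have rh0 : rh (Some 0) = Some a by have := rhE 0; rewrite !scale0r addr0.
have rh1 : rh (Some u) = Some b by have := rhE 1; rewrite !scale1r addrC subrK.
have H := line_id gT' (u := u) _ _ _ u1.
have := H _ _ _ t; rewrite /= -rhE -phE /= -axE => E.
rewrite -(K2 (T _)) E //.
- by rewrite phN TN -rhN K1.
- by rewrite axE phE scale0r addr0 TA -rh0 K1.
- by rewrite axE phE scale1r addrC subrK TB -rh1 K1.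
Qed.
End Good.

(** * The plane is mapped by a similarity *)

Section Global.
Variables (R : realType) (n : nat).
Local Notation E2 := (Rinfty R 2).
Local Notation En := (Rinfty R n).
Implicit Types (T : E2 -> En).

Lemma affine_coords T : (0 < n)%N -> good T -> T None = None -> exists A B C a b c,
  [/\ T (Some A) = Some a, T (Some B) = Some b, T (Some C) = Some c &
   forall s t : R, s *: (b - a) + t *: (c - a) = 0 -> s = 0 /\ t = 0].
Proof.
move=> n0 gT TN; have N0 := gd_gen gT.
have one0 : (0 : 'rV[R]_n) != const_mx 1.
  apply/eqP => /rowP /(_ (Ordinal n0)); rewrite !mxE => /eqP.
  by rewrite eq_sym oner_eq0.
have [|||A0 [B0 [AB nA nB]]] := N0 None (Some 0) (Some (const_mx 1)) => //.
have fin w0 : ~~ conc None (Some 0) (Some (const_mx 1)) (T w0) -> exists W w, w0 = Some W /\ T w0 = Some w.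
  move=> nw; case Ew : (T w0) nw => [w|] nw; last first.
    by case/negP: nw; rewrite -conc_rot conc_dup.
  by case: w0 Ew => [W|] Ew; [exists W, w|rewrite TN in Ew].
have [A [a [EA Ta]]] := fin _ nA; have [B [b [EB Tb]]] := fin _ nB.
have ab : a != b by apply: contra_neq AB => E; rewrite Ta Tb E.
have [|||C0 Ca nC] := general_avoid None (gd_gen gT) (a := None) (b := Some a) (c := Some b) => //.
case: C0 Ca nC => [C|] Ca nC; last by rewrite TN in Ca.
case Tc : (T (Some C)) Ca nC => [c|] // _ nC.
exists A, B, C, a, b, c; rewrite -EA -EB; split => // s t E.
have ba : b - a != 0 by rewrite subr_eq0 eq_sym.
have t0 : t = 0.
  apply/eqP; apply: contraNT nC => t0; have -> : c = a + (- s / t) *: (b - a).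
    rewrite mulrC -scalerA scaleNr; move/eqP: E; rewrite addrC addr_eq0 => /eqP <-.
    by rewrite scalerK // addrC subrK.
  exact: conc_line.
by split => //; move: E; rewrite t0 scale0r addr0 => /eqP; rewrite scaler_eq0 (negbTE ba) orbF => /eqP.
Qed.

(** T is known on the sides of the triangle A B C, and through every point
    passes a line that meets two of these sides in different points. *)
Lemma affine_global T : (0 < n)%N -> good T -> T None = None -> exists b e w : 'rV[R]_n,
  (forall x y, T (Some (pt x y)) = Some (b + x *: e + y *: w)) /\
  (forall s t : R, s *: e + t *: w = 0 -> s = 0 /\ t = 0).
Proof.
move=> n0 gT TN; have [A [B [C [a [b [c [TA TB TC ind]]]]]]] := affine_coords n0 gT TN.
pose U := B - A; pose V := C - A; pose u := b - a; pose v := c - a.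
have indP s t s' t' : a + s *: u + t *: v = a + s' *: u + t' *: v -> s = s' /\ t = t'.
  move=> E; have [] := ind (s - s') (t - t').
    have : (a + s *: u + t *: v) - (a + s' *: u + t' *: v) = 0 by rewrite E subrr.
    rewrite !scalerBl -/u -/v => <-; apply/rowP => i; rewrite !mxE; ring.
  by move=> /eqP; rewrite subr_eq0 => /eqP -> /eqP; rewrite subr_eq0 => /eqP.
pose known s t := T (Some (A + s *: U + t *: V)) = Some (a + s *: u + t *: v).
have line s t s' t' r : known s t -> known s' t' -> (s != s') || (t != t') ->
    known (s + r * (s' - s)) (t + r * (t' - t)).
  move=> k k' ne; have ne' : a + s *: u + t *: v != a + s' *: u + t' *: v.
    by apply: contraTneq ne => /indP[-> ->]; rewrite !eqxx.
  have := line_affine gT TN k k' ne' r; rewrite /known => E.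
  have -> : A + (s + r * (s' - s)) *: U + (t + r * (t' - t)) *: V =
     A + s *: U + t *: V + r *: (A + s' *: U + t' *: V - (A + s *: U + t *: V)).
    by apply/rowP => i; rewrite !mxE; ring.
  by rewrite E; congr Some; apply/rowP => i; rewrite !mxE; ring.
have k00 : known 0 0 by rewrite /known !scale0r !addr0.
have k10 : known 1 0 by rewrite /known !scale0r !scale1r !addr0 /U /u ![_ + (_ - _)]addrC !subrK.
have k01 : known 0 1 by rewrite /known !scale0r !scale1r !addr0 /V /v ![_ + (_ - _)]addrC !subrK.
have kx s : known s 0.
  have := line 0 0 1 0 s k00 k10; rewrite eq_sym oner_eq0 => /(_ isT).
  by rewrite !subr0 !add0r mulr1 mulr0.
have ky t : known 0 t.
  have := line 0 0 0 1 t k00 k01; rewrite [0 == 1]eq_sym oner_eq0 orbT => /(_ isT).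
  by rewrite !subr0 !add0r mulr1 mulr0.
have all_known s t : known s t.
  have [st|st] := eqVneq (s + t) 0; last first.
    (* on the parallel to B C *)
    have := line _ _ _ _ (t / (s + t)) (kx (s + t)) (ky (s + t)); rewrite st => /(_ isT).
    by congr known; field.
  have Et : t = - s by apply/eqP; rewrite -addr_eq0 addrC st.
  have [s0|s0] := eqVneq s 0; first by rewrite Et s0 oppr0.
  (* (s, - s) is on the line through (s / 2, 0) and (0, s) *)
  have := line _ _ _ _ (-1) (kx (s / 2)) (ky s).
  rewrite mulf_neq0 ?invr_neq0 ?pnatr_eq0 // => /(_ isT).
  by rewrite Et; congr known; field.
have DUV : cross U V != 0.
  have V0 : V != 0.
    apply: contra_neq (oner_neq0 R) => V0; have [|_ ->//] := ind 0 1.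
    have AC : A = C by apply/eqP; rewrite eq_sym -subr_eq0 -/V V0.
    by move: TC; rewrite -AC TA => -[->]; rewrite subrr scaler0 scale0r addr0.
  apply/eqP => /(cross_eq0 V0)[k Ek].
  have ac : a != c.
    apply: contra_neq (oner_neq0 R) => ac; have [|_ ->//] := ind 0 1.
    by rewrite ac subrr scaler0 scale0r addr0.
  have := line_affine gT TN TA TC ac k; rewrite -/V -Ek addrC subrK TB => -[Eb].
  have [|/eqP] := ind 1 (- k); last by rewrite oner_eq0.
  by rewrite Eb [a + _]addrC addrK scale1r scaleNr subrr.
have dec P : exists s t, P = s *: U + t *: V.
  have [s [t E]] := lines_meet 0 P DUV; exists s, (- t).
  by rewrite add0r in E; rewrite E scaleNr addrK.
have [s0 [t0 E0]] := dec (- A).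
have [s1 [t1 E1]] := dec (pt 1 0); have [s2 [t2 E2']] := dec (pt 0 1).
exists (a + s0 *: u + t0 *: v), (s1 *: u + t1 *: v), (s2 *: u + t2 *: v); split.
  move=> x y; have := all_known (s0 + x * s1 + y * s2) (t0 + x * t1 + y * t2).
  rewrite /known; have -> : A + (s0 + x * s1 + y * s2) *: U + (t0 + x * t1 + y * t2) *: V = pt x y.
    have -> : pt x y = x *: pt 1 0 + y *: pt 0 1 by rewrite !ptZ ptD; congr (pt _ _); ring.
    rewrite E1 E2' -[A]opprK E0; apply/rowP => i; rewrite !mxE; ring.
  by move=> ->; congr Some; apply/rowP => i; rewrite !mxE; ring.
move=> s t E; have [|H1 H2] := ind (s * s1 + t * s2) (s * t1 + t * t2).
  rewrite -/u -/v -[RHS]E; apply/rowP => i; rewrite !mxE; ring.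
have : s *: pt 1 0 + t *: pt 0 1 = pt 0 0.
  rewrite E1 E2' pt0; transitivity ((s * s1 + t * s2) *: U + (s * t1 + t * t2) *: V).
    by apply/rowP => i; rewrite !mxE; ring.
  by rewrite H1 H2 !scale0r addr0.
by rewrite !ptZ ptD => /pt_inj[]; rewrite !mulr1 !mulr0 addr0 add0r.
Qed.

(** The power of 0 is - |u|^2 and also - |v|^2. *)
Lemma conc_symmetric (u v : 'rV[R]_n) : (forall s t : R, s *: u + t *: v = 0 -> s = 0 /\ t = 0) ->
  conc (Some u) (Some (- u)) (Some v) (Some (- v)) -> dot u u = dot v v.
Proof.
move=> ind C.
have u0 : u != 0.
  apply: contra_neq (oner_neq0 R) => u0; have [|->//] := ind 1 0.
  by rewrite u0 scaler0 scale0r addr0.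
have v0 : v != 0.
  apply: contra_neq (oner_neq0 R) => v0; have [|_ ->//] := ind 0 1.
  by rewrite v0 scaler0 scale0r addr0.
have eu : 0 < enorm u by rewrite enorm_gt0. have ev : 0 < enorm v by rewrite enorm_gt0.
have eu0 : enorm u != 0 by rewrite gt_eqF. have ev0 : enorm v != 0 by rewrite gt_eqF.
have unit (x : 'rV[R]_n) : enorm x != 0 -> dot ((enorm x)^-1 *: x) ((enorm x)^-1 *: x) = 1.
  by move=> x0; rewrite dotZl dotZr -enorm2; field.
have resc (x : 'rV[R]_n) : enorm x != 0 -> x = enorm x *: ((enorm x)^-1 *: x).
  by move=> x0; rewrite scalerA divff // scale1r.
have inv s t : s *: ((enorm u)^-1 *: u) + t *: ((enorm v)^-1 *: v) = 0 -> s = 0 /\ t = 0.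
  rewrite !scalerA => /ind[/eqP + /eqP]; rewrite !mulf_eq0 !invr_eq0 (negbTE eu0) (negbTE ev0) !orbF.
  by move=> /eqP -> /eqP ->.
rewrite (resc u eu0) (resc v ev0) -!scaleNr in C.
have ne (x : R) : 0 < x -> x != - x by move=> x0; rewrite -subr_eq0 opprK -mulr2n mulrn_eq0 /= gt_eqF.
have := conc_power_inv (unit _ eu0) (unit _ ev0) inv C (ne _ eu) (ne _ ev).
by rewrite !mulrN => /oppr_inj; rewrite -!expr2 !enorm2.
Qed.

(** Two diameters of a circle around the origin have concyclic end points, so
    that all points of this circle have images at the same distance from b. *)
Theorem similarity T : (0 < n)%N -> good T -> T None = None -> exists b e w : 'rV[R]_n,
  [/\ forall x y, T (Some (pt x y)) = Some (b + x *: e + y *: w), e != 0, dot e e = dot w w & dot e w = 0].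
Proof.
move=> n0 gT TN; have [b [e [w [HT ind]]]] := affine_global n0 gT TN.
have e0 : e != 0.
  apply: contra_neq (oner_neq0 R) => e0; have [|->//] := ind 1 0.
  by rewrite e0 scaler0 scale0r addr0.
pose ph : En -> En := omap (fun z => z - b).
have mph : moeb ph by exact: moeb_translate.
have HT' x y : ph (T (Some (pt x y))) = Some (x *: e + y *: w).
  by rewrite HT /=; congr Some; apply/rowP => i; rewrite !mxE; ring.
have sym x y x' y' : x * x + y * y = x' * x' + y' * y' -> x * y' - y * x' != 0 ->
    dot (x *: e + y *: w) (x *: e + y *: w) = dot (x' *: e + y' *: w) (x' *: e + y' *: w).
  move=> E D; apply: conc_symmetric.
    move=> s t; rewrite !scalerDr !scalerA addrACA -!scalerDl => /ind[H1 H2].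
    split; apply/eqP; rewrite -(mulIr_eq0 _ (mulIf D)).
      have -> : s * (x * y' - y * x') = (s * x + t * x') * y' - (s * y + t * y') * x' by ring.
      by rewrite H1 H2 !mul0r subr0.
    have -> : t * (x * y' - y * x') = x * (s * y + t * y') - y * (s * x + t * x') by ring.
    by rewrite H1 H2 !mulr0 subr0.
  have C : conc (Some (pt x y)) (Some (- pt x y)) (Some (pt x' y')) (Some (- pt x' y')).
    have := @conc_power _ _ (pt x y) (pt x' y') 1 (-1) 1 (-1).
    by rewrite !scale1r !scaleN1r !dot_pt => H; apply: H.
  have := moeb_conc mph (gd_conc gT C).
  by rewrite !ptN !HT' !scaleNr -!opprD.
have E1 : dot e e = dot w w.
  have := sym 1 0 0 1; rewrite !scale1r !scale0r addr0 add0r; apply; first by ring.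
  by rewrite !mulr0 mulr1 subr0 oner_eq0.
exists b, e, w; split => //.
(* this point of the unit circle detects the scalar product of e and w *)
have := sym 1 0 (3 / 5) (4 / 5); rewrite scale1r scale0r addr0 => H.
have {}H : dot e e = dot (3 / 5 *: e + 4 / 5 *: w) (3 / 5 *: e + 4 / 5 *: w).
  apply: H; first by field.
  by rewrite mul1r mul0r subr0 mulf_neq0 ?invr_eq0 ?pnatr_eq0.
move: H; rewrite !dotE (dotC w e) -E1; lra.
Qed.
End Global.

(** * Normal form *)

Definition pad (R : realType) k m (x : 'rV[R]_k.+1) : 'rV[R]_m :=
  \row_(j < m) (if (j < k.+1)%N then x 0 (inord j) else 0).

Lemma pad_linear (R : realType) k m : linear (@pad R k m).
Proof. by move=> a x y; apply/rowP => i; rewrite !mxE; case: ifP => _; ring. Qed.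

Lemma dot_pad (R : realType) k m (x y : 'rV[R]_k.+1) : (k < m)%N ->
  dot (pad m x) (pad m y) = dot x y.
Proof.
move=> km; pose F (j : nat) := x 0 (inord j) * y 0 (inord j).
have -> : dot x y = \sum_(i < k.+1) F i.
  by apply: eq_bigr => i _; rewrite /F inord_val.
rewrite (big_ord_widen _ F km) [RHS]big_mkcond; apply: eq_bigr => i _; rewrite !mxE.
by case: ifP; rewrite ?mulr0.
Qed.

Section Standard.
Variables (R : realType) (n : nat).
Local Notation E2 := (Rinfty R 2).
Local Notation En := (Rinfty R n).
Implicit Types (T : E2 -> En).
Local Notation plane_in := (@pad R 1 n).

(** Reflections move the vectors e and w of [similarity], once rescaled, onto
    the first two basis vectors, one after the other; the second reflection
    fixes the first basis vector, which is orthogonal to the two vectors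
    exchanged. *)
Theorem standardize T : (1 < n)%N -> good T ->
  exists psi : En -> En, moeb psi /\ forall z, psi (T z) = omap plane_in z.
Proof.
move=> n1 gT; have n0 : (0 < n)%N by exact: ltnW.
have [p0 [mp0 p0N]] := moeb_to_inf (T None).
have [b [e [w [E1 e0 ew oew]]]] := similarity n0 (good_post gT mp0) p0N.
have ee : 0 < enorm e by rewrite enorm_gt0.
have ee0 : enorm e != 0 by rewrite gt_eqF.
have ei : 0 < (enorm e)^-1 by rewrite invr_gt0.
pose e' := (enorm e)^-1 *: e; pose w' := (enorm e)^-1 *: w.
have e'1 : dot e' e' = 1 by rewrite dotZl dotZr -enorm2; field.
have w'1 : dot w' w' = 1 by rewrite -[RHS]e'1 /e' !(dotZl, dotZr) ew.
have ew' : dot e' w' = 0 by rewrite !(dotZl, dotZr) oew !mulr0.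
pose p1 : En -> En := omap (fun x => (enorm e)^-1 *: x) \o omap (fun x => x - b).
have mp1 : moeb p1 by apply: moeb_comp (moeb_scale _ ei) (moeb_translate _).
pose T2 := p1 \o (p0 \o T).
have T2E x y : T2 (Some (pt x y)) = Some (x *: e' + y *: w').
  rewrite /T2 /= -[p0 _]/((p0 \o T) (Some (pt x y))) E1 /=; congr Some.
  by apply/rowP => i; rewrite !mxE; ring.
pose d0 := plane_in (pt 1 0); pose d1 := plane_in (pt 0 1).
have d00 : dot d0 d0 = 1 by rewrite dot_pad // dot_pt; ring.
have d11 : dot d1 d1 = 1 by rewrite dot_pad // dot_pt; ring.
have d01 : dot d0 d1 = 0 by rewrite dot_pad // dot_pt; ring.
have [r1 [mr1 r1N r1E _]] := moeb_rotate (etrans e'1 (esym d00)).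
have gT3 : good (r1 \o T2) by do !(apply: good_post => //).
have T3N : (r1 \o T2) None = None by rewrite /T2 /= p0N /= r1N.
have [b3 [e3 [w3 [E3 e30 ew3 oew3]]]] := similarity n0 gT3 T3N.
have z3 x : r1 (T2 (Some (pt x 0))) = Some (x *: d0) by rewrite T2E scale0r addr0 r1E.
have b30 : b3 = 0.
  by have := E3 0 0; rewrite /= z3 !scale0r !addr0 => -[].
have e3E : e3 = d0.
  by have := E3 1 0; rewrite /= z3 !scale0r !scale1r addr0 b30 add0r => -[].
rewrite e3E in oew3; rewrite e3E d00 in ew3.
have [r2 [mr2 r2N r2E r2f]] := moeb_rotate (etrans (esym ew3) (esym d11)).
have gT4 : good (r2 \o (r1 \o T2)) by exact: good_post.
have T4N : (r2 \o (r1 \o T2)) None = None by rewrite /T2 /= p0N /= r1N r2N.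
have [b4 [e4 [w4 [E4 _ _ _]]]] := similarity n0 gT4 T4N.
have z4 x : r2 (r1 (T2 (Some (pt x 0)))) = Some (x *: d0) by rewrite z3 r2f.
have b40 : b4 = 0 by have := E4 0 0; rewrite /= z4 !scale0r !addr0 => -[].
have e4E : e4 = d0.
  by have := E4 1 0; rewrite /= z4 !scale0r !scale1r addr0 b40 add0r => -[].
have w4E : w4 = d1.
  have := E4 0 1; rewrite /= -[r1 _]/((r1 \o T2) (Some (pt 0 1))) E3 b30 scale0r !add0r r2E.
  by rewrite scale0r !scale1r b40 !add0r => -[].
exists (r2 \o (r1 \o (p1 \o p0))); split.
  by do !(apply: moeb_comp => //).
case=> [z|]; last exact: T4N.
rewrite (ptE z) /=; rewrite -[LHS]/((r2 \o (r1 \o T2)) (Some (pt (z 0 0) (z 0 1)))) E4 b40 add0r e4E w4E.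
congr Some; apply/rowP => i; rewrite !mxE; case: ifP => _; rewrite ?mulr0 ?addr0 //.
by case: ifP => _; ring.
Qed.
End Standard.

(** * Stereographic projection *)

Section Stereo.
Variables (R : realType) (m : nat).
Local Notation E := (Rinfty R m).
Local Notation S := (sphere R m).
Local Notation V := ('rV[R]_m * R^o * R^o)%type.
Local Notation st := (@stereographic R m).
Implicit Types (x y : S) (X : 'rV[R]_m.+1).

Definition init X : 'rV[R]_m := \row_(i < m) X 0 (widen_ord (leqnSn m) i).
Definition last_coord X : R := X 0 ord_max.

Lemma init_inj X Y : init X = init Y -> last_coord X = last_coord Y -> X = Y.
Proof.
move=> /rowP e1 e2; apply/rowP => i; case: (unliftP ord_max i) => [j ->|-> //].
have := e1 j; rewrite !mxE; have -> : widen_ord (leqnSn m) j = fintype.lift ord_max j => //.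
by apply: ord_inj; rewrite lift_max.
Qed.

Lemma dot_init X : dot X X = dot (init X) (init X) + last_coord X ^+ 2.
Proof.
rewrite /dot big_ord_recr /= expr2; congr (_ + _).
by apply: eq_bigr => i _; rewrite !mxE.
Qed.

Lemma sphere_dot x : dot (val x) (val x) = 1.
Proof. by rewrite -enorm2 (eqP (valP x)) expr1n. Qed.

(** A multiple of the isotropic vector of the stereographic image that is an
    affine function of the point of the sphere. *)
Definition conevec x : V := (init (val x), 1 + last_coord (val x), 1 - last_coord (val x)).

Lemma stereoE x : st x = if last_coord (val x) == 1 then None
  else Some ((1 - last_coord (val x))^-1 *: init (val x)).
Proof.
rewrite /st -/(last_coord (val x)); case: ifP => // _; congr Some.
by apply/rowP => i; rewrite !mxE mulrC.
Qed.

Lemma conevec_stereo x : exists2 k, k != 0 & conevec x = k *: nullvec (st x).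
Proof.
have E := sphere_dot x; rewrite dot_init in E.
rewrite stereoE /conevec; case: eqP => [e|/eqP ne].
  exists 2; first by rewrite pnatr_eq0.
  have -> : init (val x) = 0.
    apply/eqP; rewrite -dot_eq0; apply/eqP; move: E; rewrite e expr1n; lra.
  rewrite e -[RHS]/(2 *: 0, 2 * 1, 2 * 0) scaler0; congr (_, _, _); ring.
have k0 : 1 - last_coord (val x) != 0 by rewrite subr_eq0 eq_sym.
exists (1 - last_coord (val x)) => //.
rewrite /nullvec -[RHS]/(_ *: _, _ * _, _ * _) scalerA divff // scale1r mulr1.
congr (_, _, _); rewrite dotZl dotZr; have -> : dot (init (val x)) (init (val x)) = 1 - last_coord (val x) ^+ 2 by lra.
by rewrite /=; field.
Qed.

Lemma stereo_inj : injective st.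
Proof.
move=> x y E; have [k k0 Ex] := conevec_stereo x; have [l l0 Ey] := conevec_stereo y.
have {}Ex : conevec x = (k / l) *: conevec y by rewrite Ex Ey E scalerA divfK.
have E2 : 1 + last_coord (val x) = (k / l) * (1 + last_coord (val y)) := congr1 (fun v : V => v.1.2) Ex.
have E3 : 1 - last_coord (val x) = (k / l) * (1 - last_coord (val y)) := congr1 snd Ex.
have kl : k / l = 1 by lra.
move: E2 Ex; rewrite kl mul1r scale1r => E2 /(congr1 (fun v : V => v.1.1)) /= E1.
by apply: val_inj; apply: init_inj => //; apply: (addrI 1).
Qed.

Definition snoc (p : 'rV[R]_m) (t : R) : 'rV[R]_m.+1 :=
  \row_i (if fintype.unlift ord_max i is Some j then p 0 j else t).
Lemma last_snoc p t : last_coord (snoc p t) = t.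
Proof. by rewrite /last_coord mxE unlift_none. Qed.
Lemma init_snoc p t : init (snoc p t) = p.
Proof.
apply/rowP => i; rewrite !mxE; have -> : widen_ord (leqnSn m) i = fintype.lift ord_max i.
  by apply: ord_inj; rewrite lift_max.
by rewrite liftK.
Qed.

Lemma stereo_surj (z : E) : exists x, st x = z.
Proof.
have on_sphere p t : dot p p + t ^+ 2 = 1 -> enorm (snoc p t) == 1.
  by move=> e; rewrite /enorm dot_init last_snoc init_snoc e sqrtr1.
have [x Ex] : exists x, exists2 k, k != 0 & conevec x = k *: nullvec z.
  case: z => [p|].
    have q0 : dot p p + 1 != 0 by rewrite gt_eqF // ltr_wpDl // dot_ge0.
    have e : dot ((2 / (dot p p + 1)) *: p) ((2 / (dot p p + 1)) *: p) + ((dot p p - 1) / (dot p p + 1)) ^+ 2 = 1.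
      by rewrite dotZl dotZr; field.
    exists (exist (fun X : 'rV[R]_m.+1 => is_true (enorm X == 1)) _ (on_sphere _ _ e)); exists (2 / (dot p p + 1)).
      by rewrite mulf_neq0 ?invr_neq0 ?pnatr_eq0.
    rewrite /conevec [val _]/= last_snoc init_snoc -[RHS]/(_ *: _, _ * _, _ * _).
    by congr (_, _, _); rewrite /=; field.
  have e : dot (0 : 'rV[R]_m) 0 + 1 ^+ 2 = 1 by rewrite dot0l add0r expr1n.
  exists (exist (fun X : 'rV[R]_m.+1 => is_true (enorm X == 1)) _ (on_sphere _ _ e)); exists 2; first by rewrite pnatr_eq0.
  rewrite /conevec [val _]/= last_snoc init_snoc -[RHS]/(2 *: 0, 2 * 1, 2 * 0) scaler0.
  by congr (_, _, _); ring.
have [k k0 Ek] := Ex; have [l l0 El] := conevec_stereo x.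
exists x; apply: (@nullvec_inj _ _ _ _ (l^-1 * k)).
by rewrite -scalerA -Ek El scalerA mulVf // scale1r.
Qed.

(** The linear part of [conevec], whose image is the hyperplane of height 0. *)
Definition chord X : V := (init X, last_coord X, - last_coord X).
Lemma chord_linear : linear chord.
Proof.
move=> k X Y; rewrite /chord -[RHS]/(_, _, _) /=; congr (_, _, _).
- by apply/rowP => i; rewrite !mxE.
- by rewrite /last_coord !mxE.
- by rewrite /last_coord !mxE /= /GRing.scale /=; ring.
Qed.
HB.instance Definition _ := GRing.isLinear.Build R 'rV[R]_m.+1 V *:%R chord chord_linear.

Definition height (v : V) : R^o := v.1.2 + v.2.
Lemma height_linear : linear height.
Proof. by move=> k u v; rewrite /height /= /GRing.scale /=; ring. Qed.
HB.instance Definition _ := GRing.isLinear.Build R V R^o *:%R height height_linear.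

Lemma conevecB x y : conevec x - conevec y = chord (val x - val y).
Proof.
rewrite /conevec /chord -[LHS]/(_, _, _) /=; congr (_, _, _).
- by apply/rowP => i; rewrite !mxE.
- by rewrite /last_coord !mxE; ring.
- by rewrite /last_coord !mxE; ring.
Qed.

Lemma mem_conevec (W : {vspace V}) x : (nullvec (st x) \in W) = (conevec x \in W).
Proof.
have [k k0 ->] := conevec_stereo x; apply/idP/idP; first exact: memvZ.
by move/(memvZ k^-1); rewrite scalerA mulVf // scale1r.
Qed.

Lemma height_conevec x : height (conevec x) = 2.
Proof. by rewrite /height /=; ring. Qed.

(** Differences of vectors [conevec] are values of the injective map [chord], so
    U is the preimage of the part of W of height 0. *)
Lemma sphere_section (W : {vspace V}) x0 : nullvec (st x0) \in W ->
  exists U : {vspace 'rV[R]_m.+1}, (\dim U).+1 = \dim W /\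
    forall x, (nullvec (st x) \in W) = (val x - val x0 \in U).
Proof.
move=> W0; pose f := linfun chord; pose h := linfun height.
pose W1 := (W :&: lker h)%VS.
have fh X : f X \in lker h.
  by rewrite memv_ker !lfunE /= /height /= addrN.
exists (f @^-1: W1)%VS; split; last first.
  move=> x; rewrite -memv_preim memv_cap fh andbT lfunE /= -conevecB mem_conevec.
  apply/idP/idP => H; first by rewrite memvB // -mem_conevec.
  by have := memvD H (_ : conevec x0 \in W); rewrite subrK; apply; rewrite -mem_conevec.
have lf : lker f = 0%VS.
  apply/eqP/lker0P => X Y; rewrite !lfunE /= => -[e1 e2 _]; exact: init_inj.
have sub : (W1 <= limg f)%VS.
  apply/subvP => -[[p s] t]; rewrite memv_cap memv_ker lfunE /= /height /= => /andP[_ /eqP st0].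
  have -> : (p, s, t) = f (snoc p s).
    by rewrite lfunE /= /chord last_snoc init_snoc; congr (_, _, _); apply/eqP; rewrite -addr_eq0 addrC st0.
  by rewrite memv_img ?memvf.
have dU : \dim (f @^-1: W1) = \dim W1.
  rewrite -{2}(lpreimK sub) limg_dim_eq // lf capv0 //.
have := limg_ker_dim h W; rewrite -/W1 dU => <-.
have -> : \dim (h @: W) = 1%N; last by rewrite addn1.
apply/eqP; rewrite eqn_leq; apply/andP; split.
  by apply: leq_trans (dimvS (subvf _)) _; rewrite dimvf.
rewrite lt0n dimv_eq0; apply/eqP => H.
have : h (conevec x0) \in (h @: W)%VS by rewrite memv_img // -mem_conevec.
by rewrite H memv0 lfunE /= height_conevec pnatr_eq0.
Qed.

Lemma section_span (p : 'rV[R]_m.+1) (U : {vspace 'rV[R]_m.+1}) : exists W : {vspace V},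
  (\dim W <= (\dim U).+1)%N /\ forall x, val x - p \in U -> nullvec (st x) \in W.
Proof.
pose q : V := chord p + (0, 1, 1); exists (linfun chord @: U + <[q]>)%VS; split.
  have [le _] := dimv_add_leqif (linfun chord @: U) <[q]>.
  apply: (leq_trans le); rewrite dim_vline -[(\dim U).+1]addn1 leq_add //; last by case: (_ != _).
  by rewrite -[X in (_ <= X)%N](limg_ker_dim (linfun chord)) leq_addl.
move=> x Hx; rewrite mem_conevec; have -> : conevec x = linfun chord (val x - p) + q.
  have -> : conevec x = chord (val x) + (0, 1, 1).
    rewrite /conevec /chord -[RHS]/(_, _, _) /=; congr (_, _, _).
    - by rewrite addr0.
    - by rewrite addrC.
    - by rewrite addrC.
  by rewrite lfunE /= linearB /= addrA subrK.
by rewrite memv_add ?memv_img ?memv_line.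
Qed.
End Stereo.

(** * Back to the spheres *)

Section Embed.
Variables (R : realType) (n : nat).

Lemma pad_snoc (p : 'rV[R]_2) : @pad R 1 n p = @pad R 2 n (snoc p 0).
Proof.
apply/rowP => i; rewrite !mxE; have [i2|i2] := ltnP i 2.
  have -> : inord i = fintype.lift ord_max (inord i : 'I_2) :> 'I_3.
    apply: ord_inj; rewrite lift_max !inordK //; exact: ltn_trans i2 _.
  by rewrite liftK (ltn_trans i2).
have [i3|i3] := ltnP i 3; last by [].
have -> : inord i = ord_max :> 'I_3.
  by apply: ord_inj; rewrite inordK //=; apply/eqP; rewrite eqn_leq -ltnS i3.
by rewrite unlift_none.
Qed.

Lemma snocE m (X : 'rV[R]_m.+1) : X = snoc (init X) (last_coord X).
Proof. by apply: init_inj; rewrite ?init_snoc ?last_snoc. Qed.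

(** The standard embedding of the 2-sphere differs from the embedding over the
    coordinate plane by the exchange of the third and last coordinates, which is
    an inversion of radius sqrt 2 in the stereographic chart; for n = 2 there is
    nothing to exchange. *)
Lemma embed_stereo : (1 < n)%N -> exists chi : Rinfty R n -> Rinfty R n, moeb chi /\
  forall y : sphere R 2, exists2 e : sphere R n, val e = embed3 n (val y) &
    stereographic e = chi (omap (@pad R 1 n) (stereographic y)).
Proof.
move=> n1; have [n3|n3] := leqP 3 n; last first.
  have {n3} E : n = 2 by apply/eqP; rewrite eqn_leq -ltnS n3.
  move: n1; rewrite E => _; exists id; split; first exact: moeb_id.
  move=> y; exists y.
    by apply/rowP => i; rewrite !mxE (ltn_ord i) inord_val.
  case: (stereographic y) => //= p; congr Some; apply/rowP => i.
  by rewrite !mxE (ltn_ord i) inord_val.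
have on_sphere (y : sphere R 2) : enorm (embed3 n (val y)) == 1.
  by rewrite /enorm (@dot_pad R 2 n.+1) ?sphere_dot ?sqrtr1 // ltnS; exact: leq_trans n3.
pose c := @pad R 2 n (snoc 0 1); have r0 : 0 < Num.sqrt 2 :> R by rewrite sqrtr_gt0 ltr0n.
exists (inversion c (Num.sqrt 2)); split; first exact: moeb_inversion.
move=> y; exists (exist (fun X : 'rV[R]_n.+1 => is_true (enorm X == 1)) _ (on_sphere y)) => //.
have last0 : last_coord (embed3 n (val y)) = 0.
  by rewrite /last_coord mxE /= ltnNge n3.
have initE : init (embed3 n (val y)) = @pad R 2 n (val y).
  by apply/rowP => i; rewrite !mxE.
rewrite [LHS]stereoE [val _]/= last0 initE eq_sym oner_eq0 subr0 invr1 scale1r.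
rewrite stereoE; set t := last_coord (val y); set q := init (val y).
have E : dot q q + t ^+ 2 = 1 by rewrite -dot_init sphere_dot.
rewrite [val y in LHS]snocE -/t -/q.
case: eqP => [t1|/eqP t1].
  have q0 : q = 0 by apply/eqP; rewrite -dot_eq0; apply/eqP; move: E; rewrite t1 expr1n; lra.
  by rewrite /= /c q0 t1.
have t10 : 1 - t != 0 by rewrite subr_eq0 eq_sym.
have d : dot ((1 - t)^-1 *: q) ((1 - t)^-1 *: q) + 1 = 2 / (1 - t).
  rewrite dotZl dotZr; have -> : dot q q = 1 - t ^+ 2 by lra.
  by field.
rewrite [omap _ _]/= pad_snoc.
have diff : @pad R 2 n (snoc ((1 - t)^-1 *: q) 0) - c = @pad R 2 n (snoc ((1 - t)^-1 *: q) (-1)).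
  rewrite /c; apply/rowP => i; rewrite !mxE; case: ifP => _; last by rewrite subr0.
  by case: (fintype.unlift _ _) => [j|]; rewrite ?mxE ?subr0 ?add0r.
have n2 : (2 < n)%N by [].
have dd : dot (@pad R 2 n (snoc ((1 - t)^-1 *: q) 0) - c) (@pad R 2 n (snoc ((1 - t)^-1 *: q) 0) - c) = 2 / (1 - t).
  by rewrite diff dot_pad // dot_init init_snoc last_snoc sqrrN expr1n d.
have nc : @pad R 2 n (snoc ((1 - t)^-1 *: q) 0) != c.
  by rewrite -subr_eq0 -dot_eq0 dd mulf_neq0 ?invr_eq0 ?pnatr_eq0.
rewrite /inversion (negbTE nc) expr_div_n enorm2 dd sqr_sqrtr ?ler0n //.
have -> : 2 / (2 / (1 - t)) = 1 - t by field.
congr Some; rewrite diff /c; apply/rowP => i; rewrite !mxE; case: ifP => _; last by rewrite mulr0 addr0.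
case: (fintype.unlift _ _) => [j|]; rewrite ?mxE; last by ring.
by rewrite add0r mulrA divff // mul1r.
Qed.
End Embed.

Section Transfer.
Variables (R : realType) (m : nat).
Local Notation st := (@stereographic R m).

Definition unstereo (z : Rinfty R m) : sphere R m := projT1 (cid (stereo_surj z)).
Lemma unstereoK z : st (unstereo z) = z.
Proof. exact: projT2 (cid (stereo_surj z)). Qed.
Lemma stereoK x : unstereo (st x) = x.
Proof. by apply: stereo_inj; rewrite unstereoK. Qed.

Lemma circle_through a b c : (0 < m)%N -> a != b -> a != c -> b != c ->
  is_circle [set w : sphere R m | conc a b c (st w)].
Proof.
move=> m0 ab ac bc; split; first by rewrite m0.
  have [|U [dU HU]] := @sphere_section R m (span3 a b c) (unstereo a).
    by rewrite unstereoK; exact: inb1.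
  exists (val (unstereo a)), U; split; first by move: dU; rewrite dim_span3 // => -[].
  by apply/seteqP; split=> w /=; rewrite -HU conc_span.
exists (unstereo a), (unstereo b); split => /=; rewrite ?unstereoK.
- by rewrite conc_span //; exact: inb1.
- by rewrite conc_span //; exact: inb2.
by move=> E; move: ab; rewrite -(unstereoK a) -(unstereoK b) E eqxx.
Qed.

Lemma circle_conc C x y z w : is_circle C -> C x -> C y -> C z -> C w ->
  conc (st x) (st y) (st z) (st w).
Proof.
case=> _ [p [U [dU ->]]] _ /= hx hy hz hw.
have [W [dW HW]] := section_span p U; rewrite dU in dW.
by apply: (conc_dim_le3 dW); exact: HW.
Qed.
End Transfer.

Section Main.
Variables (R : realType) (n : nat).
Hypothesis hn : (2 <= n)%N.
Variable T : sphere R 2 -> sphere R n.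
Hypotheses (hT : weakly_circle_preserving T) (hgen : circular_general_position (range T)).

Definition chart_map (z : Rinfty R 2) : Rinfty R n := stereographic (T (unstereo z)).

Lemma chart_conc : conc_preserving chart_map.
Proof.
move=> a b c d K.
have [E|ab] := eqVneq (chart_map a) (chart_map b); first by rewrite E conc_dup.
have [E|ac] := eqVneq (chart_map a) (chart_map c).
  by rewrite concC23 E conc_dup.
have [E|bc] := eqVneq (chart_map b) (chart_map c).
  by have K2 := conc_dup (chart_map b) (chart_map a) (chart_map d); rewrite -E; conc_by K2.
have ne x y : chart_map x != chart_map y -> x != y by apply: contra_neq => ->.
have Cc := @circle_through R 2 a b c isT (ne _ _ ab) (ne _ _ ac) (ne _ _ bc).
have [C' [C'c sub]] := hT Cc.
have inC z : conc a b c z -> C' (T (unstereo z)).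
  by move=> Kz; apply: sub; exists (unstereo z) => //=; rewrite unstereoK.
apply: (circle_conc C'c); apply: inC => //.
- by rewrite conc_span ?ne //; exact: inb1.
- by rewrite conc_span ?ne //; exact: inb2.
- by rewrite conc_span ?ne //; exact: inb3.
Qed.

Lemma chart_general : general chart_map.
Proof.
move=> a b c ab ac bc.
have [x [y [[s _ <-] [t _ <-] xy nx ny]]] := hgen (circle_through (ltnW hn) ab ac bc).
exists (stereographic s), (stereographic t); rewrite /chart_map !stereoK.
split; first by rewrite (inj_eq (@stereo_inj R n)); apply/eqP.
- exact/negP.
- exact/negP.
Qed.

Lemma chart_good : good chart_map.
Proof.
split; [exact: chart_conc|exact: chart_general|].
move=> A B C q ab ac bc; apply: (circle_infinite chart_conc chart_general) => //.
move=> s; apply: contrapT => ns.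
apply: (finite_absurd chart_conc chart_general (q := s) _ ab ac bc) => w.
by apply: contrapT => /negP ws; apply: ns; exists w.
Qed.
End Main.

Section Image.
Variables (R : realType) (n : nat).
Local Notation V2 := ('rV[R]_2 * R^o * R^o)%type.
Local Notation Vn := ('rV[R]_n * R^o * R^o)%type.
Local Notation plane_in := (@pad R 1 n).

HB.instance Definition _ := GRing.isLinear.Build R 'rV[R]_2 'rV[R]_n *:%R plane_in (@pad_linear R 1 n).

Definition pad_null (v : V2) : Vn := (plane_in v.1.1, v.1.2, v.2).
Lemma pad_null_linear : linear pad_null.
Proof. by move=> k u v; rewrite /pad_null /= linearP. Qed.
HB.instance Definition _ := GRing.isLinear.Build R V2 Vn *:%R pad_null pad_null_linear.

Lemma nullvec_pad (n1 : (1 < n)%N) (z : Rinfty R 2) : nullvec (omap plane_in z) = pad_null (nullvec z).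
Proof. by case: z => [z|] /=; rewrite /pad_null /= ?linear0 ?dot_pad. Qed.

Lemma pad_inj : (1 < n)%N -> injective plane_in.
Proof.
move=> n1 x y E; apply/eqP; rewrite -subr_eq0 -dot_eq0 -(@dot_pad R 1 n) // linearB /= E subrr.
by rewrite dot0l.
Qed.

Lemma dim_pad_null : (1 < n)%N -> \dim (limg (linfun pad_null)) = 4.
Proof.
move=> n1; have lk : lker (linfun pad_null) = 0%VS.
  by apply/eqP/lker0P => -[[u a] b] [[v c] d]; rewrite !lfunE /= => -[/(pad_inj n1) -> -> ->].
by rewrite limg_dim_eq ?lk ?capv0 // dimvf.
Qed.

Lemma mem_pad_null (z : Rinfty R n) : nullvec z \in limg (linfun pad_null) ->
  exists z' : Rinfty R 2, z = omap plane_in z'.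
Proof.
case/memv_imgP => -[[p s] t] _; rewrite lfunE /=; case: z => [z|] [E _ _]; last by exists None.
by exists (Some p); rewrite E.
Qed.

(** The plane consists of the points with isotropic vectors in a 4-dimensional
    subspace, and Moebius maps act linearly. *)
Lemma moebius_plane (theta : Rinfty R n -> Rinfty R n) : (1 < n)%N -> moeb theta ->
  exists W : {vspace Vn}, \dim W = 4 /\
    forall y, (nullvec y \in W) <-> exists z, y = theta (omap plane_in z).
Proof.
move=> n1 mt; have [L [kL HL]] := moebius_lorentz mt.
have [psi [mpsi K1 K2]] := moeb_inv mt.
exists (L @: limg (linfun pad_null))%VS; split.
  by rewrite limg_dim_eq ?kL ?capv0 // dim_pad_null.
move=> y; split; last first.
  case=> z ->; have [k k0 ->] := HL (omap plane_in z).
  by rewrite memvZ // memv_img // nullvec_pad // -(lfunE pad_null) memv_img ?memvf.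
have [k k0] := HL (psi y); rewrite K2 => -> H.
have : L (nullvec (psi y)) \in (L @: limg (linfun pad_null))%VS.
  by have := memvZ k^-1 H; rewrite scalerA mulVf // scale1r.
case/memv_imgP => v hv /(lker0P _ _)-/(_ (introT eqP kL)) E.
rewrite -E in hv; have [z Ez] := mem_pad_null hv.
by exists z; rewrite -Ez K2.
Qed.
End Image.

Theorem theorem1p7 (R : realType) (n : nat) (hn : (2 <= n)%N)
    (T : sphere R 2 -> sphere R n)
    (hT : weakly_circle_preserving T)
    (hgen : circular_general_position (range T))
    (hfive : (`I_5 #<= range T)%card) :
  is_msphere 2 (range T) /\ is_moebius_onto T (range T).
Proof.
have [psi [mpsi HT]] := standardize hn (chart_good hn hT hgen).
have {}HT x : psi (stereographic (T x)) = omap (@pad R 1 n) (stereographic x).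
  by rewrite -HT /chart_map stereoK.
have [theta [mtheta K1 K2]] := moeb_inv mpsi.
have Tst x : stereographic (T x) = theta (omap (@pad R 1 n) (stereographic x)).
  by rewrite -HT K1.
have [W [dW HW]] := moebius_plane hn mtheta.
have rangeW y : range T y <-> nullvec (stereographic y) \in W.
  rewrite HW; split=> [[x _ <-]|[z Ez]]; first by exists (stereographic x).
  exists (unstereo z) => //; apply: stereo_inj.
  by rewrite Tst unstereoK.
have Tinj x y : T x = T y -> x = y.
  move=> E; apply: stereo_inj; have := HT x; rewrite E HT.
  case: (stereographic x) (stereographic y) => [p|] [q|] //= [/(pad_inj hn) ->] //.
have n02 : unstereo None <> unstereo (Some 0) :> sphere R 2.
  by move=> /(congr1 (@stereographic R 2)); rewrite !unstereoK.
split.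
  split=> //.
    have [|U [dU HU]] := @sphere_section R n W (T (unstereo None)).
      by apply/rangeW; exists (unstereo None).
    exists (val (T (unstereo None))), U; split; first by move: dU; rewrite dW => -[].
    by apply/seteqP; split=> y /=; rewrite -HU => /rangeW.
  exists (T (unstereo None)), (T (unstereo (Some 0))); split; try by eexists.
  by move/Tinj.
have [chi [mchi Hchi]] := embed_stereo R hn.
pose g x := unstereo (chi (psi (stereographic x))).
have gT x : val (g (T x)) = embed3 n (val x).
  have [e <- Ee] := Hchi x; congr val; apply: stereo_inj.
  by rewrite /g unstereoK HT Ee.
split.
  by split=> // x y _ _; exact: Tinj.
exists g, id; split => //.
- exists (chi \o psi); split; first exact: moeb_comp.
  by move=> x; rewrite /g unstereoK.
- apply/seteqP; split=> [y [_ [x _ <-] <-] i i3|y Hy].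
    by rewrite gT mxE ltnNge i3.
  pose y' : 'rV[R]_3 := \row_j val y 0 (inord j).
  have Ey : val y = embed3 n y'.
    apply/rowP => j; rewrite !mxE; have [j3|j3] := ltnP j 3; last exact: Hy.
    by rewrite inordK // inord_val.
  have y'1 : enorm y' == 1.
    by have := valP y; rewrite /= Ey /enorm (@dot_pad R 2 n.+1) // ltnS.
  pose x : sphere R 2 := exist (fun X : 'rV[R]_3 => is_true (enorm X == 1)) _ y'1.
  exists (T x); first by exists x.
  by apply: val_inj; rewrite gT Ey.
- by exists id; split; [exact: moeb_id|].
Qed.
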